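(* Let $\mathcal P_{\mathbf p^t}$ and $\Pi^1_{\mathbf p^t}$ be the integrated Thomée operator and the piecewise $H^1$ projector in time defined in the context. Then, for all $w\in H^{s+1}(I_n;\mathcal X)$ with $s\ge1$, $$\|w-\mathcal P_{\mathbf p^t}w\|_{L^2(I_n;\mathcal X)}\lesssim\|w-\Pi^1_{\mathbf p^t}w\|_{L^2(I_n;\mathcal X)}+\frac{\tau_n^2}{(p_n^t)^2}\|w''\|_{L^2(I_n;\mathcal X)}\qquad\forall n=1,\dots,N.$$ Since $\mathcal P_{\mathbf p^t}$ preserves polynomials in time of order $p_n^t$, one also has, for all $n=1,\dots,N$, $$\begin{aligned}\|w-\mathcal P_{\mathbf p^t}w\|_{L^2(I_n;\mathcal X)}&\lesssim\inf_{q\in\mathbb P_{p_n^t}(I_n;\mathcal X)}\Big(\frac{\tau_n}{p_n^t}\|(w-q)'\|_{L^2(I_n;\mathcal X)}+\frac{\tau_n^2}{(p_n^t)^2}\|(w-q)''\|_{L^2(I_n;\mathcal X)}\Big)\\&\lesssim\Big(\frac{\tau_n}{p_n^t}\Big)^{\min(s,p_n^t)+1}\|w^{(s+1)}\|_{L^2(I_n;\mathcal X)} .\end{aligned}$$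
   Context: $\mathcal X$ is a Hilbert space. Time grid: $0=t_0<t_1<\dots<t_N=T$, $I_n:=(t_{n-1},t_n]$, $\tau_n:=t_n-t_{n-1}$, with polynomial degrees $p_n^t\ge2$, $\mathbf p^t=(p_1^t,\dots,p_N^t)$. $\mathbb P_q(I_n;\mathcal X)$ is the space of $\mathcal X$-valued polynomials in time of degree at most $q$ on $I_n$. Primes and superscripts $(r)$ denote time derivatives; Bochner spaces $H^r(I_n;\mathcal X)$ of noninteger order are constructed by interpolation. Integrated Thomée operator $\mathcal P_{\mathbf p^t}$: on each $I_n$, $\mathcal P_{\mathbf p^t}(w)\in\mathbb P_{p_n^t}(I_n;\mathcal X)$ is the unique polynomial with $$(w'-\mathcal P_{\mathbf p^t}(w)',q)_{L^2(I_n;\mathcal X)}=0\quad\forall q\in\mathbb P_{p_n^t-2}(I_n;\mathcal X),\qquad \mathcal P_{\mathbf p^t}(w)'(t_n^-,\cdot)=w'(t_n,\cdot),\qquad \mathcal P_{\mathbf p^t}(w)(t_{n-1},\cdot)=w(t_{n-1},\cdot)\ \text{ in }\mathcal X.$$ Equivalently: $(w-\mathcal P_{\mathbf p^t}(w),q)_{L^2(I_n;\mathcal X)}=0$ for all $q\in\mathbb P_{p_n^t-3}(I_n;\mathcal X)$ (no condition if $p_n^t=2$), $\mathcal P_{\mathbf p^t}(w)'(t_n^-,\cdot)=w'(t_n,\cdot)$, and $\mathcal P_{\mathbf p^t}(w)=w$ at $t_n$ and at $t_{n-1}$. Piecewise $H^1$ projector $\Pi^1_{\mathbf p^t}$: on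 each $I_n$, $\Pi^1_{\mathbf p^t}w\in\mathbb P_{p_n^t}(I_n;\mathcal X)$ satisfies $((w-\Pi^1_{\mathbf p^t}w)',q')_{L^2(I_n;\mathcal X)}=0$ for all $q\in\mathbb P_{p_n^t}(I_n;\mathcal X)$ and $(w-\Pi^1_{\mathbf p^t}w)(t_{n-1},\cdot)=0$ in $\mathcal X$. $A\lesssim B$ means $A\le CB$ with a constant $C>0$ independent of $w$, the time steps and the polynomial degrees.
   Formalization: In the last bound the derivative of w has order min(s,p)+1 instead of s+1; the two agree for s ≤ p, and for s > p the printed bound fails, e.g. for w a polynomial of degree p+1 and s = p+1, where w^{(s+1)} = 0 but the infimum is positive. *)

(* Defs.v *)
From HB Require Import structures.
From mathcomp Require Import all_boot all_order all_algebra.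
From mathcomp Require Import all_classical all_reals all_analysis.

Set Implicit Arguments.
Unset Strict Implicit.
Unset Printing Implicit Defensive.

Import Order.TTheory GRing.Theory Num.Theory.
Import numFieldNormedType.Exports.

Local Open Scope classical_set_scope.
Local Open Scope ring_scope.

Definition time_grid (R : realType) (T : R) (N : nat) (t : nat -> R) : Prop :=
  [/\ t 0%N = 0, t N = T & forall n, (n < N)%N -> t n < t n.+1].

(* Polynomials in time with values in X; they are functions on the whole line,
   so that one-sided values at the ends of an interval are ordinary values. *)
Definition polyT (R : realType) (X : completeNormedModType R) (q : nat) :
    set (R -> X) :=
  [set u | exists c : 'I_q.+1 -> X,
           u = fun t : R => \sum_(i < q.+1) t ^+ i *: c i].
Arguments polyT {R} X q.

Section Bochner.
Context (R : realType) (X : completeNormedModType R).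
(* The inner product of X. That it induces the norm of X is a hypothesis of
   the statements in which these definitions are used. *)
Variable dot : {dot X for idfun}.
(* All spaces below are over the interval (a, b]. *)
Variables a b : R.

Local Notation mu := (@lebesgue_measure R).

Definition simple_fun (f : R -> X) : Prop :=
  exists (k : nat) (A : 'I_k -> set R) (x : 'I_k -> X),
    (forall i, measurable (A i)) /\
    f = fun t => \sum_(i < k) (\1_(A i) t : R) *: x i.

Definition strongly_measurable (f : R -> X) : Prop :=
  exists u : nat -> R -> X, (forall k, simple_fun (u k)) /\
    forall t, t \in `]a, b] -> u k t @[k --> \oo] --> f t.

Definition L2norm (f : R -> X) : \bar R :=
  ((\int[mu]_(t in `]a, b]) ((`|f t| ^+ 2)%:E)) `^ (2^-1))%E.

Definition L2 : set (R -> X) :=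
  [set f | strongly_measurable f /\ (L2norm f < +oo)%E].

Definition L2dot (f g : R -> X) : R := \int[mu]_(t in `]a, b]) dot (f t) (g t).

(* Test functions are C^1 with compact support in the open interval; by
   mollification this gives the same weak derivatives as smooth ones. *)
Definition C1c : set (R -> R) :=
  [set phi : R -> R | [/\ forall t : R, derivable phi t 1,
     continuous (derive1 phi) &
     exists c d : R, [/\ a < c, d < b & forall t, t \notin `[c, d] -> phi t = 0]]].

(* g is the weak derivative of w. Testing against the X-valued functions
   phi(t) x, with x in X, is the identity int w phi' = - int g phi in X,
   written componentwise. *)
Definition is_wder (w g : R -> X) : Prop :=
  forall (phi : R -> R) (x : X), C1c phi ->
    L2dot w (fun t => derive1 phi t *: x) = - L2dot g (fun t => phi t *: x).

Fixpoint sobolevn (m : nat) : set (R -> X) :=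
  if m is m'.+1
  then [set w | L2 w /\ exists g, is_wder w g /\ sobolevn m' g]
  else L2.

(* The square integrable weak derivative (unique almost everywhere). *)
Definition wder (w : R -> X) : R -> X :=
  xget (fun=> 0) [set g | L2 g /\ is_wder w g].

Definition wdern (k : nat) (w : R -> X) : R -> X := iter k wder w.

(* The continuous representative of w on [a, b], through which the point
   values of H^1 functions, one-sided at a and b, are defined. *)
Definition crep (w : R -> X) : R -> X :=
  xget (fun=> 0)
    [set c | {within `[a, b], continuous c} /\
             {ae mu, forall t : R, `]a, b]%classic t -> c t = w t}].

Definition seminormn (m : nat) (w : R -> X) : \bar R := L2norm (wdern m w).

Definition normn (m : nat) (w : R -> X) : \bar R :=
  ((\sum_(k < m.+1) seminormn k w ^+ 2) `^ (2^-1))%E.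

(* K-functional of the couple (H^m, H^(m+1)), the sizes of the two parts of
   a decomposition of w being measured by N m and N (m+1). *)
Definition Kfun (N : nat -> (R -> X) -> \bar R) (m : nat) (h : R) (w : R -> X) :
    \bar R :=
  ereal_inf [set (N m (w \- v)%R + h%:E * N m.+1 v)%E | v in sobolevn m.+1].

(* Real interpolation with fine index 2. *)
Definition interpolate (N : nat -> (R -> X) -> \bar R) (m : nat) (theta : R)
    (w : R -> X) : \bar R :=
  ((\int[mu]_(h in `]0%R, +oo[)
      ((h `^ (- (2 * theta) - 1))%:E * Kfun N m h w ^+ 2)) `^ (2^-1))%E.

Definition frac_part (r : R) : R := r - (Num.truncn r)%:R.

Definition sobolev (r : R) : set (R -> X) :=
  [set w | sobolevn (Num.truncn r) w /\
     (frac_part r != 0 ->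
        (interpolate normn (Num.truncn r) (frac_part r) w < +oo)%E)].

(* The L^2 norm of w^(r); for noninteger r this is the interpolation seminorm
   of w^(m) between L^2 and H^1, where m is the integer part of r. *)
Definition seminorm (r : R) (w : R -> X) : \bar R :=
  if frac_part r == 0 then seminormn (Num.truncn r) w
  else interpolate seminormn (Num.truncn r) (frac_part r) w.

Definition is_thomee (p : nat) (w u : R -> X) : Prop :=
  [/\ polyT X p u,
      forall q, polyT X (p - 2) q -> L2dot (wder w \- derive1 u) q = 0,
      derive1 u b = crep (wder w) b &
      u a = crep w a].

Definition thomee (p : nat) (w : R -> X) : R -> X :=
  xget (fun=> 0) [set u | is_thomee p w u].

Definition is_H1proj (p : nat) (w u : R -> X) : Prop :=
  [/\ polyT X p u,
      forall q, polyT X p q -> L2dot (wder (w \- u)) (derive1 q) = 0 &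
      crep (w \- u) a = 0].

Definition H1proj (p : nat) (w : R -> X) : R -> X :=
  xget (fun=> 0) [set u | is_H1proj p w u].

End Bochner.

(* Main.v *)
Require Import Defs.
From HB Require Import structures.
From mathcomp Require Import all_boot all_order all_algebra.
From mathcomp Require Import all_classical all_reals all_analysis.
From mathcomp Require Import measurable_realfun.
From mathcomp Require Import ring lra zify.

Set Implicit Arguments.
Unset Strict Implicit.
Unset Printing Implicit Defensive.

Import Order.TTheory GRing.Theory Num.Theory.
Import numFieldNormedType.Exports.

Local Open Scope classical_set_scope.
Local Open Scope ring_scope.

(** Everything happens on one interval ]a, b] of length tau, with degree p, and
    rests on the Legendre expansion of w'. The H^1 projection is the primitive,
    with value w(a) at a, of the part of degree less than p of this expansion.
    The derivative of the Thomee polynomial has the same coefficients up to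
    degree p-2, while its last one is fixed by the value of w' at b. Since the
    Legendre polynomials have the value 1 at b, the two polynomials differ by
    the primitive of the Legendre polynomial of degree p-1 times the trace at b
    of the projection error of w' (thpoly_H1poly). Integrating by parts against
    a suitable polynomial bounds this trace by (tau/p)^(1/2) times the norm of
    w'', and the primitive has a norm of order (tau/p)^(3/2); this is the first
    inequality (nrm_correction).

    The trace of the projection error does not change when a polynomial is
    subtracted from w', so w'' may be replaced with (w - q)'' for every q of
    degree p. The error of the H^1 projection is the primitive of a function
    that is orthogonal to all polynomials of degree less than p, and such a
    primitive gains a factor of order tau/p (nrm_prim_lorth). This is the second
    inequality.

    For the third one, q is obtained by integrating twice the projection of w''
    (exists_polyT), which leaves the best approximation error of w'' in L^2.
    Each further derivative gains a factor of order tau/p, since the best error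
    of f is at most tau/n times the best error of f' in degree one less
    (bestL2_H1, bestL2_wdern). The factors involve a factorial of the number of
    derivatives, which s bounds. When the order is not an integer, the best
    error of the last derivative is bounded by its K-functional at tau/p, and
    the interpolation seminorm controls it because the K-functional increases with
    its argument (interpolate_ge).

    The factor tau/n itself comes from Parseval's identity and the relation
    between the Legendre moments of f and of f' that integrating by parts gives
    (mom_H1, nrm_sub_lproj_H1). Instead of the completeness of the Legendre
    polynomials, a Hilbert-Schmidt bound for the operator of integration
    controls the remainder of Parseval's identity (sqr_nrm_prim_defect).

    Weak derivatives enter only through the representation of w as a constant
    plus the primitive of its weak derivative (wder_repr), which follows from
    the lemma of du Bois-Reymond applied to the components of w. *)

(** * Hilbert space algebra *)

Section InnerProduct.
Context (R : realType) (X : completeNormedModType R) (dot : {dot X for idfun}).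

Lemma dotC x y : dot x y = dot y x.
Proof. by have := hermC dot x y; rewrite expr0 mul1r. Qed.
Lemma dotDl x y z : dot (x + y) z = dot x z + dot y z.
Proof. by rewrite linearDl. Qed.
Lemma dotDr x y z : dot z (x + y) = dot z x + dot z y.
Proof. by rewrite linearD. Qed.
Lemma dotZl c x y : dot (c *: x) y = c * dot x y.
Proof. by rewrite linearZl_LR. Qed.
Lemma dotZr c x y : dot x (c *: y) = c * dot x y.
Proof. by rewrite linearZ. Qed.
Lemma dotNl x y : dot (- x) y = - dot x y.
Proof. by rewrite linearNl. Qed.
Lemma dotNr x y : dot x (- y) = - dot x y.
Proof. by rewrite linearN. Qed.
Lemma dotBl x y z : dot (x - y) z = dot x z - dot y z.
Proof. by rewrite dotDl dotNl. Qed.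
Lemma dotBr x y z : dot z (x - y) = dot z x - dot z y.
Proof. by rewrite dotDr dotNr. Qed.
Lemma dot0l x : dot 0 x = 0.
Proof. by rewrite -(subrr x) dotBl subrr. Qed.
Lemma dot0r x : dot x 0 = 0.
Proof. by rewrite dotC dot0l. Qed.
Lemma dot_suml I (r : seq I) (P : pred I) (F : I -> X) y :
  dot (\sum_(i <- r | P i) F i) y = \sum_(i <- r | P i) dot (F i) y.
Proof.
by apply: (big_morph (dot^~ y)) => [u v|]; [exact: dotDl|exact: dot0l].
Qed.
Lemma dot_sumr I (r : seq I) (P : pred I) (F : I -> X) y :
  dot y (\sum_(i <- r | P i) F i) = \sum_(i <- r | P i) dot y (F i).
Proof. by rewrite dotC dot_suml; apply: eq_bigr => i _; rewrite dotC. Qed.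

Hypothesis hdot : forall x : X, dot x x = `|x| ^+ 2.

Lemma dot_le x y : `|dot x y| <= `|x| * `|y|.
Proof.
have [->|y0] := eqVneq y 0; first by rewrite dot0r !normr0 mulr0.
have y2 : 0 < `|y| ^+ 2 by rewrite exprn_gt0// normr_gt0.
have : 0 <= dot (`|y| ^+ 2 *: x - dot x y *: y) (`|y| ^+ 2 *: x - dot x y *: y).
  by rewrite hdot exprn_ge0.
have -> : dot (`|y| ^+ 2 *: x - dot x y *: y) (`|y| ^+ 2 *: x - dot x y *: y) =
   `|y| ^+ 2 * ((`|x| * `|y|) ^+ 2 - `|dot x y| ^+ 2).
  rewrite real_normK ?num_real// !(dotBl, dotBr) !(dotZl, dotZr) (dotC y x) !hdot.
  by ring.
rewrite pmulr_rge0// subr_ge0 => h.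
by rewrite -(@ler_pXn2r _ 2)// nnegrE mulr_ge0.
Qed.

Lemma dot_inj x y : (forall z, dot x z = dot y z) -> x = y.
Proof.
move=> h; apply/eqP; rewrite -subr_eq0 -normr_eq0 -sqrf_eq0 -hdot.
by rewrite dotBl h subrr.
Qed.

Lemma sqr_normD x y : `|x + y| ^+ 2 = `|x| ^+ 2 + 2 * dot x y + `|y| ^+ 2.
Proof. by rewrite -!hdot !(dotDl, dotDr) (dotC y x); ring. Qed.

Lemma cvg_dotl (u : nat -> X) x y : u n @[n --> \oo] --> x ->
  dot (u n) y @[n --> \oo] --> dot x y.
Proof.
move=> /cvgrPdist_lt ux; apply/cvgrPdist_le => e e0.
have y1 : 0 < `|y| + 1 by rewrite ltr_wpDl.
have [N _ hN] := ux _ (divr_gt0 e0 y1).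
exists N => // n /hN /= /ltW h; rewrite -dotBl; apply: le_trans (dot_le _ _) _.
rewrite (le_trans (ler_wpM2r _ h))// mulrAC ler_pdivrMr//.
by rewrite ler_wpM2l ?ltW// ltrDl.
Qed.

(** Existence goes through a minimising sequence of |x|^2 - 2 phi x: by the
    parallelogram identity it is a Cauchy sequence. *)
Lemma riesz (phi : X -> R) (M : R) :
  (forall x y, phi (x + y) = phi x + phi y) ->
  (forall c x, phi (c *: x) = c * phi x) ->
  (forall x, `|phi x| <= M * `|x|) -> exists v, forall x, dot v x = phi x.
Proof.
move=> phiD phiZ phiM.
pose J x : R := `|x| ^+ 2 - 2 * phi x.
have JM x : - M ^+ 2 <= J x.
  have h : phi x <= M * `|x| by exact: le_trans (ler_norm _) (phiM x).
  have := sqr_ge0 (`|x| - M); rewrite /J => h2; nra.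
have hJ : has_inf (range J).
  by split; [exists (J 0), 0|exists (- M ^+ 2) => _ [x _ <-]].
pose m := inf (range J).
have mJ x : m <= J x by apply: ge_inf; [exact: hJ.2|exists x].
have /choice[u uP] (n : nat) : exists x, J x < m + harmonic n.
  have [_ [x _ <-] h] := inf_adherent (harmonic_gt0 n) hJ; by exists x.
have JD t x y : J (x + t *: y) =
    J x + t * (2 * (dot x y - phi y)) + t ^+ 2 * `|y| ^+ 2.
  rewrite /J sqr_normD dotZr normrZ phiD phiZ exprMn real_normK ?num_real//.
  by ring.
(* The best step in the direction y lowers J by the left-hand side over |y|^2. *)
have uN n y : (dot (u n) y - phi y) ^+ 2 <= harmonic n * `|y| ^+ 2.
  have [y0|y0] := eqVneq y 0.
    have := phiZ 0 y; rewrite mul0r scale0r => p0.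
    by rewrite y0 p0 dot0r subrr normr0 expr0n mulr0.
  have y2 : 0 < `|y| ^+ 2 by rewrite exprn_gt0// normr_gt0.
  have := mJ (u n + (- (dot (u n) y - phi y) / `|y| ^+ 2) *: y).
  rewrite JD; move: (uP n); set d := dot _ _ - _; set q : R := `|y| ^+ 2 in y2 *.
  move=> h1 h2.
  have e : - d / q * (2 * d) + (- d / q) ^+ 2 * q = - (d ^+ 2 / q).
    by field; rewrite gt_eqF.
  rewrite -ler_pdivrMr//; rewrite -addrA e in h2; clear -h1 h2.
  rewrite -subr_ge0; move: h1 h2; move: (d ^+ 2 / q) (J (u n)) (harmonic n).
  by move=> x z t; lra.
have ucauchy n k : `|u n - u k| ^+ 2 <= 2 * (harmonic n + harmonic k).
  have h := mJ (2^-1 *: (u n + u k)).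
  have e : J (2^-1 *: (u n + u k)) =
      2^-1 * (J (u n) + J (u k)) - 4^-1 * `|u n - u k| ^+ 2.
    rewrite /J phiZ phiD normrZ ger0_norm// exprMn sqr_normD.
    have := sqr_normD (u n) (- u k); rewrite normrN dotNr => ->.
    by field.
  by have := uP n; have := uP k; lra.
have /cauchy_cvgP : cauchy (u n @[n --> \oo]).
  apply: cauchy_exP => e e0.
  have e2 : 0 < e ^+ 2 / 4 by rewrite divr_gt0// exprn_gt0.
  have [N _ hN] := @cvgr_lt R _ _ eventually_filter _ _ (@cvg_harmonic R) _ e2.
  exists (u N), N => // n /= Nn; rewrite -ball_normE /ball_ /=.
  rewrite -(@ltr_pXn2r _ 2)// ?nnegrE//; last exact: ltW.
  apply: (le_lt_trans (ucauchy N n)).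
  by have := hN n Nn; have := hN N (leqnn _); lra.
move=> ucvg; exists (lim (u n @[n --> \oo])) => y.
have h1 := cvg_dotl (y := y) ucvg.
suff h2 : dot (u n) y @[n --> \oo] --> phi y by exact: (cvg_unique _ h1 h2).
apply/cvgrPdist_lt => e e0.
have y1 : 0 < `|y| ^+ 2 + 1 by rewrite ltr_wpDl// exprn_ge0.
have e2 : 0 < e ^+ 2 / (`|y| ^+ 2 + 1) by rewrite divr_gt0// exprn_gt0.
have [N _ hN] := @cvgr_lt R _ _ eventually_filter _ _ (@cvg_harmonic R) _ e2.
exists N => // n /= /hN; rewrite distrC => h.
rewrite -(@ltr_pXn2r _ 2)// ?nnegrE//; last exact: ltW.
rewrite real_normK ?num_real//; apply: (le_lt_trans (uN n y)).
move: h; rewrite ltr_pdivlMr// => h.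
have := @harmonic_gt0 R n; move: (harmonic n) (`|y| ^+ 2) h => i q h i0.
by rewrite (le_lt_trans _ h)// mulrDr mulr1 lerDl ltW.
Qed.
End InnerProduct.

(** * Strong measurability and square integrability *)

Section SimpleFunctions.
Import HBSimple.
Context (R : realType) (X : completeNormedModType R).
Implicit Types (f g u : R -> X) (phi : R -> R).
Local Notation simple := (@simple_fun R X).

Lemma simple_indic (A : set R) (x : X) :
  measurable A -> simple (fun t => \1_A t *: x).
Proof.
move=> mA; exists 1%N, (fun=> A), (fun=> x); split=> //.
by apply/funext => t; rewrite big_ord1.
Qed.

Lemma simpleD u v : simple u -> simple v -> simple (fun t => u t + v t).
Proof.
move=> [k [A [x [mA ->]]]] [l [B [y [mB ->]]]].
exists (k + l)%N, (fun i => match fintype.split i with inl j => A j | inr j => B j end),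
  (fun i => match fintype.split i with inl j => x j | inr j => y j end); split.
  by move=> i; case: (fintype.split i).
apply/funext => t; rewrite big_split_ord /=.
by congr (_ + _); apply: eq_bigr => i _;
  rewrite -/(unsplit (inl i)) -/(unsplit (inr i)) unsplitK.
Qed.

Lemma simple0 : simple (fun=> 0).
Proof.
have := @simple_indic set0 0 measurable0; congr (simple _).
by apply/funext => t; rewrite scaler0.
Qed.

Lemma simple_sum (I : Type) (s : seq I) (F : I -> R -> X) :
  (forall i, simple (F i)) -> simple (fun t => \sum_(i <- s) F i t).
Proof.
move=> sF; elim: s => [|i s ih].
  by under eq_fun do rewrite big_nil; exact: simple0.
by under eq_fun do rewrite big_cons; exact: simpleD.
Qed.

Lemma simpleZ (phi : {sfun R >-> R}) u : simple u -> simple (fun t => phi t *: u t).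
Proof.
move=> [k [A [x [mA ->]]]].
have -> : (fun t => phi t *: \sum_(i < k) \1_(A i) t *: x i) = fun t =>
    \sum_(i <- index_enum 'I_k) \sum_(y <- finmap.enum_fset (fset_set (range phi)))
      \1_(A i `&` phi @^-1` [set y]) t *: (y *: x i).
  apply/funext => t; rewrite scaler_sumr; apply: eq_bigr => i _.
  rewrite {1}fimfunE fsbig_finite//= scaler_suml.
  by apply: eq_bigr => y _; rewrite !scalerA indicI /=; congr (_ *: _); ring.
apply: simple_sum => i; apply: simple_sum => y; apply: simple_indic.
exact: measurableI.
Qed.

End SimpleFunctions.

Section StrongMeasurability.
Import HBSimple.
Context (R : realType) (X : completeNormedModType R) (a b : R).
Implicit Types (f g u : R -> X) (phi : R -> R).
Local Notation sm := (@strongly_measurable R X a b).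
Local Notation D := [set` `]a, b]].

Lemma sm_eq f g : (forall t, t \in `]a, b] -> f t = g t) -> sm f -> sm g.
Proof. by move=> fg [u [su uf]]; exists u; split=> // t tab; rewrite -fg //; exact: uf. Qed.

Lemma sm_simple f : simple_fun f -> sm f.
Proof. by move=> sf; exists (fun=> f); split=> // t _; exact: cvg_cst. Qed.

Lemma smD f g : sm f -> sm g -> sm (fun t => f t + g t).
Proof.
move=> [u [su uf]] [v [sv vg]]; exists (fun k t => u k t + v k t); split.
  by move=> k; exact: simpleD.
by move=> t tab; apply: cvgD; [exact: uf|exact: vg].
Qed.

Lemma smZ phi f : measurable_fun D phi -> sm f -> sm (fun t => phi t *: f t).
Proof.
move=> mphi [u [su uf]].
have mD : measurable D by exact: measurable_itv.
have mphiE : measurable_fun D (EFin \o phi) by exact/measurable_EFinP.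
have [h hphi] := approximation_sfun mD mphiE.
exists (fun k t => h k t *: u k t); split; first by move=> k; exact: simpleZ.
move=> t tab; apply: cvgZ; last exact: uf.
exact: (fine_cvg (hphi t tab)).
Qed.

Lemma sm_cst x : sm (fun=> x).
Proof.
have := @simple_indic _ _ setT x (@measurableT _ _) => /sm_simple; apply: sm_eq.
by move=> t _; rewrite indicT scale1r.
Qed.

Lemma smN f : sm f -> sm (fun t => - f t).
Proof.
move=> sf; have := smZ (@measurable_cst _ _ _ _ D (-1 : R)) sf; apply: sm_eq => t _.
by rewrite scaleN1r.
Qed.

Lemma smB f g : sm f -> sm g -> sm (fun t => f t - g t).
Proof. by move=> sf sg; apply: smD => //; exact: smN. Qed.

End StrongMeasurability.

Section Continuous.
Import HBSimple.
Context (R : realType) (X : completeNormedModType R) (a b : R).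
Hypothesis ab : a < b.

Lemma within_continuousP (c : R -> X) : {within `[a, b], continuous c} ->
  forall t, t \in `[a, b] -> forall e, 0 < e -> exists2 d, 0 < d &
    forall r, r \in `[a, b] -> `|t - r| < d -> `|c t - c r| < e.
Proof.
move=> /subspace_continuousP cc t tab e e0.
have /cvgrPdist_lt/(_ _ e0) := cc t tab.
by move=> [d d0 h]; exists d => // r rab tr; apply: h.
Qed.

(** Step functions on the partition of ]a, b] into equal subintervals
    approximate a continuous function at every point. *)
Lemma sm_continuous (c : R -> X) : {within `[a, b], continuous c} ->
  strongly_measurable a b c.
Proof.
move=> cc; have ba0 : 0 < b - a by rewrite subr_gt0.
pose p k i : R := a + i%:R * ((b - a) / k.+1%:R).
have pS k i : p k i.+1 = p k i + (b - a) / k.+1%:R.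
  by rewrite /p -natr1; ring.
have pk k : p k k.+1 = b by rewrite /p mulrC divfK ?pnatr_eq0// addrC subrK.
have h0 k : 0 < (b - a) / k.+1%:R by rewrite divr_gt0.
have pmono k : {homo p k : i j / (i <= j)%N >-> i <= j}.
  by move=> i j ij; rewrite lerD2l ler_pM2r// ler_nat.
exists (fun k t => \sum_(i < k.+1) \1_([set` `]p k i, p k i.+1]]) t *: c (p k i.+1)).
split.
  by move=> k; apply: simple_sum => i; apply: simple_indic; exact: measurable_itv.
move=> t tab; apply/cvgrPdist_lt => e e0.
have tab' : t \in `[a, b] by move: tab; rewrite !in_itv/= => /andP[/ltW-> ->].
have [d d0 hd] := within_continuousP cc tab' e0.
have [N _ hN] := @cvgr_lt R _ _ eventually_filter _ _ (@cvg_harmonic R) _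
  (divr_gt0 d0 ba0).
exists N => // k /hN kd.
have hk : (b - a) / k.+1%:R < d by rewrite mulrC -ltr_pdivlMr.
have ex : exists j, t <= p k j by exists k.+1; rewrite pk; move: tab; rewrite in_itv/= => /andP[].
have [j tj jmin] := ex_minnP ex.
case: j tj jmin => [|j] tj jmin.
  by move: tab tj; rewrite in_itv/= /p mul0r addr0 => /andP[/lt_le_trans h _] /h; rewrite ltxx.
have jt : p k j < t.
  by rewrite ltNge; apply/negP => /jmin; rewrite ltnn.
have jk : (j < k.+1)%N.
  by apply: jmin; rewrite pk; move: tab; rewrite in_itv/= => /andP[].
rewrite (bigD1 (Ordinal jk))//= big1 ?addr0; last first.
  move=> i ij; rewrite indicE memNset ?scale0r//= in_itv/= => /andP[it ti].
  move/eqP: ij; apply; apply/val_inj => /=; apply/eqP; rewrite eqn_leq.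
  apply/andP; split; rewrite leqNgt; apply/negP => /(pmono k) h.
    by have := lt_le_trans it tj => /lt_le_trans/(_ h); rewrite ltxx.
  by have := lt_le_trans jt ti => /lt_le_trans/(_ h); rewrite ltxx.
rewrite indicE mem_set/= ?in_itv/= ?jt ?tj// scale1r; apply: hd.
  have a_t : a <= t by move: tab'; rewrite in_itv/= => /andP[].
  have : p k j.+1 <= p k k.+1 by exact: pmono.
  by rewrite pk in_itv/= (le_trans a_t tj) => ->.
by rewrite distrC ger0_norm ?subr_ge0// (le_lt_trans _ hk)// pS lerBlDr addrC lerD2l ltW.
Qed.
End Continuous.

Section AlmostEverywhere.
Context (R : realType).
Local Notation mu := (@lebesgue_measure R).
Implicit Types P Q S : R -> Prop.

Lemma aeS P Q : (forall t, P t -> Q t) ->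
  {ae mu, forall t, P t} -> {ae mu, forall t, Q t}.
Proof. by move=> h; apply: filterS; first exact: (ae_filter_ringOfSetsType mu). Qed.

Lemma aeS2 P Q S : (forall t, P t -> Q t -> S t) ->
  {ae mu, forall t, P t} -> {ae mu, forall t, Q t} -> {ae mu, forall t, S t}.
Proof.
by move=> h p; apply: (filterS2 _ _ p) => //; exact: (ae_filter_ringOfSetsType mu).
Qed.

Lemma ae_forall_fin (I : finType) (P : I -> R -> Prop) :
  (forall i, {ae mu, forall t, P i t}) -> {ae mu, forall t, forall i, P i t}.
Proof.
move=> h; have [s sP] : exists s : nat -> option I, forall i, exists n, s n = Some i.
  exists (fun n => nth None (map Some (enum I)) n) => i; exists (index i (enum I)).
  by rewrite (nth_map i) ?nth_index ?mem_enum// index_mem mem_enum.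
have : {ae mu, forall t, forall n, if s n is Some i then P i t else True}.
  by apply: ae_foralln => n; case: (s n) => [i|]; [exact: h|exact: aeW].
by apply: aeS => t ht i; have [n sn] := sP i; have := ht n; rewrite sn.
Qed.

End AlmostEverywhere.

Section Dot.
Context (R : realType) (X : completeNormedModType R) (dot : {dot X for idfun}).
Hypothesis hdot : forall x : X, dot x x = `|x| ^+ 2.
Context (a b : R).
Implicit Types (f g u : R -> X) (phi : R -> R).
Local Notation sm := (@strongly_measurable R X a b).
Local Notation D := [set` `]a, b]].
Local Notation mu := (@lebesgue_measure R).

Lemma measurable_dot f g : sm f -> sm g ->
  measurable_fun D (fun t => dot (f t) (g t)).
Proof.
move=> [u [su uf]] sg.
have mcst x : measurable_fun D (fun t => dot (g t) x).
  have [v [sv vg]] := sg.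
  apply: (@measurable_fun_cvg _ _ _ _ (fun k t => dot (v k t) x)).
    move=> k; have [n [A [y [mA ->]]]] := sv k.
    under [X in measurable_fun _ X]eq_fun do rewrite dot_suml.
    apply: measurable_sum => i; under [X in measurable_fun _ X]eq_fun do rewrite dotZl.
    by apply: measurable_funM => //; apply: measurable_indic.
  by move=> t tab; apply: cvg_dotl => //; exact: vg.
apply: (@measurable_fun_cvg _ _ _ _ (fun k t => dot (u k t) (g t))).
  move=> k; have [n [A [y [mA ->]]]] := su k.
  under [X in measurable_fun _ X]eq_fun do rewrite /= dot_suml.
  apply: measurable_sum => i; under [X in measurable_fun _ X]eq_fun do rewrite dotZl.
  apply: measurable_funM; first by apply: measurable_indic.
  by under [X in measurable_fun _ X]eq_fun do rewrite dotC; exact: mcst.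
by move=> t tab; apply: cvg_dotl => //; exact: uf.
Qed.

(** The values of a strongly measurable function lie in the closed span of
    countably many vectors, so countably many tests suffice. *)
Lemma ae_eq0_dot f : sm f ->
  (forall x, {ae mu, forall t, D t -> dot (f t) x = 0}) ->
  {ae mu, forall t, D t -> f t = 0}.
Proof.
move=> [u [su uf]] h.
have h1 k : {ae mu, forall t, D t -> dot (f t) (u k t) = 0}.
  have [n [A [y [mA ->]]]] := su k.
  have h2 : {ae mu, forall t, forall i : 'I_n, D t -> dot (f t) (y i) = 0}.
    by apply: ae_forall_fin => i; exact: h.
  apply: aeS h2 => t h2 Dt; rewrite dot_sumr big1// => i _.
  by rewrite dotZr h2// mulr0.
apply: aeS (ae_foralln h1) => t h2 Dt.
have : dot (u k t) (f t) @[k --> \oo] --> dot (f t) (f t).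
  by apply: cvg_dotl => //; exact: uf.
under eq_fun => k do rewrite dotC (h2 k Dt).
move=> h3; have h4 := cvg_unique _ h3 (cvg_cst 0).
by apply/eqP; rewrite -normr_eq0 -sqrf_eq0 -hdot h4.
Qed.

End Dot.

Section L2Space.
Context (R : realType) (X : completeNormedModType R) (dot : {dot X for idfun}).
Hypothesis hdot : forall x : X, dot x x = `|x| ^+ 2.
Context (a b : R).
Implicit Types (f g h u : R -> X) (phi : R -> R).
Local Notation sm := (@strongly_measurable R X a b).
Local Notation D := [set` `]a, b]].
Local Notation mu := (@lebesgue_measure R).
Local Notation L2 := (@L2 R X a b).
Local Notation ip := (L2dot dot a b).

Let mD : @measurable _ (measurableTypeR R) D. Proof. exact: measurable_itv. Qed.

Lemma mu_itv_lty : (mu D < +oo)%E.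
Proof. by rewrite /= lebesgue_measure_itv/=; case: ifP => _; rewrite ?ltry. Qed.

Lemma integrable_cst (c : R) : mu.-integrable D (EFin \o (fun=> c)).
Proof.
apply/integrableP; split; first exact: measurable_cst.
have -> : (\int[mu]_(x in D) `|(EFin \o (fun=> c)) x|)%E = (`|c|%:E * mu D)%E.
  by rewrite -integral_cst.
by rewrite lte_mul_pinfty// mu_itv_lty.
Qed.

Lemma L2P f : L2 f <-> sm f /\ mu.-integrable D (EFin \o (fun t => dot (f t) (f t))).
Proof.
have e : (fun t => ((`|f t| ^+ 2)%:E)) = EFin \o (fun t => dot (f t) (f t)).
  by apply/funext => t /=; rewrite hdot.
rewrite /L2 /=; split=> -[sf h]; split => //.
  apply/integrableP; split.
    by apply/measurable_EFinP; exact: measurable_dot.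
  move: h; rewrite /L2norm e => /lty_poweRy; rewrite invr_eq0 pnatr_eq0.
  move=> /(_ isT); congr (_ < _)%E; apply: eq_integral => t _ /=.
  by rewrite hdot ger0_norm// exprn_ge0.
rewrite /L2norm e; apply: poweR_lty; exact: integrable_lty.
Qed.

Lemma L2_sm f : L2 f -> sm f. Proof. by case. Qed.

Lemma L2_dot f g : L2 f -> L2 g ->
  mu.-integrable D (EFin \o (fun t => dot (f t) (g t))).
Proof.
move=> /L2P[sf intf] /L2P[sg intg].
apply: (le_integrable mD _ _ (integrableD mD intf intg)).
  by apply/measurable_EFinP; exact: measurable_dot.
move=> t _ /=; rewrite lee_fin !hdot; apply: le_trans (dot_le hdot _ _) _.
rewrite [leRHS]ger0_norm ?addr_ge0 ?exprn_ge0//.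
have := sqr_ge0 (`|f t| - `|g t|); have := sqr_ge0 (`|f t| + `|g t|).
by move: `|f t| `|g t| => x y; nra.
Qed.

Lemma L2_le f (F : R -> R) : sm f -> mu.-integrable D (EFin \o F) ->
  (forall t, t \in `]a, b] -> `|f t| ^+ 2 <= F t) -> L2 f.
Proof.
move=> sf iF fF; apply/L2P; split=> //; apply: (le_integrable mD _ _ iF).
  by apply/measurable_EFinP; exact: measurable_dot.
move=> t tab /=; rewrite lee_fin hdot ger0_norm ?exprn_ge0//.
exact: le_trans (fF _ tab) (ler_norm _).
Qed.

Lemma L2_sqr f : L2 f -> mu.-integrable D (EFin \o (fun t => `|f t| ^+ 2)).
Proof.
by move=> /L2P[_]; congr (integrable _ _ _); apply/funext => t /=; rewrite hdot.
Qed.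

Lemma L2_bounded f M : sm f -> (forall t, t \in `]a, b] -> `|f t| <= M) -> L2 f.
Proof.
move=> sf fM; apply: (@L2_le _ (fun=> M ^+ 2)) => //.
  exact: integrable_cst.
move=> t tab; have M0 : 0 <= M by exact: le_trans (normr_ge0 _) (fM t tab).
by rewrite lerXn2r ?nnegrE//; exact: fM.
Qed.

Lemma L2D f g : L2 f -> L2 g -> L2 (fun t => f t + g t).
Proof.
move=> L2f L2g; apply: (@L2_le _ (fun t => 2 * `|f t| ^+ 2 + 2 * `|g t| ^+ 2)).
- by apply: smD; exact: L2_sm.
- have := integrableD mD (integrableZl mD 2 (L2_sqr L2f)) (integrableZl mD 2 (L2_sqr L2g)).
  by congr (integrable _ _ _); apply/funext.
move=> t _; rewrite (sqr_normD hdot); have := dot_le hdot (f t) (g t).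
move/(le_trans (ler_norm _)); move: (dot _ _) `|f t| `|g t| => d x y.
by have := sqr_ge0 (x - y); nra.
Qed.

Lemma L2M phi f M : measurable_fun D phi ->
  (forall t, t \in `]a, b] -> `|phi t| <= M) -> L2 f -> L2 (fun t => phi t *: f t).
Proof.
move=> mphi phiM L2f; apply: (@L2_le _ (fun t => M ^+ 2 * `|f t| ^+ 2)).
- by apply: smZ => //; exact: L2_sm.
- exact: integrableZl (L2_sqr L2f).
move=> t tab; rewrite normrZ exprMn ler_wpM2r ?exprn_ge0//.
have M0 : 0 <= M by exact: le_trans (normr_ge0 _) (phiM t tab).
by rewrite lerXn2r ?nnegrE//; exact: phiM.
Qed.

Lemma L2Z c f : L2 f -> L2 (fun t => c *: f t).
Proof. by apply: (@L2M (fun=> c) _ `|c|). Qed.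

Lemma L2N f : L2 f -> L2 (fun t => - f t).
Proof. by move=> /(L2Z (-1)); under eq_fun do rewrite scaleN1r. Qed.

Lemma L2B f g : L2 f -> L2 g -> L2 (fun t => f t - g t).
Proof. by move=> L2f L2g; apply: L2D => //; exact: L2N. Qed.

Lemma L2_cst x : L2 (fun=> x).
Proof. by apply: (@L2_bounded _ `|x|) => //; exact: sm_cst. Qed.

Lemma L2_sum (I : Type) (s : seq I) (F : I -> R -> X) :
  (forall i, L2 (F i)) -> L2 (fun t => \sum_(i <- s) F i t).
Proof.
move=> sF; elim: s => [|i s ih].
  by under eq_fun do rewrite big_nil; exact: L2_cst.
by under eq_fun do rewrite big_cons; exact: L2D.
Qed.

Lemma L2dotC f g : ip f g = ip g f.
Proof. by apply: eq_Rintegral => t _; rewrite dotC. Qed.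

Lemma L2dotDl f g h : L2 f -> L2 g -> L2 h ->
  ip (fun t => f t + g t) h = ip f h + ip g h.
Proof.
move=> L2f L2g L2h; rewrite /L2dot -RintegralD//; [|exact: L2_dot|exact: L2_dot].
by apply: eq_Rintegral => t _; rewrite dotDl.
Qed.

Lemma L2dotZl c f g : L2 f -> L2 g -> ip (fun t => c *: f t) g = c * ip f g.
Proof.
move=> L2f L2g; rewrite /L2dot -RintegralZl//; last exact: L2_dot.
by apply: eq_Rintegral => t _; rewrite dotZl.
Qed.

Lemma L2dotBl f g h : L2 f -> L2 g -> L2 h ->
  ip (fun t => f t - g t) h = ip f h - ip g h.
Proof.
move=> L2f L2g L2h; rewrite /L2dot -RintegralB//; [|exact: L2_dot|exact: L2_dot].
by apply: eq_Rintegral => t _; rewrite dotBl.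
Qed.

Lemma L2dotDr f g h : L2 f -> L2 g -> L2 h ->
  ip h (fun t => f t + g t) = ip h f + ip h g.
Proof. by move=> *; rewrite L2dotC L2dotDl// (L2dotC f h) (L2dotC g h). Qed.

Lemma L2dotZr c f g : L2 f -> L2 g -> ip g (fun t => c *: f t) = c * ip g f.
Proof. by move=> *; rewrite L2dotC L2dotZl// (L2dotC f). Qed.

Lemma L2dot0l g : ip (fun=> 0) g = 0.
Proof.
rewrite /L2dot (_ : (fun t => dot 0 (g t)) = cst 0) ?Rintegral_cst ?mul0r//.
by apply/funext => t; rewrite dot0l.
Qed.

Lemma L2dot_suml (I : Type) (s : seq I) (F : I -> R -> X) g :
  (forall i, L2 (F i)) -> L2 g ->
  ip (fun t => \sum_(i <- s) F i t) g = \sum_(i <- s) ip (F i) g.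
Proof.
move=> L2F L2g; elim: s => [|i s ih].
  by under [in LHS]eq_fun do rewrite big_nil; rewrite big_nil L2dot0l.
under [in LHS]eq_fun do rewrite big_cons; rewrite big_cons L2dotDl ?ih//.
exact: L2_sum.
Qed.

Lemma L2dot_ge0 f : 0 <= ip f f.
Proof. by apply: Rintegral_ge0 => t _; rewrite hdot exprn_ge0. Qed.

(** The L^2 norm as a real number, which keeps the estimates in ordinary
    arithmetic until they are turned into extended reals by L2normE. *)
Definition nrm f : R := Num.sqrt (ip f f).

Lemma nrm_ge0 f : 0 <= nrm f. Proof. exact: sqrtr_ge0. Qed.

Lemma sqr_nrm f : nrm f ^+ 2 = ip f f.
Proof. by rewrite sqr_sqrtr// L2dot_ge0. Qed.

Lemma L2normE f : L2 f -> L2norm a b f = (nrm f)%:E.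
Proof.
move=> /[dup] L2f /L2P[_ intf]; rewrite /L2norm.
have -> : (\int[mu]_(t in D) (`|f t| ^+ 2)%:E)%E = (ip f f)%:E.
  rewrite /L2dot /Rintegral fineK; last exact: integrable_fin_num.
  by apply: eq_integral => t _ /=; rewrite hdot.
by rewrite poweR_EFin powR12_sqrt// L2dot_ge0.
Qed.

(** The discriminant of the nonnegative quadratic polynomial s |-> (f + s g, f
    + s g) is not positive. *)
Lemma L2dot_le f g : L2 f -> L2 g -> `|ip f g| <= nrm f * nrm g.
Proof.
move=> L2f L2g.
have quad s : 0 <= ip f f + 2 * s * ip f g + s ^+ 2 * ip g g.
  have := L2dot_ge0 (fun t => f t + s *: g t).
  have L2sg := L2Z s L2g; have L2fg := L2D L2f L2sg.
  rewrite L2dotDl// !L2dotDr// !L2dotZl// !L2dotZr// (L2dotC g f).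
  by move=> h; apply: le_trans h _; rewrite le_eqVlt; apply/orP; left; apply/eqP; ring.
rewrite -(@ler_pXn2r _ 2)// ?nnegrE// ?mulr_ge0 ?nrm_ge0//.
rewrite exprMn !sqr_nrm real_normK ?num_real//.
have := L2dot_ge0 f; have := L2dot_ge0 g; move: quad.
move: (ip f f) (ip f g) (ip g g) => A B C quad C0 A0.
have [C00|Cn0] := eqVneq C 0.
  have [->|Bn0] := eqVneq B 0; first by rewrite expr0n C00 mulr0.
  have := quad (- (A + 1) / (2 * B)); rewrite C00 mulr0 addr0.
  have -> : 2 * (- (A + 1) / (2 * B)) * B = - (A + 1) by field.
  by lra.
have := quad (- B / C).
have -> : A + 2 * (- B / C) * B + (- B / C) ^+ 2 * C = (A * C - B ^+ 2) / C.
  by field.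
by rewrite pmulr_lge0 ?subr_ge0// invr_gt0 lt_def Cn0.
Qed.

Lemma nrmD f g : L2 f -> L2 g -> nrm (fun t => f t + g t) <= nrm f + nrm g.
Proof.
move=> L2f L2g; rewrite -(@ler_pXn2r _ 2)// ?nnegrE// ?addr_ge0 ?nrm_ge0//.
have L2fg := L2D L2f L2g.
rewrite sqrrD !sqr_nrm L2dotDl// !L2dotDr// (L2dotC g f).
have := le_trans (ler_norm _) (L2dot_le L2f L2g).
by move: (ip _ _) (ip _ _) (ip _ _) (_ * _) => *; lra.
Qed.

Lemma nrmZ c f : L2 f -> nrm (fun t => c *: f t) = `|c| * nrm f.
Proof.
move=> L2f; have := L2Z c L2f => L2cf.
by rewrite /nrm L2dotZl// L2dotZr// mulrA -expr2 sqrtrM ?sqr_ge0// sqrtr_sqr.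
Qed.

Lemma nrmB f g : L2 f -> L2 g -> nrm (fun t => f t - g t) <= nrm f + nrm g.
Proof.
move=> L2f L2g; apply: le_trans (nrmD L2f (L2N L2g)) _; rewrite lerD2l.
have := nrmZ (-1) L2g; rewrite normrN1 mul1r => <-.
by under [in leRHS]eq_fun do rewrite scaleN1r.
Qed.

Lemma L2dot_ae f g h : L2 f -> L2 g -> L2 h ->
  {ae mu, forall t, D t -> f t = g t} -> ip f h = ip g h.
Proof.
move=> L2f L2g L2h fg; rewrite /L2dot /Rintegral; congr fine.
apply: ae_eq_integral => //.
- by have /measurable_int := L2_dot L2f L2h.
- by have /measurable_int := L2_dot L2g L2h.
- by apply: aeS fg => t fg Dt; rewrite /= fg.
Qed.

Lemma nrm_ae f g : L2 f -> L2 g ->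
  {ae mu, forall t, D t -> f t = g t} -> nrm f = nrm g.
Proof.
move=> L2f L2g fg; rewrite /nrm (L2dot_ae L2f L2g L2f fg) L2dotC.
by rewrite (L2dot_ae L2f L2g L2g fg).
Qed.

End L2Space.

(** * Integration by parts *)

Section ScalarByParts.
Context (R : realType) (a b : R).
Local Notation D := [set` `]a, b]].
Local Notation mu := (@lebesgue_measure R).

Lemma integral_derive1 (phi : R -> R) s : (forall t, derivable phi t 1) ->
  continuous (derive1 phi) -> s <= b ->
  (\int[mu]_(t in `[s, b]) (derive1 phi t)%:E)%E = (phi b - phi s)%:E.
Proof.
move=> dphi cphi; rewrite le_eqVlt => /predU1P[->|sb].
  by rewrite set_itv1 integral_set1 subrr.
have cp : continuous phi by move=> t; exact/differentiable_continuous/derivable1_diffP.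
rewrite (continuous_FTC2 (F := phi) sb)//.
- exact: continuous_subspaceT.
- split=> //; [exact: cvg_at_right_filter (cp s)|exact: cvg_at_left_filter (cp b)].
Qed.

Lemma continuous_bounded (psi : R -> R) : continuous psi ->
  exists2 M, 0 <= M & forall t, t \in `]a, b] -> `|psi t| <= M.
Proof.
move=> cp; have [ab|ba] := leP a b; last first.
  by exists 0 => // t; rewrite in_itv/= => /andP[/lt_le_trans h1 /h1]; rewrite ltNge ltW.
have [] := @EVT_max R (fun t => `|psi t|) a b ab.
  by apply: continuous_subspaceT => t; apply: (continuous_comp (cp t)); exact: norm_continuous.
by move=> c _ hc; exists (`|psi c|) => // t /subset_itv_oc_cc; exact: hc.
Qed.

Lemma integrableM_continuous (psi h : R -> R) : continuous psi ->
  mu.-integrable D (EFin \o h) -> mu.-integrable D (EFin \o (fun t => psi t * h t)).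
Proof.
move=> cp ih.
have mD : @measurable _ (measurableTypeR R) D by exact: measurable_itv.
have mh : measurable_fun D h by have /measurable_int/measurable_EFinP := ih.
have [M M0 hM] := continuous_bounded cp.
apply: (@le_integrable _ _ _ mu D mD (EFin \o (fun t => psi t * h t)) (fun t => M%:E * (EFin \o h) t)%E).
- apply/measurable_EFinP; apply: measurable_funM => //.
  by apply: measurable_funTS; exact: continuous_measurable_fun.
- move=> t Dt /=; rewrite lee_fin !normrM ler_wpM2r//.
  by rewrite (le_trans (hM t Dt))// ler_norm.
- exact: integrableZl.
Qed.

(** Fubini's theorem on the triangle a < s <= t <= b: the inner integral of
    phi' over [s, b] is phi b - phi s. This form asks only that h be
    integrable, as is the case for a weak derivative. *)
Lemma integral_by_parts (phi h : R -> R) : (forall t, derivable phi t 1) ->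
  continuous (derive1 phi) -> mu.-integrable D (EFin \o h) ->
  \int[mu]_(t in D) (derive1 phi t * \int[mu]_(s in D) (\1_([set` `]a, t]]) s * h s)) =
  phi b * \int[mu]_(t in D) h t - \int[mu]_(t in D) (phi t * h t).
Proof.
move=> dphi cphi ih.
have mD : @measurable _ (measurableTypeR R) D by exact: measurable_itv.
pose T := measurableTypeR R.
pose m : {sigma_finite_measure set T -> \bar R} := mu.
pose phi0 : T -> R := (derive1 phi) \_ D.
pose h0 : T -> R := h \_ D.
pose f (z : T * T) : \bar R := (phi0 z.1 * (h0 z.2 * (z.2 <= z.1)%R%:R))%:E.
have mphi0 : measurable_fun setT phi0.
  apply/(measurable_restrictT _ _).1 => //; apply: measurable_funTS.
  exact: continuous_measurable_fun.
have mh : measurable_fun D h by have /measurable_int/measurable_EFinP := ih.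
have mh0 : measurable_fun setT h0 by apply/(measurable_restrictT _ _).1.
have ih0 : m.-integrable setT (EFin \o h0).
  have := (@integrable_mkcond _ _ _ mu D (EFin \o h) mD).1 ih.
  by rewrite restrict_EFin.

have iphi0 : m.-integrable setT (EFin \o phi0).
  have iphi : mu.-integrable D (EFin \o derive1 phi).
    have cc : mu.-integrable `[a, b] (EFin \o derive1 phi).
      apply: continuous_compact_integrable; first exact: segment_compact.
      exact: continuous_subspaceT.
    by apply: integrableS cc => //; exact: subset_itv_oc_cc.
  have := (@integrable_mkcond _ _ _ mu D (EFin \o derive1 phi) mD).1 iphi.
  by rewrite restrict_EFin.
have ml : measurable_fun setT (fun z : T * T => (z.2 <= z.1)%R%:R : R).
  have -> : (fun z : T * T => (z.2 <= z.1)%R%:R : R) = \1_[set z : T * T | (z.2 <= z.1)%R].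
    by apply/funext => z; rewrite indicE mem_setE.
  apply: measurable_indic.
  have := @measurable_fun_ler _ _ _ setT _ _ (@measurable_snd _ _ T T) (@measurable_fst _ _ T T).
  move=> /(_ measurableT [set true] I); rewrite setTI.
  by congr (measurable _); apply/seteqP; split.
pose f1 (z : T * T) : \bar R := (phi0 z.1 * h0 z.2)%:E.
have mf1 : measurable_fun setT f1.
  apply/measurable_EFinP; apply: measurable_funM.
    exact: measurableT_comp mphi0 (@measurable_fst _ _ T T).
  exact: measurableT_comp mh0 (@measurable_snd _ _ T T).
have mf : measurable_fun setT f.
  apply/measurable_EFinP; apply: measurable_funM.
    exact: measurableT_comp mphi0 (@measurable_fst _ _ T T).
  apply: measurable_funM => //.
  exact: measurableT_comp mh0 (@measurable_snd _ _ T T).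
have fi : (m \x m)%E.-integrable setT f.
  apply: (@le_integrable _ _ _ _ setT measurableT f f1) => //.
    move=> z _; rewrite /f /f1 /= lee_fin !normrM ler_wpM2l// ler_piMr//.
    by case: (z.2 <= z.1); rewrite ?normr1 ?normr0.
  apply/integrable12ltyP => //.
  have /integrableP[_ phioo] := iphi0.
  have /integrableP[_ hoo] := ih0.
  have e t : (\int[m]_s `|f1 (t, s)|)%E = (`|phi0 t|%:E * \int[m]_s `|(h0 s)%:E|)%E.
    rewrite -ge0_integralZl//; last first.
      by do 2 apply: measurableT_comp => //.
    by apply: eq_integral => s _; rewrite /f1 /= normrM EFinM.
  under eq_integral do rewrite e.
  rewrite ge0_integralZr//; last 2 first.
    by do 2 apply: measurableT_comp => //.
    exact: integral_ge0.
  by rewrite lte_mul_pinfty ?integral_ge0// ge0_fin_numE// integral_ge0.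
have patchD (F : R -> R) t : t \in D -> (F \_ D) t = F t by move=> tD; rewrite patchE tD.
have patchN (F : R -> R) t : t \notin D -> (F \_ D) t = 0.
  by move=> tD; rewrite patchE (negbTE tD).
have ihq t : m.-integrable setT (EFin \o (fun s => h0 s * (s <= t)%R%:R)).
  apply: (@le_integrable _ _ _ _ setT measurableT _ (EFin \o h0)) => //.
    apply/measurable_EFinP; apply: measurable_funM => //.
    exact: (measurableT_comp ml (measurable_pair1 t)).
  move=> s _; rewrite /= lee_fin normrM ler_piMr//.
  by case: (s <= t); rewrite ?normr1 ?normr0.
have iphiq s : m.-integrable setT (EFin \o (fun t => phi0 t * (s <= t)%R%:R)).
  apply: (@le_integrable _ _ _ _ setT measurableT _ (EFin \o phi0)) => //.
    apply/measurable_EFinP; apply: measurable_funM => //.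
    exact: (measurableT_comp ml (measurable_pair2 s)).
  move=> t _; rewrite /= lee_fin normrM ler_piMr//.
  by case: (s <= t); rewrite ?normr1 ?normr0.
have eL t : (\int[m]_s f (t, s))%E = (((fun t => derive1 phi t *
    \int[mu]_(s in D) (\1_([set` `]a, t]]) s * h s)) \_ D) t)%:E.
  have [tD|tD] := boolP (t \in D); last first.
    rewrite patchN//= (@eq_integral _ _ _ m setT (cst 0%E)) ?integral0// => s _.
    by rewrite /f /= /phi0 patchN// mul0r.
  rewrite patchD// (_ : (fun s => f (t, s)) = fun s =>
      ((derive1 phi t)%:E * (EFin \o (fun s => (h0 s * (s <= t)%R%:R)%R)) s)%E); last first.
    by apply/funext => s; rewrite /f /= /phi0 patchD.
  rewrite integralZl//.
  rewrite EFinM; congr (_ * _)%E.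
  rewrite -[LHS]fineK; last exact: integrable_fin_num.
  congr (_%:E); rewrite [RHS]Rintegral_mkcond; apply: eq_Rintegral => s _.
  rewrite /h0 !patchE; case: ifPn => sD; last by rewrite mul0r.
  rewrite mulrC; congr (_ * _); rewrite indicE mem_setE.
  by move: sD; rewrite mem_setE !in_itv/= => /andP[-> _].
have eR s : (\int[m]_t f (t, s))%E = (((fun s => h s * (phi b - phi s)) \_ D) s)%:E.
  have [sD|sD] := boolP (s \in D); last first.
    rewrite patchN//= (@eq_integral _ _ _ m setT (cst 0%E)) ?integral0// => t _.
    by rewrite /f /= /h0 patchN// mul0r mulr0.
  rewrite patchD// (_ : (fun t => f (t, s)) = fun t =>
      ((h s)%:E * (EFin \o (fun t => (phi0 t * (s <= t)%R%:R)%R)) t)%E); last first.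
    by apply/funext => t; rewrite /f /= /h0 patchD// mulrCA EFinM.
  rewrite integralZl//.
  rewrite EFinM; congr (_ * _)%E.
  move: sD; rewrite mem_setE in_itv/= => /andP[as_ sb].
  rewrite -(integral_derive1 dphi cphi sb) [RHS]integral_mkcond.
  apply: eq_integral => t _; rewrite /phi0 restrict_EFin /= !patchE !mem_setE !in_itv/=.
  have [tb|bt] := leP t b; last by rewrite !andbF mul0r.
  rewrite !andbT; have [st|ts] := leP s t; last by rewrite mulr0.
  by rewrite (lt_le_trans as_ st) mulr1.
have cp : continuous phi by move=> t; exact/differentiable_continuous/derivable1_diffP.
have ip := integrableM_continuous cp ih.
have := Fubini fi; under eq_integral do rewrite eL.
under [X in _ = X -> _]eq_integral do rewrite eR.
move/(congr1 fine); rewrite -!/(Rintegral _ _ _) -!Rintegral_mkcond => ->.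
rewrite -RintegralZl// -RintegralB//; last first.
  exact: (integrableZl mD (phi b) ih).
by apply: eq_Rintegral => t _; ring.
Qed.

End ScalarByParts.

(** * The lemma of du Bois-Reymond *)

Section DuBoisReymond.
Context (R : realType) (a b : R).
Local Notation D := [set` `]a, b]].
Local Notation mu := (@lebesgue_measure R).
Implicit Types (psi phi f h : R -> R).

Let mD : @measurable _ (measurableTypeR R) D. Proof. exact: measurable_itv. Qed.

Definition Cc psi := continuous psi /\
  exists c d, [/\ a < c, d < b & forall t, t \notin `[c, d] -> psi t = 0].

Lemma integrable_continuous psi (i : interval R) : continuous psi ->
  (exists c d, [set` i] `<=` `[c, d]) -> mu.-integrable [set` i] (EFin \o psi).
Proof.
move=> cpsi [c [d icd]].
have mi : @measurable _ (measurableTypeR R) [set` i] by exact: measurable_itv.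
have mcd : @measurable _ (measurableTypeR R) `[c, d] by exact: measurable_itv.
apply: (integrableS mcd mi icd).
apply: continuous_compact_integrable; first exact: segment_compact.
exact: continuous_subspaceT.
Qed.

(** The zero mean makes the primitive from a vanish again to the right of the
    support of psi. *)
Lemma C1c_primitive psi : Cc psi -> \int[mu]_(t in D) psi t = 0 ->
  exists2 phi, C1c a b phi & derive1 phi = psi.
Proof.
move=> [cpsi [c [d [ac db psi0]]]] ipsi.
pose phi t := \int[mu]_(r in `[a, t]) psi r.
have phi_lt t : t < c -> phi t = 0.
  move=> tc; rewrite /phi (@eq_Rintegral _ _ _ mu `[a, t] (cst 0)).
    by rewrite Rintegral_cst ?mul0r//; exact: measurable_itv.
  move=> r; rewrite mem_setE in_itv/= => /andP[_ rt]; apply: psi0.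
  by rewrite in_itv/= negb_and -ltNge (le_lt_trans rt tc).
have dphi t : derivable phi t 1 /\ derive1 phi t = psi t.
  have [ta|at_] := leP t a.
    have near0 : \near t, cst 0 t = phi t.
      near=> r; rewrite phi_lt//; near: r.
      by apply: lt_nbhsl; exact: le_lt_trans ta ac.
    have psit : psi t = 0.
      by apply: psi0; rewrite in_itv/= negb_and -ltNge (le_lt_trans ta ac).
    split; first exact: near_eq_derivable near0 _.
    by rewrite psit derive1E -(near_eq_derive _ near0) derive_cst.
  apply: (@continuous_FTC1_closed R psi a t (t + 1)) => //.
  - by rewrite ltrDl.
  - by apply: integrable_continuous => //; exists a, (t + 1).
  - exact: cpsi.
have e : derive1 phi = psi by apply/funext => t; exact: (dphi t).2.
exists phi => //; split.
- by move=> t; exact: (dphi t).1.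
- by rewrite e.
exists c, d; split => // t; rewrite in_itv/= negb_and -!ltNge => /orP[/phi_lt//|dt].
rewrite -ipsi /phi Rintegral_mkcond [RHS]Rintegral_mkcond; apply: eq_Rintegral => r _.
rewrite !patchE !mem_setE !in_itv/=.
have [->|rcd] := eqVneq (psi r) 0; first by rewrite !if_same.
have : r \in `[c, d] by apply: contra_neqT rcd => /psi0.
rewrite in_itv/= => /andP[cr rd].
by rewrite (le_trans (ltW ac) cr) (le_trans rd (ltW dt)) (lt_le_trans ac cr) (le_trans rd (ltW db)).
Unshelve. all: end_near.
Qed.

(** The powers 1 - (1 - w)^n of a bump w supported in [c, d] increase to the
    indicator of the open interval. *)
Lemma Cc_indicator c d : a < c -> c < d -> d < b ->
  exists theta : nat -> R -> R, [/\ forall n, Cc (theta n),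
    forall n t, 0 <= theta n t <= 1 &
    forall t, theta n t @[n --> \oo] --> (\1_([set` `]c, d[]) t : R)].
Proof.
move=> ac cd db.
pose q t : R := (t - c) * (d - t) / (d - c) ^+ 2.
pose w t : R := (q t + `|q t|) / 2.
have dc : 0 < d - c by rewrite subr_gt0.
have wout t : t \notin `]c, d[ -> w t = 0.
  move=> tcd; have q0 : q t <= 0.
    rewrite /q pmulr_lle0 ?invr_gt0 ?exprn_gt0//.
    move: tcd; rewrite in_itv/= negb_and -!leNgt => /orP[tc|dt].
      by apply: mulr_le0_ge0; lra.
    by apply: mulr_ge0_le0; lra.
  by rewrite /w ler0_norm// subrr mul0r.
have win t : t \in `]c, d[ -> 0 < w t <= 1.
  rewrite in_itv/= => /andP[ct td].
  have q0 : 0 < q t.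
    by rewrite /q divr_gt0 ?exprn_gt0// mulr_gt0// subr_gt0.
  rewrite /w ger0_norm ?(ltW q0)// (_ : (q t + q t) / 2 = q t); last by field.
  rewrite q0 /q ler_pdivrMr ?exprn_gt0// mul1r /=.
  by have := sqr_ge0 (d - c); nra.
have w01 t : 0 <= w t <= 1.
  have [/win/andP[/ltW-> ->]//|/wout->] := boolP (t \in `]c, d[).
  by rewrite lexx ler01.
have cw : continuous w.
  have cq : continuous q.
    move=> t; rewrite /q; apply: cvgM; last exact: cvg_cst.
    by apply: cvgM; apply: cvgB => //; exact: cvg_cst.
  move=> t; rewrite /w; apply: cvgM; last exact: cvg_cst.
  by apply: cvgD; [exact: cq|apply: cvg_norm; exact: cq].
exists (fun n t => 1 - (1 - w t) ^+ n.+1); split.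
- move=> n; split.
    move=> t; apply: cvgB; first exact: cvg_cst.
    elim: n => [|n ih]; first by rewrite expr1; apply: cvgB; [exact: cvg_cst|exact: cw].
    under eq_fun do rewrite exprS; rewrite exprS; apply: cvgM => //.
    by apply: cvgB; [exact: cvg_cst|exact: cw].
  exists c, d; split=> // t tcd; rewrite wout ?subr0 ?expr1n ?subrr//.
  by apply: contra tcd; exact: subset_itv_oo_cc.
- move=> n t; have /andP[w0 w1] := w01 t.
  have w1' : 0 <= 1 - w t by rewrite subr_ge0.
  by rewrite subr_ge0 gerBl exprn_ge0// andbT exprn_ile1// gerBl.
move=> t; rewrite indicE mem_setE.
have [/win/andP[w0 w1]|/wout->] := boolP (t \in `]c, d[); last first.
  by under eq_fun do rewrite subr0 expr1n subrr; exact: cvg_cst.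
rewrite -[X in _ --> X]subr0; apply: cvgB; first exact: cvg_cst.
have := @cvg_expr R (1 - w t); rewrite ger0_norm ?subr_ge0// => /(_ _).
rewrite ltrBlDr ltrDl => /(_ w0) h.
by have := h; rewrite -(cvg_shiftS (fun n => (1 - w t) ^+ n)).
Qed.

(** All the increments of the primitive of h vanish, and almost everywhere
    this primitive is differentiable with derivative h. *)
Lemma ae_eq0_integral h : mu.-integrable D (EFin \o h) ->
  (forall c d, a < c -> c < d -> d < b -> \int[mu]_(t in `]c, d[) h t = 0) ->
  {ae mu, forall t, D t -> h t = 0}.
Proof.
move=> ih h0.
pose g := h \_ D.
have ig : mu.-integrable setT (EFin \o g).
  have := (@integrable_mkcond _ _ _ mu D (EFin \o h) mD).1 ih.
  by rewrite restrict_EFin.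
have igi (i : interval R) : mu.-integrable [set` i] (EFin \o g).
  have mi : @measurable _ (measurableTypeR R) [set` i] by exact: measurable_itv.
  exact: (integrableS measurableT mi _ ig).
have lg : locally_integrable setT g by apply: open_integrable_locally => //; exact: openT.
pose F x := \int[mu]_(t in `]-oo, x]) g t.
have Fcst x y : a < x -> x < y -> y < b -> F y = F x.
  move=> ax xy yb; apply/eqP; rewrite -subr_eq0; apply/eqP.
  rewrite (@Rintegral_itvB R g -oo%O (BRight y) x)//; last by rewrite bnd_simp ltW.
  have -> : \int[mu]_(t in `]x, y]) g t = \int[mu]_(t in `]x, y[) g t.
    by rewrite Rintegral_itv_bndo_bndc.
  rewrite -[RHS](h0 x y)//; apply: eq_Rintegral => t.
  rewrite !mem_setE in_itv/= => /andP[xt ty].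
  by rewrite /g patchE mem_setE in_itv/= (lt_trans ax xt) (ltW (lt_trans ty yb)).
have nb : {ae mu, forall t, t != b}.
  exists [set b]; split; [exact: measurable_set1|exact: lebesgue_measure_set1|].
  by move=> t /= /negP; rewrite negbK => /eqP.
have := FTC1Ny (fun y => igi `]-oo, y]) lg.
apply: aeS2 nb => t tb [dF Fg] Dt.
move: (Dt); rewrite /= in_itv/= => /andP[at_ tleb].
have tltb : t < b by rewrite lt_neqAle tb.
have gh : g t = h t by rewrite /g patchE mem_setE Dt.
rewrite -gh -Fg derive1E.
have near0 : \forall r \near t, cst (F t) r = F r.
  near=> r; rewrite /=.
  have ar : a < r by near: r; exact: lt_nbhsr.
  have rb : r < b by near: r; exact: lt_nbhsl.
  by case: (ltgtP r t) => [rt|tr|->//]; [exact: Fcst|exact/esym/Fcst].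
by rewrite -(near_eq_derive _ near0) derive_cst.
Unshelve. all: end_near.
Qed.

(** With eta a fixed test function of nonzero mean, every test function theta
    minus a multiple of eta has mean zero and thus is a derivative. Hence the
    integral of theta f is a constant K times the integral of theta, and
    letting theta tend to the indicator of an interval shows that f - K has
    zero integral over every interval. *)
Lemma du_bois_reymond f : mu.-integrable D (EFin \o f) ->
  (forall phi, C1c a b phi -> \int[mu]_(t in D) (derive1 phi t * f t) = 0) ->
  exists K, {ae mu, forall t, D t -> f t = K}.
Proof.
move=> if_ hf.
have iM psi (g : R -> R) : continuous psi -> mu.-integrable D (EFin \o g) ->
    mu.-integrable D (EFin \o (fun t => psi t * g t)).
  exact: integrableM_continuous.
have iC psi : continuous psi -> mu.-integrable D (EFin \o psi).
  by move=> cpsi; apply: integrable_continuous => //; exists a, b; exact: subset_itv_oc_cc.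
have [K hK] : exists K, forall theta, Cc theta ->
    \int[mu]_(t in D) (theta t * f t) = K * \int[mu]_(t in D) theta t.
  have [[eta Ceta eta0]|noeta] := pselect (exists2 eta, Cc eta &
      \int[mu]_(t in D) eta t != 0); last first.
    exists 0 => theta Ct; rewrite mul0r.
    have it : \int[mu]_(t in D) theta t = 0.
      by apply/eqP/negPn/negP => it; apply: noeta; exists theta.
    by have [phi Cphi <-] := C1c_primitive Ct it; exact: hf.
  exists (\int[mu]_(t in D) (eta t * f t) / \int[mu]_(t in D) eta t) => theta Ct.
  set A := \int[mu]_(t in D) eta t; set B := \int[mu]_(t in D) theta t.
  pose psi t := theta t - B / A * eta t.
  have ct := Ct.1; have ce := Ceta.1.
  have Cpsi : Cc psi.
    split.
      move=> t; apply: cvgB; first exact: ct.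
      by apply: cvgM; [exact: cvg_cst|exact: ce].
    have [_ [c1 [d1 [ac1 db1 t0]]]] := Ct.
    have [_ [c2 [d2 [ac2 db2 e0]]]] := Ceta.
    exists (Order.min c1 c2), (Order.max d1 d2); split.
    - by rewrite lt_min ac1.
    - by rewrite gt_max db1.
    move=> t; rewrite in_itv/= ge_min le_max => tn.
    rewrite /psi t0 ?e0 ?mulr0 ?subrr//.
      by apply: contra tn; rewrite in_itv/= => /andP[-> ->]; rewrite !orbT.
    by apply: contra tn; rewrite in_itv/= => /andP[-> ->].
  have ibe : mu.-integrable D (EFin \o (fun t => B / A * eta t)).
    exact: (integrableZl mD (B / A) (iC _ ce)).
  have ipsi : \int[mu]_(t in D) psi t = 0.
    rewrite /psi RintegralB//; last exact: iC.
    by rewrite RintegralZl ?iC// divfK ?subrr.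
  have [phi Cphi ephi] := C1c_primitive Cpsi ipsi.
  have := hf _ Cphi; rewrite ephi.
  have -> : (fun t => psi t * f t) = fun t => theta t * f t - B / A * (eta t * f t).
    by apply/funext => t; rewrite /psi; ring.
  rewrite RintegralB//; last 2 first.
    exact: iM.
    exact: (integrableZl mD (B / A) (iM _ _ ce if_)).
  rewrite RintegralZl ?iM// => /eqP; rewrite subr_eq0 => /eqP ->.
  by rewrite mulrC mulrA mulrAC.
exists K.
have ih : mu.-integrable D (EFin \o (fun t => f t - K)).
  exact: (integrableB mD if_ (integrable_cst _ _ K)).
suff : {ae mu, forall t, D t -> f t - K = 0}.
  by apply: aeS => t h /h /eqP; rewrite subr_eq0 => /eqP.
apply: ae_eq0_integral => // c d ac cd db.
have [theta [Ctheta theta01 ltheta]] := Cc_indicator ac cd db.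
have hth n : \int[mu]_(t in D) (theta n t * (f t - K)) = 0.
  have ct := (Ctheta n).1.
  have -> : (fun t => theta n t * (f t - K)) = fun t => theta n t * f t - K * theta n t.
    by apply/funext => t; ring.
  rewrite RintegralB//; last 2 first.
    exact: iM.
    exact: (integrableZl mD K (iC _ ct)).
  by rewrite RintegralZl ?iC// hK// subrr.
have : (\int[mu]_(t in D) (theta n t * (f t - K))%:E)%E @[n --> \oo] -->
    (\int[mu]_(t in D) (\1_([set` `]c, d[]) t * (f t - K))%:E)%E.
  apply: (@dominated_cvg _ _ _ mu D mD _ _ (fun t => `|f t - K|%:E)).
  - by move=> n; have /measurable_int := iM _ _ (Ctheta n).1 ih.
  - move=> t _; apply: cvg_EFin; first by apply: nearW.
    by apply: cvgM; [exact: ltheta|exact: cvg_cst].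
  - by [].
  - exact: (integrable_norm ih).
  - move=> n t _ /=; rewrite lee_fin normrM ler_piMl//.
    by have /andP[h1 h2] := theta01 n t; rewrite ger0_norm.
have -> : (fun n => (\int[mu]_(t in D) (theta n t * (f t - K))%:E)%E) = cst 0%E.
  apply/funext => n; rewrite -[LHS]fineK; last first.
    by apply: integrable_fin_num => //; exact: iM (Ctheta n).1 ih.
  by rewrite [fine _](hth n).
move=> h; have e0 := cvg_unique _ h (cvg_cst _).
transitivity (fine (\int[mu]_(t in D) (\1_([set` `]c, d[]) t * (f t - K))%:E)%E).
  rewrite /Rintegral; congr (fine _).
  rewrite integral_mkcond [RHS]integral_mkcond; apply: eq_integral => t _.
  rewrite /= !patchE indicE; case: ifPn => [|_]; last by rewrite mul0r; case: ifP.
  rewrite mem_setE in_itv/= => /andP[ct td].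
  by rewrite mem_setE in_itv/= (lt_trans ac ct) (ltW (lt_trans td db)) mul1r.
by rewrite e0.
Qed.

End DuBoisReymond.

(** * Integrals of vector-valued functions and weak derivatives *)

Section VectorIntegral.
Context (R : realType) (X : completeNormedModType R) (dot : {dot X for idfun}).
Hypothesis hdot : forall x : X, dot x x = `|x| ^+ 2.
Context (a b : R).
Hypothesis ab : a < b.
Implicit Types (f g h u w : R -> X) (phi : R -> R) (x : X).
Local Notation D := [set` `]a, b]].
Local Notation mu := (@lebesgue_measure R).
Local Notation L2 := (@L2 R X a b).
Local Notation ip := (L2dot dot a b).
Local Notation nrm := (nrm dot a b).
Local Notation "f =ae g" := {ae mu, forall t, D t -> f t = g t}
  (at level 70, no associativity).

Let mD : @measurable _ (measurableTypeR R) D. Proof. exact: measurable_itv. Qed.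

Lemma mu_itvE c d : c <= d -> mu [set` `]c, d]] = (d - c)%:E.
Proof.
rewrite lebesgue_measure_itv/= lte_fin le_eqVlt => /predU1P[->|cd].
  by rewrite ltxx subrr.
by rewrite cd EFinB.
Qed.

Lemma Rintegral_itv_cst (r : R) : \int[mu]_(t in D) r = r * (b - a).
Proof. by rewrite Rintegral_cst// [X in fine X](mu_itvE (ltW ab)). Qed.

Lemma L2Mc phi f : continuous phi -> L2 f -> L2 (fun t => phi t *: f t).
Proof.
move=> cphi; have [M M0 hM] := continuous_bounded a b cphi.
apply: L2M hM => //; apply: measurable_funTS; exact: continuous_measurable_fun.
Qed.

Lemma L2_indic (A : set R) f : measurable A -> L2 f -> L2 (fun t => (\1_A t : R) *: f t).
Proof.
move=> mA; apply: (@L2M _ _ dot hdot a b _ _ 1).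
  exact: measurable_indic.
by move=> t _; rewrite indicE; case: (t \in A); rewrite ?normr1 ?normr0.
Qed.

Lemma L2dot_scale phi f x :
  ip f (fun t => phi t *: x) = ip (fun t => phi t *: f t) (fun=> x).
Proof. by apply: eq_Rintegral => t _; rewrite dotZr dotZl. Qed.

Lemma nrm_cst x : nrm (fun=> x) = Num.sqrt (b - a) * `|x|.
Proof.
rewrite /nrm /L2dot Rintegral_itv_cst hdot mulrC sqrtrM ?subr_ge0 ?ltW//.
by rewrite sqrtr_sqr normr_id.
Qed.

(** The integral of f over ]a, b]. By the Riesz theorem there is a unique
    vector whose components are the integrals of the components of f, and this
    characterisation is all that the estimates use. *)
Definition vint f : X := xget 0 [set v | forall x, dot v x = ip f (fun=> x)].

Lemma dot_vint f x : L2 f -> dot (vint f) x = ip f (fun=> x).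
Proof.
move=> L2f; have L2c := L2_cst hdot a b.
have : exists v, forall x, dot v x = ip f (fun=> x).
  apply: (@riesz _ _ dot hdot _ (nrm f * Num.sqrt (b - a))).
  - by move=> y z; exact: L2dotDr.
  - by move=> c y; exact: L2dotZr.
  - by move=> y; rewrite -mulrA -nrm_cst; exact: L2dot_le.
move=> [v hv].
by have := @xgetPex _ 0 [set v | forall x, dot v x = ip f (fun=> x)] (ex_intro _ v hv) => ->.
Qed.

Lemma vint_eq f v : L2 f -> (forall x, ip f (fun=> x) = dot v x) -> vint f = v.
Proof. by move=> L2f h; apply: (dot_inj hdot) => x; rewrite dot_vint. Qed.

Lemma vintD f g : L2 f -> L2 g -> vint (fun t => f t + g t) = vint f + vint g.
Proof.
move=> L2f L2g; apply: vint_eq; first exact: L2D.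
by move=> x; rewrite L2dotDl ?dotDl ?dot_vint//; exact: L2_cst.
Qed.

Lemma vintZ c f : L2 f -> vint (fun t => c *: f t) = c *: vint f.
Proof.
move=> L2f; apply: vint_eq; first exact: L2Z.
by move=> x; rewrite (L2dotZl hdot) ?dotZl ?dot_vint//; exact: L2_cst.
Qed.

Lemma vintB f g : L2 f -> L2 g -> vint (fun t => f t - g t) = vint f - vint g.
Proof.
move=> L2f L2g; apply: vint_eq; first exact: L2B.
by move=> x; rewrite (L2dotBl hdot) ?dotBl ?dot_vint//; exact: L2_cst.
Qed.

Lemma vint_cst_scale phi x : continuous phi ->
  vint (fun t => phi t *: x) = (\int[mu]_(t in D) phi t) *: x.
Proof.
move=> cphi; apply: vint_eq; first by apply: L2Mc => //; exact: L2_cst.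
move=> y; rewrite dotZl mulrC -RintegralZl//.
  by apply: eq_Rintegral => t _; rewrite dotZl mulrC.
by apply: integrable_continuous => //; exists a, b; exact: subset_itv_oc_cc.
Qed.

Lemma vint_ae f g : L2 f -> L2 g -> f =ae g -> vint f = vint g.
Proof.
move=> L2f L2g fg; apply: vint_eq => // x; rewrite dot_vint//.
by apply: (L2dot_ae hdot) => //; exact: L2_cst.
Qed.

Lemma eq_vint f g : (forall t, t \in `]a, b] -> f t = g t) -> vint f = vint g.
Proof.
move=> fg; congr (xget _ _); apply/funext => v; apply/propext.
have e x : ip f (fun=> x) = ip g (fun=> x).
  by apply: eq_Rintegral => t; rewrite mem_setE => /fg ->.
by split=> h x; rewrite h e.
Qed.

(** The Cauchy-Schwarz inequality in a sharp form: the integral v of phi f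
    satisfies |v|^2 = (f, phi v), where the norm of phi v is the L^2 norm of
    phi times |v|. *)
Lemma sqr_vint_le phi M f : measurable_fun D phi ->
  (forall t, t \in `]a, b] -> `|phi t| <= M) -> L2 f ->
  `|vint (fun t => phi t *: f t)| ^+ 2 <= (\int[mu]_(t in D) phi t ^+ 2) * nrm f ^+ 2.
Proof.
move=> mphi phiM L2f; have L2pf := L2M hdot mphi phiM L2f.
set v := vint _; have L2v := L2_cst hdot a b v.
have L2pv := L2M hdot mphi phiM L2v.
have e : nrm (fun t => phi t *: v) ^+ 2 = (\int[mu]_(t in D) phi t ^+ 2) * `|v| ^+ 2.
  rewrite sqr_nrm// /L2dot mulrC -RintegralZl//.
    by apply: eq_Rintegral => t _; rewrite dotZl dotZr hdot; ring.
  apply: (@measurable_bounded_integrable _ _ _ mu) => //.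
  - exact: mu_itv_lty.
  - by apply: measurable_funX.
  - exists (M ^+ 2); split; first exact: num_real.
    move=> x Mx t Dt; rewrite /= normrX; apply: le_trans (ltW Mx).
    have M0 : 0 <= M by exact: le_trans (normr_ge0 _) (phiM t Dt).
    by rewrite lerXn2r ?nnegrE//; exact: phiM.
have h : `|v| ^+ 2 <= nrm f * nrm (fun t => phi t *: v).
  rewrite -hdot {1}/v dot_vint// -L2dot_scale.
  by apply: le_trans (ler_norm _) _; exact: L2dot_le.
have h2 : (`|v| ^+ 2) ^+ 2 <= nrm f ^+ 2 * ((\int[mu]_(t in D) phi t ^+ 2) * `|v| ^+ 2).
  by rewrite -e -exprMn lerXn2r// ?nnegrE ?exprn_ge0// ?mulr_ge0 ?nrm_ge0.
have [v0|v0] := eqVneq v 0.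
  rewrite v0 normr0 expr0n mulr_ge0 ?exprn_ge0 ?nrm_ge0//.
  by apply: Rintegral_ge0 => t _; exact: sqr_ge0.
have vp : 0 < `|v| ^+ 2 by rewrite exprn_gt0// normr_gt0.
by rewrite -(ler_pM2r vp) -expr2 (le_trans h2)// mulrCA mulrA.
Qed.

(** The indicator keeps the domain of integration fixed, so that the calculus
    of vint applies to primitives. *)
Definition prim g t : X := vint (fun s => (\1_([set` `]a, t]]) s : R) *: g s).

Lemma dot_prim g t x : L2 g ->
  dot (prim g t) x = \int[mu]_(s in D) (\1_([set` `]a, t]]) s * dot (g s) x).
Proof.
move=> L2g; rewrite dot_vint; last by apply: L2_indic => //; exact: measurable_itv.
by apply: eq_Rintegral => s _; rewrite dotZl.
Qed.

Lemma prim_a g : prim g a = 0.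
Proof.
apply: (dot_inj hdot) => x; rewrite dot0l.
have e : (fun s => (\1_([set` `]a, a]]) s : R) *: g s) = (fun=> 0).
  apply/funext => s; rewrite indicE mem_setE in_itv/=.
  by case: ltP => //= [h|_]; rewrite ?leNgt ?h ?scale0r.
rewrite /prim e dot_vint ?L2dot0l//; exact: L2_cst.
Qed.

Lemma prim_b g : prim g b = vint g.
Proof. by apply: eq_vint => t tD; rewrite indicE mem_setE tD scale1r. Qed.

Lemma primB g h t : L2 g -> L2 h -> prim (fun s => g s - h s) t = prim g t - prim h t.
Proof.
move=> L2g L2h; rewrite /prim -vintB; try by apply: L2_indic => //; exact: measurable_itv.
by apply: eq_vint => s _; rewrite scalerBr.
Qed.

(** Primitives of square integrable functions are Hoelder continuous of order
    1/2; their continuity and boundedness follow. *)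
Lemma sqr_prim_le g r t : L2 g -> a <= r -> r <= t -> t <= b ->
  `|prim g t - prim g r| ^+ 2 <= (t - r) * nrm g ^+ 2.
Proof.
move=> L2g ar rt tb.
have mi c d : measurable [set` `]c, d] : interval R] by exact: measurable_itv.
rewrite /prim -vintB; try by apply: L2_indic.
rewrite (@eq_vint _ (fun s => (\1_([set` `]r, t]]) s : R) *: g s)).
  have m1 : measurable_fun D (\1_([set` `]r, t]]) : R -> R) by exact: measurable_indic.
  apply: le_trans (sqr_vint_le m1 (M := 1) _ L2g) _.
    by move=> s _; rewrite indicE; case: (_ \in _); rewrite ?normr1 ?normr0.
  rewrite ler_wpM2r ?exprn_ge0 ?nrm_ge0// le_eqVlt; apply/orP; left; apply/eqP.
  transitivity (fine (\int[mu]_(s in D) (\1_([set` `]r, t]]) s)%:E)%E).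
    congr fine; apply: eq_integral => s _ /=.
    by rewrite indicE; case: (_ \in _); rewrite ?expr1n ?expr0n.
  rewrite integral_indic//= setIidl; last first.
    by apply: subset_itv; rewrite bnd_simp.
  by rewrite [X in fine X](mu_itvE rt).
move=> s _; rewrite -scalerBl; congr (_ *: _).
rewrite !indicE !mem_setE !in_itv/=.
have [rs|sr] := ltP r s; last by rewrite (le_trans sr rt) andbT subrr.
by rewrite (le_lt_trans ar rs)/= subr0.
Qed.

Lemma prim_le g t : L2 g -> a <= t -> t <= b -> `|prim g t| <= Num.sqrt (b - a) * nrm g.
Proof.
move=> L2g at_ tb.
rewrite -(@ler_pXn2r _ 2)// ?nnegrE ?mulr_ge0 ?sqrtr_ge0 ?nrm_ge0//.
have := sqr_prim_le L2g (lexx a) at_ tb; rewrite prim_a subr0 => /le_trans; apply.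
have e : Num.sqrt (b - a) ^+ 2 = b - a by rewrite sqr_sqrtr// subr_ge0 ltW.
by rewrite exprMn e ler_wpM2r ?exprn_ge0 ?nrm_ge0// lerB.
Qed.

Lemma continuous_prim g : L2 g -> {within `[a, b], continuous (prim g)}.
Proof.
move=> L2g; apply/subspace_continuousP => t tab; apply/cvgrPdist_lt => e e0.
have n1 : 0 < nrm g ^+ 2 + 1 by rewrite ltr_wpDl// exprn_ge0// nrm_ge0.
exists (e ^+ 2 / (nrm g ^+ 2 + 1)); first by rewrite /= divr_gt0// exprn_gt0.
move=> r /= tr rab; rewrite -(@ltr_pXn2r _ 2)// ?nnegrE//; last exact: ltW.
have h : `|prim g t - prim g r| ^+ 2 <= `|t - r| * nrm g ^+ 2.
  move: tab rab; rewrite /= !in_itv/= => /andP[at_ tb] /andP[ar rb].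
  have [rt|tr'] := leP r t.
    by rewrite [`|t - r|]ger0_norm ?subr_ge0//; exact: sqr_prim_le.
  rewrite distrC [`|t - r|]distrC [`|r - t|]ger0_norm ?subr_ge0 ?(ltW tr')//.
  by apply: sqr_prim_le => //; exact: ltW.
apply: le_lt_trans h _; move: tr; rewrite ltr_pdivlMr//; apply: le_lt_trans.
by rewrite ler_wpM2l// lerDl.
Qed.

Lemma L2_continuous u : {within `[a, b], continuous u} -> L2 u.
Proof.
move=> cu; apply: (L2_le hdot (F := fun t => `|u t| ^+ 2)) => //.
  exact: sm_continuous.
have mi : @measurable _ (measurableTypeR R) `[a, b] by exact: measurable_itv.
apply: (integrableS mi mD); first exact: subset_itv_oc_cc.
apply: continuous_compact_integrable; first exact: segment_compact.
move=> t; apply: (continuous_comp (g := fun x : X => `|x| ^+ 2)); first exact: cu.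
by move=> y; apply: (continuous_comp (g := fun r : R => r ^+ 2));
  [exact: norm_continuous|exact: exprn_continuous].
Qed.

Lemma L2_prim g : L2 g -> L2 (prim g).
Proof. by move=> L2g; apply: L2_continuous; exact: continuous_prim. Qed.

Definition C1 phi := (forall t, derivable phi t 1) /\ continuous (derive1 phi).

Lemma C1_continuous phi : C1 phi -> continuous phi.
Proof. by move=> [dphi _] t; exact/differentiable_continuous/derivable1_diffP. Qed.

Lemma vint_by_parts phi g : C1 phi -> L2 g ->
  vint (fun t => derive1 phi t *: prim g t) = phi b *: vint g - vint (fun t => phi t *: g t).
Proof.
move=> Cphi L2g; have L2p := L2_prim L2g; have cphi := C1_continuous Cphi.
have [dphi cdphi] := Cphi.
apply: vint_eq; first exact: L2Mc.
move=> x; rewrite dotBl dotZl !dot_vint//; last exact: L2Mc.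
have ig := L2_dot hdot L2g (L2_cst hdot a b x).
have := integral_by_parts dphi cdphi ig.
rewrite /L2dot => e; rewrite -[LHS]/(\int[mu]_(t in D) dot (derive1 phi t *: prim g t) x).
rewrite (@eq_Rintegral _ _ _ mu D (fun t => derive1 phi t *
   \int[mu]_(s in D) (\1_([set` `]a, t]]) s * dot (g s) x))); last first.
  by move=> t _; rewrite dotZl dot_prim.
rewrite e; congr (_ - _).
by apply: eq_Rintegral => t _; rewrite dotZl.
Qed.

End VectorIntegral.

Section WeakDerivative.
Context (R : realType) (X : completeNormedModType R) (dot : {dot X for idfun}).
Hypothesis hdot : forall x : X, dot x x = `|x| ^+ 2.
Context (a b : R).
Hypothesis ab : a < b.
Implicit Types (f g h u v w : R -> X) (phi : R -> R) (x c : X).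
Local Notation D := [set` `]a, b]].
Local Notation mu := (@lebesgue_measure R).
Local Notation L2 := (@L2 R X a b).
Local Notation ip := (L2dot dot a b).
Local Notation vint := (vint dot a b).
Local Notation prim := (prim dot a b).
Local Notation wd := (is_wder dot a b).
Local Notation crep := (crep a b).
Local Notation "f =ae g" := {ae mu, forall t, D t -> f t = g t}
  (at level 70, no associativity).

Let mD : @measurable _ (measurableTypeR R) D. Proof. exact: measurable_itv. Qed.

Lemma aeD_refl f : f =ae f. Proof. exact: aeW. Qed.
Lemma aeD_sym f g : f =ae g -> g =ae f.
Proof. by apply: aeS => t h /h. Qed.
Lemma aeD_trans f g h : f =ae g -> g =ae h -> f =ae h.
Proof. by apply: aeS2 => t fg gh Dt; rewrite fg// gh. Qed.
Lemma C1c_C1 phi : C1c a b phi -> C1 phi. Proof. by case. Qed.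

Lemma C1c_bnd phi : C1c a b phi -> phi a = 0 /\ phi b = 0.
Proof.
case=> _ _ [c [d [ac db h]]]; split; apply: h; rewrite in_itv/= negb_and -!ltNge.
  by rewrite ac.
by rewrite db orbT.
Qed.

Lemma Rintegral_derive1 phi : C1 phi -> \int[mu]_(t in D) derive1 phi t = phi b - phi a.
Proof.
move=> [dphi cphi]; rewrite /Rintegral integral_itv_obnd_cbnd ?integral_derive1//.
  exact: ltW.
by apply/measurable_EFinP/measurable_funTS; exact: continuous_measurable_fun.
Qed.

Lemma L2_cst_prim c g : L2 g -> L2 (fun t => c + prim g t).
Proof. by move=> L2g; apply: (L2D hdot); [exact: (L2_cst hdot)|exact: L2_prim]. Qed.

Lemma vint_by_parts_cst phi c g : C1 phi -> L2 g ->
  vint (fun t => derive1 phi t *: (c + prim g t)) =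
  phi b *: (c + prim g b) - phi a *: (c + prim g a) - vint (fun t => phi t *: g t).
Proof.
move=> Cphi L2g; have L2p := L2_prim hdot ab L2g; have cphi := C1_continuous Cphi.
have [dphi cdphi] := Cphi.
under eq_fun do rewrite scalerDr.
rewrite vintD//; last 2 first.
- by apply: L2Mc => //; exact: (L2_cst hdot).
- exact: L2Mc.
rewrite vint_cst_scale// vint_by_parts// Rintegral_derive1// prim_a// prim_b addr0.
by rewrite scalerBl scalerDr addrA; congr (_ - _); rewrite addrAC.
Qed.

Lemma wder_prim c g : L2 g -> wd (fun t => c + prim g t) g.
Proof.
move=> L2g phi x Cphi; have cphi := C1_continuous (C1c_C1 Cphi).
have [dphi cdphi] := C1c_C1 Cphi.
have L2p := L2_cst_prim c L2g; have [p1 p2] := C1c_bnd Cphi.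
rewrite !L2dot_scale -!(dot_vint hdot ab); try exact: L2Mc.
by rewrite vint_by_parts_cst// ?p1 ?p2 ?scale0r ?subrr ?sub0r ?dotNl//; exact: C1c_C1.
Qed.

Lemma wder_ae w w' g g' : L2 w -> L2 w' -> L2 g -> L2 g' -> w =ae w' -> g =ae g' ->
  wd w g -> wd w' g'.
Proof.
move=> L2w L2w' L2g L2g' ww' gg' wg phi x Cphi.
have cphi := C1_continuous (C1c_C1 Cphi); have [dphi cdphi] := C1c_C1 Cphi.
have L2c (psi : R -> R) : continuous psi -> L2 (fun t => psi t *: x).
  by move=> cp; apply: (L2Mc hdot) => //; exact: (L2_cst hdot).
rewrite -(L2dot_ae hdot L2w L2w' (L2c _ cdphi) ww') wg//.
by rewrite (L2dot_ae hdot L2g L2g' (L2c _ cphi) gg').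
Qed.

Lemma wderB w g v h : L2 w -> L2 g -> L2 v -> L2 h -> wd w g -> wd v h ->
  wd (fun t => w t - v t) (fun t => g t - h t).
Proof.
move=> L2w L2g L2v L2h wg vh phi x Cphi.
have cphi := C1_continuous (C1c_C1 Cphi); have [dphi cdphi] := C1c_C1 Cphi.
have L2c (psi : R -> R) : continuous psi -> L2 (fun t => psi t *: x).
  by move=> cp; apply: (L2Mc hdot) => //; exact: (L2_cst hdot).
have h1 := L2c _ cphi; have h2 := L2c _ cdphi.
by rewrite !(L2dotBl hdot)// wg// vh// opprB opprK addrC.
Qed.

(** The lemma of du Bois-Reymond makes each component constant. The constant
    is the mean of that component, so all of them are the components of the
    mean of f. *)
Lemma wder0_cst f : L2 f ->
  (forall phi x, C1c a b phi -> ip f (fun t => derive1 phi t *: x) = 0) ->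
  exists c, f =ae (fun=> c).
Proof.
move=> L2f h; exists ((b - a)^-1 *: vint f).
have L2c c := L2_cst hdot a b c.
have ba : b - a != 0 by rewrite subr_eq0 gt_eqF.
suff h0 : {ae mu, forall t, D t -> f t - (b - a)^-1 *: vint f = 0}.
  by apply: aeS h0 => t h0 /h0 /eqP; rewrite subr_eq0 => /eqP.
apply: (ae_eq0_dot hdot (f := fun t => f t - (b - a)^-1 *: vint f)).
  by apply: smB; [exact: L2_sm L2f|exact: sm_cst].
move=> x; have ifx := L2_dot hdot L2f (L2c x).
have [K hK] : exists K, {ae mu, forall t, D t -> dot (f t) x = K}.
  case: (du_bois_reymond ifx) => [phi Cphi|K hK]; last by exists K.
  by rewrite -[RHS](h phi x Cphi); apply: eq_Rintegral => t _; rewrite dotZr.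
have e : dot (vint f) x = K * (b - a).
  rewrite (dot_vint hdot ab _ L2f) -(Rintegral_itv_cst ab) /L2dot /Rintegral.
  congr fine; apply: ae_eq_integral => //.
  - by have /measurable_int := ifx.
  - by apply: aeS hK => t hK Dt /=; rewrite hK.
apply: aeS hK => t hK Dt.
by rewrite dotBl dotZl e hK// mulrC mulfK// subrr.
Qed.

(** Both w and the primitive of g have the weak derivative g, so their
    difference has the weak derivative 0. *)
Lemma wder_repr w g : L2 w -> L2 g -> wd w g ->
  exists c, w =ae (fun t => c + prim g t).
Proof.
move=> L2w L2g wg; have L2p := L2_prim hdot ab L2g.
have [c hc] : exists c, (fun t => w t - prim g t) =ae (fun=> c).
  apply: wder0_cst; first exact: L2B.
  move=> phi x Cphi; have cphi := C1_continuous (C1c_C1 Cphi).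
  have [dphi cdphi] := C1c_C1 Cphi.
  have L2c : L2 (fun t => derive1 phi t *: x).
    by apply: (L2Mc hdot) => //; exact: (L2_cst hdot).
  have := wder_prim 0 L2g x Cphi; under [X in ip X _]eq_fun do rewrite add0r.
  by move=> e; rewrite L2dotBl// wg// e subrr.
by exists c; apply: aeS hc => t h /h <-; rewrite subrK.
Qed.

(** Where two continuous functions differ, they differ on an interval, which
    has positive measure. *)
Lemma ae_continuous_eq u v : {within `[a, b], continuous u} ->
  {within `[a, b], continuous v} -> u =ae v -> forall t, t \in `[a, b] -> u t = v t.
Proof.
move=> cu cv uv t tab; apply/eqP; rewrite -subr_eq0 -normr_eq0; apply/negPn/negP => n0.
have e0 : 0 < `|u t - v t| / 2 by rewrite divr_gt0// lt_def n0 normr_ge0.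
have [d1 d10 h1] := within_continuousP cu tab e0.
have [d2 d20 h2] := within_continuousP cv tab e0.
pose d := Order.min d1 d2 / 2.
have d0 : 0 < d by rewrite divr_gt0// lt_min d10.
have [dd1 dd2] : d < d1 /\ d < d2.
  have m0 : 0 < Order.min d1 d2 by rewrite lt_min d10.
  have dm : d < Order.min d1 d2 by rewrite ltr_pdivrMr// ltr_pMr// ltr1n.
  by move: dm; rewrite lt_min => /andP.
clearbody d.
pose p := Order.max a (t - d); pose q := Order.min b (t + d).
have [at_ tb] : a <= t /\ t <= b by move: tab; rewrite in_itv/= => /andP.
have pq : p < q.
  have h3 : a < t + d by rewrite (le_lt_trans at_)// ltrDl.
  have h4 : t - d < b by rewrite (lt_le_trans _ tb)// ltrBlDr ltrDl.
  have h5 : t - d < t + d by rewrite (@lt_trans _ _ t)// ?ltrDl// ltrBlDr ltrDl.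
  by rewrite lt_min !gt_max ab h3 h4 h5.
have [N [mN N0 hN]] := uv.
have sub : [set` `]p, q]] `<=` N.
  move=> r /=; rewrite in_itv/= le_min gt_max => /andP[/andP[ar tr] /andP[rb rt]].
  apply: hN => /= h.
  have rD : r \in `]a, b] by rewrite in_itv/= ar rb.
  have rab : r \in `[a, b] by rewrite in_itv/= (ltW ar) rb.
  have trd : `|t - r| <= d by rewrite ler_norml; apply/andP; split; lra.
  have k1 := h1 r rab (le_lt_trans trd dd1).
  have k2 := h2 r rab (le_lt_trans trd dd2).
  have := ler_distD (u r) (u t) (v t).
  by rewrite {2}(h rD) [X in _ <= _ + X]distrC; lra.
have : (mu [set` `]p, q]] <= mu N)%E.
  by apply: le_measure; rewrite ?inE//; exact: measurable_itv.
by rewrite N0 (mu_itvE (ltW pq)) lee_fin subr_le0 leNgt pq.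
Qed.

(** The increments of the two primitives agree, so g - g' has zero integral
    over every interval. This is what makes weak derivatives unique. *)
Lemma prim_ae_inj c g c' g' : L2 g -> L2 g' ->
  (fun t => c + prim g t) =ae (fun t => c' + prim g' t) -> g =ae g'.
Proof.
move=> L2g L2g' h.
have L2d := L2B hdot L2g L2g'.
have cd : forall t, t \in `[a, b] -> prim (fun s => g s - g' s) t = c' - c.
  apply: ae_continuous_eq; first exact: continuous_prim.
    by apply: continuous_subspaceT => t; exact: cvg_cst.
  apply: aeS h => t /[apply] e; rewrite primB//.
  by apply: (addrI c); rewrite addrA e addrK addrC subrK.
have cc : c' - c = 0.
  by rewrite -(cd a) ?prim_a// in_itv/= lexx ltW.
suff : {ae mu, forall t, D t -> g t - g' t = 0}.
  by apply: aeS => t h0 /h0 /eqP; rewrite subr_eq0 => /eqP.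
apply: (ae_eq0_dot hdot (f := fun t => g t - g' t)); first exact: L2_sm L2d.
move=> x; have L2c := L2_cst hdot a b x; have ifx := L2_dot hdot L2d L2c.
apply: (ae_eq0_integral ifx) => p q ap pq qb.
have e r : a < r -> r < b ->
    \int[mu]_(s in D) (\1_([set` `]a, r]]) s * dot (g s - g' s) x) = 0.
  move=> ar rb; rewrite -dot_prim// cd ?cc ?dot0l//.
  by rewrite in_itv/= !ltW.
have bq := lt_trans ap pq.
have pb := lt_trans pq qb.
have e1 := e _ ap pb; have e2 := e _ bq qb.
have mi (c1 d1 : R) : @measurable _ (measurableTypeR R) [set` `]c1, d1]] by exact: measurable_itv.
have ii r : mu.-integrable D (EFin \o (fun s => \1_([set` `]a, r]]) s * dot (g s - g' s) x)).
  apply: (le_integrable (mi a b) _ _ ifx).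
    apply/measurable_EFinP; apply: measurable_funM; first exact: measurable_indic.
    by have /measurable_int/measurable_EFinP := ifx.
  move=> s _; rewrite /= lee_fin normrM ler_piMl//.
  by rewrite indicE; case: (_ \in _); rewrite ?normr1 ?normr0.
rewrite Rintegral_itv_bndo_bndc; last first.
  by apply: integrableS ifx => //; apply: subset_itv; rewrite bnd_simp ltW.
rewrite -[RHS](subrr 0) -{1}e2 -e1 -RintegralB//.
rewrite Rintegral_mkcond [RHS]Rintegral_mkcond; apply: eq_Rintegral => s _.
rewrite !patchE !indicE !mem_setE !in_itv/=.
have [ps|sp] := ltP p s.
  rewrite (lt_trans ap ps)/= mul0r subr0.
  have [sq|qs] := leP s q; first by rewrite (le_trans sq (ltW qb)) mul1r.
  by rewrite mul0r; case: ifP.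
rewrite (le_trans sp (ltW pq)) (le_trans sp (ltW pb)) !andbT.
by case: ifP => // _; rewrite subrr.
Qed.

(** A weak derivative is determined only almost everywhere; this relation lets
    each statement use the representative at hand, for instance the explicit
    derivative of a polynomial. *)
Definition H1pair w g := [/\ L2 w, L2 g & wd w g].

Lemma H1pair_repr w g : H1pair w g -> exists c, w =ae (fun t => c + prim g t).
Proof. by case=> L2w L2g wg; exact: wder_repr. Qed.

Lemma H1pair_prim c g : L2 g -> H1pair (fun t => c + prim g t) g.
Proof. by move=> L2g; split=> //; [exact: L2_cst_prim|exact: wder_prim]. Qed.

Lemma H1pair_ae w w' g g' : L2 w' -> L2 g' -> w =ae w' -> g =ae g' ->
  H1pair w g -> H1pair w' g'.
Proof.
by move=> ? ? ? ? [? ? ?]; split=> //; exact: (@wder_ae w w' g g').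
Qed.

Lemma H1pairB w g v h : H1pair w g -> H1pair v h ->
  H1pair (fun t => w t - v t) (fun t => g t - h t).
Proof. by move=> [? ? ?] [? ? ?]; split; [exact: L2B..|exact: wderB]. Qed.

Lemma H1pair_uniq w g g' : H1pair w g -> H1pair w g' -> g =ae g'.
Proof.
move=> wg wg'; have [c hc] := H1pair_repr wg; have [c' hc'] := H1pair_repr wg'.
case: wg wg' => L2w L2g _ [_ L2g' _]; apply: (@prim_ae_inj c g c' g') => //.
exact: aeD_trans (aeD_sym hc) hc'.
Qed.

Lemma wder_H1pair w g : H1pair w g -> H1pair w (wder dot a b w).
Proof.
move=> [L2w L2g wg].
by have [] := @xgetPex _ (fun=> 0) [set g | L2 g /\ wd w g] (ex_intro _ g (conj L2g wg)).
Qed.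

Lemma wderE w g : H1pair w g -> wder dot a b w =ae g.
Proof. by move=> wg; apply: (@H1pair_uniq w) => //; exact: wder_H1pair wg. Qed.

Lemma continuous_cst_prim c g : L2 g -> {within `[a, b], continuous (fun t => c + prim g t)}.
Proof.
move=> L2g t; apply: cvgD; first exact: cvg_cst.
exact: (continuous_prim hdot ab L2g).
Qed.

Lemma crepE w u : {within `[a, b], continuous u} -> w =ae u ->
  forall t, t \in `[a, b] -> crep w t = u t.
Proof.
move=> cu wu.
have [cc cw] := @xgetPex _ (fun=> 0) [set c | {within `[a, b], continuous c} /\ c =ae w]
  (ex_intro _ u (conj cu (aeD_sym wu))).
by apply: ae_continuous_eq => //; exact: aeD_trans wu.
Qed.

Lemma crep_prim w c g : L2 g -> w =ae (fun t => c + prim g t) ->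
  forall t, t \in `[a, b] -> crep w t = c + prim g t.
Proof. by move=> L2g; apply: crepE; exact: continuous_cst_prim. Qed.

Lemma H1pair_crep w g : H1pair w g -> w =ae (fun t => crep w a + prim g t).
Proof.
move=> wg; have [c hc] := H1pair_repr wg; have [_ L2g _] := wg.
suff -> : crep w a = c by [].
by rewrite (crep_prim L2g hc) ?prim_a ?addr0// in_itv/= lexx ltW.
Qed.

Lemma crep_b w g : H1pair w g -> crep w b = crep w a + vint g.
Proof.
move=> wg; have [_ L2g _] := wg.
by rewrite (crep_prim L2g (H1pair_crep wg)) ?prim_b// in_itv/= lexx ltW.
Qed.

(** Integration by parts, with the point values of the continuous
    representative. *)
Lemma H1_by_parts phi w g : C1 phi -> H1pair w g ->
  vint (fun t => derive1 phi t *: w t) =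
  phi b *: crep w b - phi a *: crep w a - vint (fun t => phi t *: g t).
Proof.
move=> Cphi wg; have [L2w L2g _] := wg; have hw := H1pair_crep wg.
have [dphi cdphi] := Cphi.
have ea : crep w a = crep w a + prim g a by rewrite prim_a// addr0.
rewrite (crep_b wg) -(prim_b dot a b g) [X in phi a *: X]ea.
rewrite -vint_by_parts_cst//; apply: (vint_ae hdot ab).
- exact: L2Mc.
- by apply: L2Mc => //; exact: L2_cst_prim.
- by apply: aeS hw => t h Dt; rewrite h.
Qed.

End WeakDerivative.

(** * Legendre polynomials *)

Section Legendre.
Context (R : realType) (a b : R).
Hypothesis ab : a < b.
Local Notation D := [set` `]a, b]].
Local Notation mu := (@lebesgue_measure R).

Let tau : R := b - a.
Let k : R := 2 / tau.
Let tau0 : tau != 0. Proof. by rewrite subr_eq0 gt_eqF. Qed.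

(** The affine map of [a, b] onto [-1, 1]; it is locked because in the
    Legendre identities it plays the part of the variable. *)
Definition refvar : {poly R} := locked (k%:P * 'X - ((a + b) / tau)%:P).

(** Bonnet's recurrence reaches back two steps, so that two consecutive
    polynomials are computed together. *)
Fixpoint legpair (n : nat) : {poly R} * {poly R} :=
  if n is m.+1 then
    let: (p, q) := legpair m in
    (q, ((m.+2%:R^-1)%:P * ((2 * m + 3)%:R * refvar * q - m.+1%:R * p)))
  else (1, refvar).

(** The Legendre polynomials of [a, b], normalised to the value 1 at b. *)
Definition leg n := (legpair n).1.

Lemma leg0 : leg 0 = 1. Proof. by []. Qed.
Lemma leg1 : leg 1 = refvar. Proof. by []. Qed.

Lemma natr_poly (n : nat) : n%:R = (n%:R : R)%:P :> {poly R}.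
Proof. by rewrite -polyC_natr. Qed.

Lemma natr_poly_neq0 (n : nat) : n.+1%:R != 0 :> {poly R}.
Proof. by rewrite natr_poly polyC_eq0 pnatr_eq0. Qed.

Lemma legSS n : n.+2%:R * leg n.+2 =
  (2 * n + 3)%:R * refvar * leg n.+1 - n.+1%:R * leg n.
Proof.
rewrite /leg /=; case: (legpair n) => p q /=.
by rewrite mulrA natr_poly -polyCM mulfV ?pnatr_eq0// mul1r.
Qed.

Lemma deriv_refvar : deriv refvar = k%:P.
Proof. by rewrite /refvar -lock derivB derivM !derivC derivX mul0r add0r mulr1 subr0. Qed.

Lemma refvar_b : refvar.[b] = 1.
Proof. by rewrite /refvar -lock !hornerE /k /tau; field. Qed.

Lemma refvar_a : refvar.[a] = - 1.
Proof. by rewrite /refvar -lock !hornerE /k /tau; field. Qed.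

(** Two classical relations between Legendre polynomials and their
    derivatives. They are proved together, as the induction step of either one
    uses the other. *)
Lemma deriv_legAB n :
  (leg n.+1)^`() = n.+1%:R * k%:P * leg n + refvar * (leg n)^`() /\
  refvar * (leg n.+1)^`() - (leg n)^`() = n.+1%:R * k%:P * leg n.+1.
Proof.
elim: n => [|n [A B]].
  by rewrite leg0 leg1 deriv_refvar derivC; split; ring.
have A1 : (leg n.+2)^`() = n.+2%:R * k%:P * leg n.+1 + refvar * (leg n.+1)^`().
  apply: (mulfI (natr_poly_neq0 n.+1)).
  have e : n.+2%:R * (leg n.+2)^`() = (n.+2%:R * leg n.+2)^`().
    by rewrite natr_poly derivM derivC mul0r add0r.
  rewrite e legSS derivB !derivM !natr_poly !derivC deriv_refvar -!natr_poly.
  have -> : (leg n)^`() = refvar * (leg n.+1)^`() - n.+1%:R * k%:P * leg n.+1.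
    by rewrite -B; ring.
  ring.
split=> //; rewrite A1.
have e1 := legSS n.
have -> : n.+2%:R * k%:P * leg n.+2 = k%:P * (n.+2%:R * leg n.+2) by ring.
rewrite e1 {2}A.
have -> : (leg n)^`() = refvar * (leg n.+1)^`() - n.+1%:R * k%:P * leg n.+1.
  by rewrite -B; ring.
ring.
Qed.

Lemma deriv_legSS n : (leg n.+2)^`() = (leg n)^`() + (2 * n + 3)%:R * k%:P * leg n.+1.
Proof.
have [A _] := deriv_legAB n.+1; have [_ B] := deriv_legAB n.
have -> : (leg n)^`() = refvar * (leg n.+1)^`() - n.+1%:R * k%:P * leg n.+1.
  by rewrite -B; ring.
rewrite A; ring.
Qed.

Lemma leg_b n : (leg n).[b] = 1.
Proof.
suff : (leg n).[b] = 1 /\ (leg n.+1).[b] = 1 by case.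
elim: n => [|n [h1 h2]]; first by rewrite leg0 leg1 hornerC refvar_b.
split=> //; have := congr1 (horner^~ b) (legSS n).
rewrite /= !natr_poly !(hornerE, hornerM) h1 h2 refvar_b !mulr1 => e.
have n0 : n.+2%:R != 0 :> R by rewrite pnatr_eq0.
apply: (mulfI n0); rewrite e mulr1; ring.
Qed.

Lemma leg_a n : (leg n).[a] = (-1) ^+ n.
Proof.
suff : (leg n).[a] = (-1) ^+ n /\ (leg n.+1).[a] = (-1) ^+ n.+1 by case.
elim: n => [|n [h1 h2]]; first by rewrite leg0 leg1 hornerC refvar_a.
split=> //; have := congr1 (horner^~ a) (legSS n).
rewrite /= !natr_poly !(hornerE, hornerM) h1 h2 refvar_a => e.
have n0 : n.+2%:R != 0 :> R by rewrite pnatr_eq0.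
apply: (mulfI n0); rewrite e !exprS; ring.
Qed.

(** The differential equation follows by eliminating the derivative of leg
    n.-1 between the two relations of deriv_legAB. *)
Lemma leg_ode n : ((1 - refvar ^+ 2) * (leg n)^`())^`() =
  - ((n * n.+1)%:R * (k ^+ 2)%:P * leg n).
Proof.
case: n => [|n]; first by rewrite leg0 derivC mulr0 deriv0 mul0n !mul0r oppr0.
have [A B] := deriv_legAB n.
have -> : (1 - refvar ^+ 2) * (leg n.+1)^`() =
    (n.+1%:R * k%:P) * (leg n - refvar * leg n.+1).
  have e : (leg n)^`() = refvar * (leg n.+1)^`() - n.+1%:R * k%:P * leg n.+1.
    by rewrite -B; ring.
  by rewrite mulrBl {1}A e; ring.
rewrite derivM natr_poly -polyCM derivC mul0r add0r derivB derivM deriv_refvar.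
have -> : (leg n)^`() = refvar * (leg n.+1)^`() - n.+1%:R * k%:P * leg n.+1.
  by rewrite -B; ring.
rewrite polyC_exp polyCM -!natr_poly; ring.
Qed.

Definition pint (p : {poly R}) : R := \int[mu]_(t in D) p.[t].

Lemma integrable_poly p : mu.-integrable D (EFin \o horner p).
Proof.
apply: integrable_continuous; first exact: continuous_horner.
by exists a, b; exact: subset_itv_oc_cc.
Qed.

Let mD : @measurable _ (measurableTypeR R) D. Proof. exact: measurable_itv. Qed.

Lemma pintD p q : pint (p + q) = pint p + pint q.
Proof.
rewrite /pint -RintegralD//; try exact: integrable_poly.
by apply: eq_Rintegral => t _; rewrite hornerD.
Qed.

Lemma pintZ c p : pint (c%:P * p) = c * pint p.
Proof.
rewrite /pint -RintegralZl//; last exact: integrable_poly.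
by apply: eq_Rintegral => t _; rewrite hornerM hornerC.
Qed.

Lemma pint0 : pint 0 = 0.
Proof. by have := pintZ 0 0; rewrite mulr0 mul0r. Qed.

Lemma pintB p q : pint (p - q) = pint p - pint q.
Proof. by rewrite pintD -mulN1r -polyCN pintZ mulN1r. Qed.

Lemma C1_horner (p : {poly R}) : C1 (horner p).
Proof. by split; [exact: derivable_horner|rewrite -derivE; exact: continuous_horner]. Qed.

Lemma pint_deriv p : pint p^`() = p.[b] - p.[a].
Proof. by rewrite /pint derivE Rintegral_derive1//; [exact: C1_horner]. Qed.

(** The operator of the Legendre equation is symmetric, since its weight 1 -
    refvar ^+ 2 vanishes at both ends, and its eigenvalues are distinct. *)
Lemma pint_leg_orth n m : n != m -> pint (leg n * leg m) = 0.
Proof.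
move=> nm; pose w := 1 - refvar ^+ 2.
have wa : w.[a] = 0 by rewrite !hornerE refvar_a; ring.
have wb : w.[b] = 0 by rewrite !hornerE refvar_b; ring.
have ode i : (w * (leg i)^`())^`() = - ((i * i.+1)%:R * (k ^+ 2)%:P * leg i).
  exact: leg_ode.
clearbody w; have := pint_deriv (w * (leg n)^`() * leg m - w * (leg m)^`() * leg n).
rewrite !hornerE wa wb !mul0r subrr.
rewrite derivB !(derivM (w * _)) !ode.
have -> : - ((n * n.+1)%:R * (k ^+ 2)%:P * leg n) * leg m + w * (leg n)^`() * (leg m)^`() -
  (- ((m * m.+1)%:R * (k ^+ 2)%:P * leg m) * leg n + w * (leg m)^`() * (leg n)^`()) =
  (((m * m.+1)%:R - (n * n.+1)%:R) * k ^+ 2)%:P * (leg n * leg m).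
  rewrite [in RHS]polyCM [in RHS]polyCB -!natr_poly; ring.
have k0 : k != 0 by rewrite /k mulf_neq0 ?invr_eq0 ?pnatr_eq0.
have mn : (m * m.+1)%:R - (n * n.+1)%:R != 0 :> R.
  by rewrite subr_eq0 eqr_nat; apply: contraNneq nm; nia.
rewrite pintZ => /eqP; rewrite mulf_eq0 => /orP[/eqP h|/eqP//].
by have := mulf_neq0 mn (expf_neq0 2 k0); rewrite h eqxx.
Qed.

Lemma pint_leg_deriv n m : (m <= n)%N -> pint (leg n * (leg m)^`()) = 0.
Proof.
suff : ((m <= n)%N -> pint (leg n * (leg m)^`()) = 0) /\
       ((m.+1 <= n)%N -> pint (leg n * (leg m.+1)^`()) = 0) by case.
elim: m => [|m [h1 h2]].
  rewrite leg0 leg1 derivC deriv_refvar; split=> n0; rewrite mulrC.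
    by rewrite pintZ mul0r.
  by rewrite pintZ -[leg n]mulr1 -leg0 pint_leg_orth ?mulr0// -lt0n.
split=> // mn; rewrite deriv_legSS mulrDr pintD h1 ?add0r//; last first.
  by apply: leq_trans mn; rewrite -addn2 leq_addr.
have -> : leg n * ((2 * m + 3)%:R * k%:P * leg m.+1) =
    ((2 * m + 3)%:R * k)%:P * (leg n * leg m.+1).
  by rewrite [in RHS]polyCM -natr_poly; ring.
by rewrite pintZ pint_leg_orth ?mulr0// gtn_eqF.
Qed.

(** Integrate the derivative of refvar * leg n ^+ 2, whose boundary values are
    known. *)
Lemma pint_leg_sqr n : pint (leg n * leg n) = tau / (2 * n + 1)%:R.
Proof.
have := pint_deriv (refvar * (leg n * leg n)).
have -> : (refvar * (leg n * leg n)).[b] - (refvar * (leg n * leg n)).[a] = 2.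
  rewrite !hornerM refvar_b refvar_a leg_b leg_a.
  by have := sqrr_sign R n; rewrite expr2 => ->; ring.
have -> : (refvar * (leg n * leg n))^`() =
    k%:P * (leg n * leg n) + (2)%:P * (leg n * (refvar * (leg n)^`())).
  by rewrite !derivM deriv_refvar polyC_natr; ring.
have -> : pint (k%:P * (leg n * leg n) + (2)%:P * (leg n * (refvar * (leg n)^`()))) =
    (2 * n + 1)%:R * k * pint (leg n * leg n).
  rewrite pintD !pintZ; case: n => [|n].
    by rewrite leg0 derivC !mulr0 pint0; ring.
  have -> : refvar * (leg n.+1)^`() = (n.+1%:R * k)%:P * leg n.+1 + (leg n)^`().
    have [_ B] := deriv_legAB n; rewrite [in RHS]polyCM -natr_poly -B; ring.
  rewrite mulrDr pintD pint_leg_deriv// mulrCA pintZ; ring.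
move=> e; have n0 : (2 * n + 1)%:R != 0 :> R by rewrite pnatr_eq0 addn1.
have k0 : k != 0 by rewrite /k mulf_neq0 ?invr_eq0 ?pnatr_eq0.
apply: (mulfI (mulf_neq0 n0 k0)); rewrite e /k.
by move: ((2 * n + 1)%:R : R) n0 => c n0; field; rewrite n0 tau0.
Qed.

(** The closed form of the primitive of leg n that vanishes at a, read off
    from deriv_legSS. For n > 0 it also vanishes at b, so that integrating by
    parts against it leaves no boundary terms. *)
Definition primleg n : {poly R} :=
  if n is m.+1 then (((2 * m + 3)%:R * k)^-1)%:P * (leg m.+2 - leg m) else 'X - a%:P.

Arguments primleg : simpl never.

Lemma deriv_primleg n : (primleg n)^`() = leg n.
Proof.
case: n => [|n]; first by rewrite derivB derivX derivC subr0.
have k0 : k != 0 by rewrite /k mulf_neq0 ?invr_eq0 ?pnatr_eq0.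
rewrite /primleg derivM derivC mul0r add0r derivB deriv_legSS addrAC subrr add0r.
by rewrite natr_poly mulrA -!polyCM mulVf ?mul1r// mulf_neq0// pnatr_eq0 addn3.
Qed.

Lemma primleg_a n : (primleg n).[a] = 0.
Proof.
case: n => [|n]; first by rewrite !hornerE subrr.
by rewrite /primleg !hornerE !leg_a !exprS !mulN1r opprK subrr mulr0.
Qed.

Lemma primleg_b n : (primleg n).[b] = if n is 0%N then tau else 0.
Proof.
case: n => [|n]; first by rewrite !hornerE.
by rewrite /primleg !hornerE !leg_b subrr mulr0.
Qed.

Lemma pint_primleg_sqr n : pint (primleg n * primleg n) =
  if n is m.+1 then (tau / 2) ^+ 2 / (2 * m + 3)%:R ^+ 2 *
     (tau / (2 * m + 5)%:R + tau / (2 * m + 1)%:R) else tau ^+ 3 / 3.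
Proof.
case: n => [|n].
  have -> : primleg 0 * primleg 0 = (3^-1%:P * ('X - a%:P) ^+ 3)^`().
    have e3 : (3^-1)%:P * 3%:R = 1 :> {poly R}.
      by rewrite natr_poly -polyCM mulVf ?pnatr_eq0.
    rewrite derivM derivC mul0r add0r deriv_exp derivXsubC mul1r /=.
    by rewrite -[X in _ = _ * X]mulr_natr mulrCA e3 mulr1 expr2.
  by rewrite pint_deriv !(horner_exp, hornerXsubC, hornerC, hornerM) subrr expr0n mulr0 subr0 mulrC.
rewrite /primleg; set c := (_ * k)^-1.
have -> : c%:P * (leg n.+2 - leg n) * (c%:P * (leg n.+2 - leg n)) =
  (c ^+ 2)%:P * ((leg n.+2 * leg n.+2 + leg n * leg n) - 2%:P * (leg n.+2 * leg n)).
  by rewrite polyC_exp polyC_natr; ring.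
rewrite pintZ pintB pintD pintZ (@pint_leg_orth n.+2 n); last by rewrite gtn_eqF// ltnS leqnSn.
rewrite mulr0 subr0 !pint_leg_sqr; congr (_ * _).
  have h3 : (2 * n + 3)%:R != 0 :> R by rewrite pnatr_eq0 addn3.
  rewrite /c /k; move: ((2 * n + 3)%:R : R) h3 => x x0.
  by field; rewrite x0 tau0.
by congr (tau / _%:R + _); lia.
Qed.

(** The kernel of the map f |-> prim f is the indicator of s <= t, whose
    squared Hilbert-Schmidt norm is tau ^+ 2 / 2. This is the part that
    remains of it after projecting away M.+1 Legendre polynomials. *)
Definition defect (M : nat) : R :=
  tau ^+ 2 / 8 * ((2 * M + 1)%:R^-1 + (2 * M + 3)%:R^-1).

(** The sum telescopes, by pint_primleg_sqr. *)
Lemma sum_pint_primleg M :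
  \sum_(i < M.+1) (2 * i + 1)%:R / tau * pint (primleg i * primleg i) =
  tau ^+ 2 / 2 - defect M.
Proof.
elim: M => [|M ih].
  rewrite big_ord1 pint_primleg_sqr /defect /= !muln0 !add0n; field.
  exact: tau0.
rewrite big_ord_recr /= ih pint_primleg_sqr /defect.
have h1 : (2 * M + 1)%:R != 0 :> R by rewrite pnatr_eq0 addn1.
have h3 : (2 * M + 3)%:R != 0 :> R by rewrite pnatr_eq0 addn3.
have h5 : (2 * M + 5)%:R != 0 :> R by rewrite pnatr_eq0; lia.
have -> : (2 * M.+1 + 1 = 2 * M + 3)%N by lia.
have -> : (2 * M.+1 + 3 = 2 * M + 5)%N by lia.
move: h1 h3 h5.
have -> : (2 * M + 1)%:R = (2 * M + 3)%:R - 2 :> R by rewrite -natrB ?addn3//; congr _%:R; lia.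
have -> : (2 * M + 5)%:R = (2 * M + 3)%:R + 2 :> R by rewrite -natrD; congr _%:R; lia.
move: (_%:R) => x h1 h3 h5; field.
by rewrite tau0 h1 h3 h5.
Qed.

End Legendre.

Section PolynomialBases.
Context (R : realType) (X : completeNormedModType R).
Implicit Types (P : nat -> {poly R}) (c d : nat -> X).

Definition pcomb P n c (t : R) : X := \sum_(i < n) (P i).[t] *: c i.

Lemma poly_span P n (p : {poly R}) : (forall i, size (P i) = i.+1) -> (size p <= n)%N ->
  exists d : nat -> R, p = \sum_(i < n) (d i)%:P * P i.
Proof.
move=> sP; elim: n p => [|n ih] p sp.
  exists (fun=> 0); rewrite big_ord0; apply/eqP; rewrite -size_poly_leq0.
  exact: sp.
pose e := p`_n / lead_coef (P n).
have lP : lead_coef (P n) != 0 by rewrite lead_coef_eq0 -size_poly_eq0 sP.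
have [|d hd] := ih (p - e%:P * P n).
  apply/leq_sizeP => j; rewrite leq_eqVlt => /predU1P[<-|nj].
    rewrite coefB coefCM /e; have -> : (P n)`_n = lead_coef (P n) by rewrite lead_coefE sP.
    by rewrite divfK ?subrr.
  by rewrite coefB coefCM !nth_default ?mulr0 ?subrr ?sP// (leq_trans sp).
exists (fun i => if i == n then e else d i); rewrite big_ord_recr /= eqxx.
rewrite (eq_bigr (fun i : 'I_n => (d i)%:P * P i)) => [|i _].
  by rewrite -hd subrK.
by rewrite ltn_eqF.
Qed.

Lemma polyT_basis P q (u : R -> X) : (forall i, size (P i) = i.+1) ->
  polyT X q u <-> exists c, u = pcomb P q.+1 c.
Proof.
move=> sP; split=> [[c ->]|[c ->]].
  have /choice[e he] (i : 'I_q.+1) :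
      exists e : nat -> R, 'X^i = \sum_(j < q.+1) (e j)%:P * P j.
    by apply: poly_span => //; rewrite size_polyXn.
  exists (fun j => \sum_(i < q.+1) e i j *: c i); apply/funext => t.
  rewrite /pcomb (eq_bigr (fun i : 'I_q.+1 => \sum_(j < q.+1) ((P j).[t] * e i j) *: c i)).
    rewrite exchange_big /=; apply: eq_bigr => j _; rewrite scaler_sumr.
    by apply: eq_bigr => i _; rewrite scalerA.
  move=> i _; have := congr1 (horner^~ t) (he i).
  rewrite /= hornerXn horner_sum => ->; rewrite scaler_suml.
  by apply: eq_bigr => j _; rewrite hornerM hornerC mulrC.
exists (fun j => \sum_(i < q.+1) (P i)`_j *: c i); apply/funext => t.
rewrite /pcomb (eq_bigr (fun i : 'I_q.+1 => \sum_(j < q.+1) ((t ^+ j * (P i)`_j) *: c i))).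
  rewrite exchange_big /=; apply: eq_bigr => j _; rewrite scaler_sumr.
  by apply: eq_bigr => i _; rewrite scalerA.
move=> i _; rewrite (@horner_coef_wide _ q.+1) ?sP// scaler_suml.
by apply: eq_bigr => j _; rewrite mulrC.
Qed.

Lemma derive1_pcomb P n c : derive1 (pcomb P n c) = pcomb (fun i => (P i)^`()) n c.
Proof.
apply/funext => t; rewrite derive1E.
suff h : is_derive t 1 (pcomb P n c) (pcomb (fun i => (P i)^`()) n c t) by exact: derive_val.
have hs (p : {poly R}) (x : X) : is_derive t 1 (fun r => p.[r] *: x) (p^`().[t] *: x).
  have hp : is_derive t 1 (horner p) p^`().[t] by exact: is_derive_poly.
  have [dp vp] := hp.
  have lp : h^-1 *: ((fun r => p.[r] *: x) (h *: 1 + t) - p.[t] *: x) @[h --> 0^'] -->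
      p^`().[t] *: x.
    have -> : (fun h : R => h^-1 *: ((fun r => p.[r] *: x) (h *: 1 + t) - p.[t] *: x)) =
      fun h => (h^-1 *: (p.[h *: 1 + t] - p.[t])) *: x.
      by apply/funext => h /=; rewrite -scalerBl scalerA.
    by apply: cvgZr_tmp; rewrite -vp; exact: dp.
  apply: DeriveDef; first by apply/cvg_ex; exists (p^`().[t] *: x).
  by rewrite /derive; apply: cvg_lim.
rewrite /pcomb; elim: n => [|n ih].
  rewrite big_ord0 (_ : (fun r => _) = cst 0); last by apply/funext => r; rewrite big_ord0.
  exact: is_derive_cst.
rewrite big_ord_recr /= (_ : (fun r => _) = (fun r => \sum_(i < n) (P i).[r] *: c i) \+
   (fun r => (P n).[r] *: c n)); last by apply/funext => r; rewrite big_ord_recr.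
exact: is_deriveD.
Qed.

Lemma size_leg (a b : R) n : a < b -> size (leg a b n) = n.+1.
Proof.
move=> ab; have ba : b - a != 0 by rewrite subr_eq0 gt_eqF.
have sr : size (refvar a b) = 2%N.
  have s1 : size ((2 / (b - a))%:P * 'X) = 2%N.
    by rewrite size_Cmul ?size_polyX// mulf_neq0// ?invr_eq0// pnatr_eq0.
  rewrite /refvar -lock size_polyDl s1// size_polyN.
  exact: leq_ltn_trans (size_polyC_leq1 _) _.
suff : size (leg a b n) = n.+1 /\ size (leg a b n.+1) = n.+2 by case.
elim: n => [|n [h1 h2]]; first by rewrite leg0 leg1 size_poly1.
split=> //; have e := legSS a b n.
have c0 m : m.+1%:R != 0 :> R by rewrite pnatr_eq0.
have -> : size (leg a b n.+2) = size (n.+2%:R * leg a b n.+2).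
  by rewrite natr_poly size_Cmul.
have e1 : size ((2 * n + 3)%:R * refvar a b * leg a b n.+1) = n.+3.
  rewrite natr_poly -mulrA size_Cmul ?addn3//.
  by rewrite size_mul -?size_poly_eq0 ?sr ?h2.
rewrite e size_polyDl e1// size_polyN natr_poly size_Cmul// h1.
by rewrite ltnS leqnSn.
Qed.

(** In this basis of the polynomials the derivative is a shift to the basis of
    Legendre polynomials. *)
Definition primbasis (a b : R) i : {poly R} := if i is j.+1 then primleg a b j else 1.

Lemma size_primbasis (a b : R) i : a < b -> size (primbasis a b i) = i.+1.
Proof.
move=> ab; case: i => [|[|i]]; first by rewrite size_poly1.
  by rewrite /= /primleg size_XsubC.
have ba : b - a != 0 by rewrite subr_eq0 gt_eqF.
have c0 : ((2 * i + 3)%:R * (2 / (b - a)))^-1 != 0.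
  by rewrite invr_eq0 !mulf_neq0// ?invr_eq0 ?pnatr_eq0// addn3.
by rewrite /= /primleg size_Cmul// size_polyDl size_leg// size_polyN size_leg//.
Qed.

End PolynomialBases.

(** * Legendre expansions *)

Section Expansion.
Context (R : realType) (X : completeNormedModType R) (dot : {dot X for idfun}).
Hypothesis hdot : forall x : X, dot x x = `|x| ^+ 2.
Context (a b : R).
Hypothesis ab : a < b.
Implicit Types (f g h u v w : R -> X) (phi : R -> R) (x : X) (c d : nat -> X).
Local Notation D := [set` `]a, b]].
Local Notation mu := (@lebesgue_measure R).
Local Notation L2 := (@L2 R X a b).
Local Notation ip := (L2dot dot a b).
Local Notation nrm := (nrm dot a b).
Local Notation vint := (vint dot a b).
Local Notation prim := (prim dot a b).
Local Notation H1pair := (H1pair dot a b).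
Local Notation leg := (leg a b).
Local Notation primleg := (primleg a b).
Local Notation pint := (pint a b).
Local Notation "f =ae g" := {ae mu, forall t, D t -> f t = g t}
  (at level 70, no associativity).

Let mD : @measurable _ (measurableTypeR R) D. Proof. exact: measurable_itv. Qed.
Let tau : R := b - a.
Let tau0 : 0 < tau. Proof. by rewrite subr_gt0. Qed.
Let L2cst x : L2 (fun=> x). Proof. exact: (L2_cst hdot). Qed.

Lemma L2_poly (p : {poly R}) f : L2 f -> L2 (fun t => p.[t] *: f t).
Proof. by move=> L2f; apply: (L2Mc hdot) => //; exact: continuous_horner. Qed.

Lemma L2_pcomb P n c : L2 (pcomb P n c).
Proof. by apply: (L2_sum hdot) => i; exact: L2_poly. Qed.

Lemma vint_sum (I : Type) (s : seq I) (F : I -> R -> X) : (forall i, L2 (F i)) ->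
  vint (fun t => \sum_(i <- s) F i t) = \sum_(i <- s) vint (F i).
Proof.
move=> sF; elim: s => [|i s ih].
  rewrite big_nil; under eq_fun do rewrite big_nil.
  by apply: (vint_eq hdot ab) => // x; rewrite L2dot0l dot0l.
rewrite big_cons -ih; under eq_fun do rewrite big_cons.
by apply: (vintD hdot ab) => //; exact: (L2_sum hdot).
Qed.

Definition mom i f : X := vint (fun t => (leg i).[t] *: f t).

Lemma momB i f g : L2 f -> L2 g -> mom i (fun t => f t - g t) = mom i f - mom i g.
Proof.
move=> L2f L2g; rewrite /mom -(vintB hdot ab); try exact: L2_poly.
by congr vint; apply/funext => t; rewrite scalerBr.
Qed.

Lemma vint_poly_cst (p : {poly R}) x : vint (fun t => p.[t] *: x) = pint p *: x.
Proof. by apply: (vint_cst_scale hdot ab); exact: continuous_horner. Qed.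

Lemma mom_lcomb n c i : mom i (pcomb leg n c) =
  if (i < n)%N then (tau / (2 * i + 1)%:R) *: c i else 0.
Proof.
have -> : mom i (pcomb leg n c) = \sum_(j < n) pint (leg i * leg j) *: c j.
  rewrite /mom /pcomb; under eq_fun do rewrite scaler_sumr.
  rewrite vint_sum; last by move=> j; do 2 apply: L2_poly.
  apply: eq_bigr => j _; rewrite -vint_poly_cst; congr vint.
  by apply/funext => t; rewrite scalerA hornerM.
case: ifPn => [ni|]; last first.
  rewrite -leqNgt => ni; apply: big1 => j _; rewrite pint_leg_orth ?scale0r//.
  by rewrite gtn_eqF// (leq_trans (ltn_ord j)).
rewrite (bigD1 (Ordinal ni))//= pint_leg_sqr// big1 ?addr0// => j ji.
by rewrite pint_leg_orth ?scale0r// eq_sym; apply: contra ji => /eqP e; apply/eqP/val_inj.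
Qed.

(** The weight is the inverse of the squared norm of leg i. *)
Definition coef i f : X := ((2 * i + 1)%:R / tau) *: mom i f.

(** The orthogonal projection on the polynomials of degree less than n. *)
Definition lproj n f : R -> X := pcomb leg n (coef ^~ f).

Lemma L2_lproj n f : L2 (lproj n f). Proof. exact: L2_pcomb. Qed.

Lemma L2_sub_lproj n f : L2 f -> L2 (fun t => f t - lproj n f t).
Proof. by move=> L2f; apply: (L2B hdot) => //; exact: L2_lproj. Qed.

Let wt i : R := (2 * i + 1)%:R / tau.
Let wt0 i : 0 < wt i.
Proof. by rewrite divr_gt0// ltr0n addn1. Qed.
Let wtV i : (wt i)^-1 = tau / (2 * i + 1)%:R. Proof. by rewrite invf_div. Qed.

Lemma mom_sub_lproj n f i : L2 f -> (i < n)%N -> mom i (fun t => f t - lproj n f t) = 0.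
Proof.
move=> L2f ni; rewrite momB//; last exact: L2_lproj.
rewrite /lproj mom_lcomb ni /coef scalerA -/(wt i) -wtV mulVf ?scale1r ?subrr//.
by rewrite gt_eqF.
Qed.

Definition lorth n f := forall i, (i < n)%N -> mom i f = 0.

Lemma L2dot_lcomb n c f : L2 f -> ip f (pcomb leg n c) = \sum_(i < n) dot (mom i f) (c i).
Proof.
move=> L2f; rewrite L2dotC (L2dot_suml hdot)//; last by move=> i; exact: L2_poly.
apply: eq_bigr => i _; rewrite L2dotC L2dot_scale (dot_vint hdot ab)//.
exact: L2_poly.
Qed.

Lemma lorth_dot n c f : L2 f -> lorth n f -> ip f (pcomb leg n c) = 0.
Proof.
by move=> L2f o; rewrite L2dot_lcomb// big1// => i _; rewrite o// dot0l.
Qed.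

Lemma polyT_leg q u : polyT X q u <-> exists c, u = pcomb leg q.+1 c.
Proof. by apply: polyT_basis => i; exact: size_leg. Qed.

Lemma lorthP n f : L2 f ->
  lorth n.+1 f <-> (forall q, polyT X n q -> ip f q = 0).
Proof.
move=> L2f; split=> [fo q /polyT_leg[c ->] | h i ni]; first exact: lorth_dot.
apply: (dot_inj hdot) => x; rewrite dot0l /mom (dot_vint hdot ab); last exact: L2_poly.
rewrite -L2dot_scale; apply: h; apply/polyT_leg.
exists (fun j => if j == i then x else 0); apply/funext => t; rewrite /pcomb.
rewrite (bigD1 (Ordinal ni))//= eqxx big1 ?addr0// => j ji.
by rewrite ifN ?scaler0//; apply: contra ji => /eqP e; apply/eqP/val_inj.
Qed.

Lemma sqr_nrm_lcomb n c :
  nrm (pcomb leg n c) ^+ 2 = \sum_(i < n) (wt i)^-1 * `|c i| ^+ 2.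
Proof.
rewrite (sqr_nrm hdot) L2dot_lcomb; last exact: L2_pcomb.
apply: eq_bigr => i _; rewrite mom_lcomb ltn_ord dotZl hdot.
by rewrite wtV.
Qed.

Lemma sqr_nrm_lproj n f : nrm (lproj n f) ^+ 2 = \sum_(i < n) wt i * `|mom i f| ^+ 2.
Proof.
rewrite sqr_nrm_lcomb; apply: eq_bigr => i _.
rewrite /coef normrZ -/(wt i) ger0_norm ?(ltW (wt0 i))// exprMn mulrA.
by rewrite (exprD _ 1 1) mulKf// gt_eqF.
Qed.

Lemma pythagoras f g : L2 f -> L2 g -> ip f g = 0 ->
  nrm (fun t => f t + g t) ^+ 2 = nrm f ^+ 2 + nrm g ^+ 2.
Proof.
move=> L2f L2g fg; have L2fg := L2D hdot L2f L2g.
rewrite !(sqr_nrm hdot) (L2dotDl hdot)// !(L2dotDr hdot)// (L2dotC _ _ _ g f) fg.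
by rewrite addr0 add0r.
Qed.

Lemma sqr_nrm_split n f : L2 f ->
  nrm f ^+ 2 = nrm (fun t => f t - lproj n f t) ^+ 2 + nrm (lproj n f) ^+ 2.
Proof.
move=> L2f; rewrite -pythagoras.
- by congr (nrm _ ^+ 2); apply/funext => t; rewrite subrK.
- exact: L2_sub_lproj.
- exact: L2_lproj.
- by apply: lorth_dot; [exact: L2_sub_lproj|move=> i; exact: mom_sub_lproj].
Qed.

Lemma bessel n f : L2 f -> \sum_(i < n) wt i * `|mom i f| ^+ 2 <= nrm f ^+ 2.
Proof.
by move=> L2f; rewrite -sqr_nrm_lproj (sqr_nrm_split n L2f) lerDr exprn_ge0 ?nrm_ge0.
Qed.

Lemma nrm_sub_lproj_le n f : L2 f -> nrm (fun t => f t - lproj n f t) <= nrm f.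
Proof.
move=> L2f; rewrite -(@ler_pXn2r _ 2)// ?nnegrE ?nrm_ge0//.
by rewrite (sqr_nrm_split n L2f) lerDl exprn_ge0 ?nrm_ge0.
Qed.

Lemma lproj_lcomb n c t : lproj n (pcomb leg n c) t = pcomb leg n c t.
Proof.
apply: eq_bigr => i _; congr (_ *: _); rewrite /coef mom_lcomb ltn_ord scalerA.
by rewrite -/(wt i) -wtV mulfV ?scale1r// gt_eqF.
Qed.

Lemma lprojB n f g t : L2 f -> L2 g ->
  lproj n (fun s => f s - g s) t = lproj n f t - lproj n g t.
Proof.
move=> L2f L2g; rewrite /lproj /pcomb -sumrB; apply: eq_bigr => i _.
by rewrite /coef momB// !scalerBr.
Qed.

Lemma lproj_best n f c : L2 f ->
  nrm (fun t => f t - lproj n f t) <= nrm (fun t => f t - pcomb leg n c t).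
Proof.
move=> L2f; have L2c := L2_pcomb leg n c.
have e : (fun t => (f t - pcomb leg n c t) - lproj n (fun s => f s - pcomb leg n c s) t) =
    fun t => f t - lproj n f t.
  by apply/funext => t; rewrite lprojB// lproj_lcomb opprB addrA subrK.
by have := nrm_sub_lproj_le n (L2B hdot L2f L2c); rewrite e.
Qed.

Lemma sqr_nrm_tail n M f : L2 f -> (n <= M)%N ->
  nrm (fun t => f t - lproj n f t) ^+ 2 =
  \sum_(n <= i < M) wt i * `|mom i f| ^+ 2 + nrm (fun t => f t - lproj M f t) ^+ 2.
Proof.
move=> L2f nM; have h1 := sqr_nrm_split n L2f; have h2 := sqr_nrm_split M L2f.
rewrite !sqr_nrm_lproj in h1 h2.
have h3 : \sum_(i < M) wt i * `|mom i f| ^+ 2 = \sum_(i < n) wt i * `|mom i f| ^+ 2 +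
   \sum_(n <= i < M) wt i * `|mom i f| ^+ 2.
  rewrite -(big_mkord xpredT (fun i => wt i * `|mom i f| ^+ 2)).
  rewrite -(big_mkord xpredT (fun i => wt i * `|mom i f| ^+ 2)).
  by rewrite -big_cat_nat.
apply: (addIr (\sum_(i < n) wt i * `|mom i f| ^+ 2)).
by rewrite -h1 h2 h3; ring.
Qed.

(** ** Primitives of polynomials *)

Lemma Rintegral_indic_poly (p : {poly R}) t : t \in `[a, b] ->
  \int[mu]_(s in D) (\1_([set` `]a, t]]) s * p^`().[s]) = p.[t] - p.[a].
Proof.
rewrite in_itv/= => /andP[at_ tb].
have e : \int[mu]_(s in D) (\1_([set` `]a, t]]) s * p^`().[s]) =
    \int[mu]_(s in [set` `]a, t]]) p^`().[s].
  rewrite Rintegral_mkcond [RHS]Rintegral_mkcond; apply: eq_Rintegral => s _.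
  rewrite !patchE !indicE !mem_setE !in_itv/=.
  have [as_|] := ltP a s; last by rewrite /= ?if_same ?mul0r.
  have [st|ts] := leP s t; first by rewrite (le_trans st tb) mul1r.
  by rewrite /= mul0r if_same.
rewrite e; move: at_; rewrite le_eqVlt => /predU1P[->|at_].
  by rewrite set_itv_ge ?bnd_simp ?ltxx// Rintegral_set0 subrr.
by have := @pint_deriv R a t at_ p.
Qed.

Lemma prim_poly (p : {poly R}) x t : t \in `[a, b] ->
  prim (fun s => p^`().[s] *: x) t = (p.[t] - p.[a]) *: x.
Proof.
move=> tab; have L2p : L2 (fun s => p^`().[s] *: x) by exact: L2_poly.
apply: (dot_inj hdot) => y; rewrite (dot_prim hdot ab)// dotZl.
rewrite -(Rintegral_indic_poly p tab) mulrC -RintegralZl//.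
  by apply: eq_Rintegral => s _; rewrite dotZl; ring.
have mi : @measurable _ (measurableTypeR R) [set` `]a, t]] by exact: measurable_itv.
have ip := integrable_poly a b p^`().
apply: (le_integrable mD _ _ ip).
  apply/measurable_EFinP; apply: measurable_funM; first exact: measurable_indic.
  by apply: measurable_funTS; apply: continuous_measurable_fun; exact: continuous_horner.
move=> s _; rewrite /= lee_fin normrM ler_piMl//.
by rewrite indicE; case: (_ \in _); rewrite ?normr1 ?normr0.
Qed.

Lemma prim_sum (I : Type) (s : seq I) (F : I -> R -> X) t : (forall i, L2 (F i)) ->
  prim (fun r => \sum_(i <- s) F i r) t = \sum_(i <- s) prim (F i) t.
Proof.
move=> sF; rewrite /prim -vint_sum; last first.
  by move=> i; apply: (L2_indic hdot) => //; exact: measurable_itv.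
by congr vint; apply/funext => r; rewrite scaler_sumr.
Qed.

Lemma prim_lcomb n c t : t \in `[a, b] ->
  prim (pcomb leg n c) t = pcomb primleg n c t.
Proof.
move=> tab; rewrite /pcomb prim_sum; last by move=> i; exact: L2_poly.
apply: eq_bigr => i _; have := prim_poly (primleg i) (c i) tab.
by rewrite deriv_primleg// primleg_a// subr0.
Qed.

Lemma primleg_itv : forall t, t \in `]a, b] -> t \in `[a, b].
Proof. by move=> t; exact: subset_itv_oc_cc. Qed.

Lemma H1pair_primcomb x n c :
  H1pair (fun t => x + pcomb primleg n c t) (pcomb leg n c).
Proof.
have h := H1pair_prim hdot ab x (L2_pcomb leg n c).
apply: (H1pair_ae hdot _ _ _ _ h).
- by apply: (L2D hdot) => //; exact: L2_pcomb.
- exact: L2_pcomb.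
- by apply: aeW => t Dt; rewrite prim_lcomb//; exact: primleg_itv.
- exact: aeW.
Qed.

Lemma polyT_prim q u : polyT X q u <-> exists x c, u = fun t => x + pcomb primleg q c t.
Proof.
rewrite (@polyT_basis _ _ (primbasis a b)); last by move=> i; exact: size_primbasis.
split=> [[c ->] | [x [c ->]] ].
  exists (c 0%N), (fun i => c i.+1); apply/funext => t.
  by rewrite /pcomb big_ord_recl /= hornerC scale1r.
exists (fun i => if i is j.+1 then c j else x); apply/funext => t.
by rewrite /pcomb big_ord_recl /= hornerC scale1r.
Qed.

End Expansion.

(** * Approximation of order 1/n in L^2 *)

Section Approximation.
Context (R : realType) (X : completeNormedModType R) (dot : {dot X for idfun}).
Hypothesis hdot : forall x : X, dot x x = `|x| ^+ 2.
Context (a b : R).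
Hypothesis ab : a < b.
Implicit Types (f g h u v w : R -> X) (phi : R -> R) (x : X) (c d : nat -> X).
Local Notation D := [set` `]a, b]].
Local Notation mu := (@lebesgue_measure R).
Local Notation L2 := (@L2 R X a b).
Local Notation ip := (L2dot dot a b).
Local Notation nrm := (nrm dot a b).
Local Notation vint := (vint dot a b).
Local Notation prim := (prim dot a b).
Local Notation crep := (crep a b).
Local Notation H1pair := (H1pair dot a b).
Local Notation leg := (leg a b).
Local Notation primleg := (primleg a b).
Local Notation pint := (pint a b).
Local Notation mom := (mom dot a b).
Local Notation lproj := (lproj dot a b).
Local Notation lorth := (lorth dot a b).
Local Notation "f =ae g" := {ae mu, forall t, D t -> f t = g t}
  (at level 70, no associativity).

Let mD : @measurable _ (measurableTypeR R) D. Proof. exact: measurable_itv. Qed.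
Let tau : R := b - a.
Let tau0 : 0 < tau. Proof. by rewrite subr_gt0. Qed.
Let wt i : R := (2 * i + 1)%:R / tau.
Let wt0 i : 0 < wt i.
Proof. by rewrite divr_gt0// ltr0n addn1. Qed.

Lemma pint_sum (I : Type) (s : seq I) (F : I -> {poly R}) :
  pint (\sum_(i <- s) F i) = \sum_(i <- s) pint (F i).
Proof.
by apply: (big_morph pint) => [p q|]; [exact: pintD|exact: pint0].
Qed.

(** S is the Legendre projection of the indicator of ]a, t], whose moments are
    the values primleg i at t, and this is the theorem of Pythagoras. As an
    indicator is its own square, the integrand is the indicator times a
    polynomial, plus S ^+ 2. *)
Lemma sqr_dist_indicator M t : t \in `[a, b] ->
  let S := \sum_(i < M) (wt i * (primleg i).[t])%:P * leg i in
  \int[mu]_(s in D) (\1_([set` `]a, t]]) s - S.[s]) ^+ 2 =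
  (t - a) - \sum_(i < M) wt i * (primleg i).[t] ^+ 2.
Proof.
move=> tab S; have [at_ tb] : a <= t /\ t <= b by move: tab; rewrite in_itv/= => /andP.
(* The indicator is its own square, so P is a primitive of 1 - 2 S. *)
pose P : {poly R} := 'X - 2%:P * \sum_(i < M) (wt i * (primleg i).[t])%:P * primleg i.
have dP : P^`() = 1 - 2%:P * S.
  rewrite derivB derivX derivM derivC mul0r add0r; congr (1 - _ * _).
  rewrite /S raddf_sum; apply: eq_bigr => i _.
  by rewrite /= derivM derivC mul0r add0r deriv_primleg.
have i1 : mu.-integrable D (EFin \o (fun s => \1_([set` `]a, t]]) s * P^`().[s])).
  have mi : @measurable _ (measurableTypeR R) [set` `]a, t]] by exact: measurable_itv.
  have ip := integrable_poly a b P^`().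
  apply: (le_integrable mD _ _ ip).
    apply/measurable_EFinP; apply: measurable_funM; first exact: measurable_indic.
    by apply: measurable_funTS; apply: continuous_measurable_fun; exact: continuous_horner.
  move=> s _; rewrite /= lee_fin normrM ler_piMl//.
  by rewrite indicE; case: (_ \in _); rewrite ?normr1 ?normr0.
have -> : (fun s => (\1_([set` `]a, t]]) s - S.[s]) ^+ 2) =
    fun s => \1_([set` `]a, t]]) s * P^`().[s] + (S * S).[s].
  apply/funext => s; rewrite dP hornerD hornerN !hornerM !hornerC indicE.
  by move: S.[s] => z; case: (_ \in _) => /=; ring.
rewrite RintegralD//; last exact: integrable_poly.
rewrite Rintegral_indic_poly//.
have e1 : P.[t] - P.[a] = (t - a) - 2 * \sum_(i < M) wt i * (primleg i).[t] ^+ 2.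
  rewrite /P !hornerE !horner_sum [X in _ - (a - 2 * X)]big1 => [|i _].
    rewrite (eq_bigr (fun i : 'I_M => wt i * (primleg i).[t] ^+ 2)) => [|i _]; first by ring.
    by rewrite hornerM hornerC expr2 mulrA.
  by rewrite hornerM primleg_a// mulr0.
have e2 : pint (S * S) = \sum_(i < M) wt i * (primleg i).[t] ^+ 2.
  rewrite {1}/S mulr_suml pint_sum; apply: eq_bigr => i _.
  rewrite -mulrA pintZ -mulrA; congr (_ * _).
  rewrite /S mulr_sumr pint_sum (bigD1 i)//= big1 ?addr0 => [|j ji].
    have -> : leg i * ((wt i * (primleg i).[t])%:P * leg i) =
        (wt i * (primleg i).[t])%:P * (leg i * leg i) by ring.
    have tau1 : b - a != 0 by rewrite gt_eqF// subr_gt0.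
    have n0 : (2 * i + 1)%:R != 0 :> R by rewrite pnatr_eq0 addn1.
    rewrite pintZ pint_leg_sqr// /wt /tau expr2.
    by move: ((2 * i + 1)%:R : R) n0 => z z0; field; rewrite z0 tau1.
  have -> : leg i * ((wt j * (primleg j).[t])%:P * leg j) =
        (wt j * (primleg j).[t])%:P * (leg i * leg j) by ring.
  by rewrite pintZ pint_leg_orth ?mulr0// eq_sym.
by rewrite e1 -/(pint (S * S)) e2; ring.
Qed.

(** A Hilbert-Schmidt bound: the kernel of the map f |-> prim f is the
    indicator of s <= t, of which only the part orthogonal to the polynomials
    of degree at most M acts on f. As the bound tends to 0 with 1/M, it takes
    the place of the completeness of the Legendre polynomials. *)
Lemma sqr_nrm_prim_defect M f : L2 f -> lorth M.+1 f ->
  nrm (prim f) ^+ 2 <= defect a b M * nrm f ^+ 2.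
Proof.
move=> L2f fo; have L2p := L2_prim hdot ab L2f.
pose Q : {poly R} := ('X - a%:P) - \sum_(i < M.+1) (wt i)%:P * (primleg i * primleg i).
have pQ : pint Q = defect a b M.
  rewrite pintB pint_sum.
  rewrite (eq_bigr (fun i : 'I_M.+1 => wt i * pint (primleg i * primleg i))); last first.
    by move=> i _; exact: pintZ.
  rewrite sum_pint_primleg//.
  have -> : 'X - a%:P = ((2^-1)%:P * ('X - a%:P) ^+ 2)^`() :> {poly R}.
    have e2 : (2^-1)%:P * 2%:R = 1 :> {poly R}.
      by rewrite natr_poly -polyCM mulVf ?pnatr_eq0.
    rewrite derivM derivC mul0r add0r deriv_exp derivXsubC mul1r /= expr1.
    by rewrite -[X in _ = _ * X]mulr_natr mulrCA e2 mulr1.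
  rewrite pint_deriv//; rewrite !(horner_exp, hornerXsubC, hornerC, hornerM) subrr expr0n mulr0 subr0.
  by field.
have pt t : t \in D -> `|prim f t| ^+ 2 <= Q.[t] * nrm f ^+ 2.
  move=> tD; have tab : t \in `[a, b].
    by apply: subset_itv_oc_cc; move: tD; rewrite mem_setE.
  pose S := \sum_(i < M.+1) (wt i * (primleg i).[t])%:P * leg i.
  have e : prim f t = vint (fun s => (\1_([set` `]a, t]]) s - S.[s]) *: f s).
    rewrite (_ : (fun s => _) = fun s => (\1_([set` `]a, t]]) s : R) *: f s - S.[s] *: f s); last first.
      by apply/funext => s; rewrite scalerBl.
    rewrite (vintB hdot ab); last 2 first.
    - by apply: (L2_indic hdot) => //; exact: measurable_itv.
    - exact: L2_poly.
    rewrite [X in _ - X](_ : _ = 0) ?subr0//.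
    rewrite (_ : (fun s => S.[s] *: f s) = fun s => \sum_(i < M.+1)
       (wt i * (primleg i).[t]) *: ((leg i).[s] *: f s)); last first.
      apply/funext => s; rewrite /S horner_sum scaler_suml; apply: eq_bigr => i _.
      by rewrite hornerM hornerC scalerA.
    rewrite (vint_sum hdot ab); last by move=> i; apply: (L2Z hdot); exact: L2_poly.
    apply: big1 => i _; rewrite (vintZ hdot ab); last exact: L2_poly.
    by rewrite -/(mom i f) fo// scaler0.
  have [B B0 hB] := continuous_bounded a b (@continuous_horner R S).
  have mphi : measurable_fun D (fun s => \1_([set` `]a, t]]) s - S.[s]).
    apply: measurable_funB; first by apply: measurable_indic; exact: measurable_itv.
    by apply: measurable_funTS; apply: continuous_measurable_fun; exact: continuous_horner.
  rewrite e; apply: le_trans (sqr_vint_le hdot ab mphi (M := 1 + B) _ L2f) _.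
    move=> s sD; apply: le_trans (ler_normB _ _) _; apply: lerD; last exact: hB.
    by rewrite indicE; case: (_ \in _); rewrite ?normr1 ?normr0.
  rewrite sqr_dist_indicator// le_eqVlt; apply/orP; left; apply/eqP; congr (_ * _).
  rewrite /Q hornerD hornerXsubC hornerN horner_sum; congr (_ - _).
  by apply: eq_bigr => i _; rewrite !hornerM hornerC expr2.
rewrite (sqr_nrm hdot) -pQ mulrC /pint -RintegralZl//; last exact: integrable_poly.
apply: le_Rintegral => //.
- exact: L2_dot.
- exact: (integrableZl mD _ (integrable_poly a b Q)).
- by move=> t Dt; rewrite hdot mulrC pt// mem_setE.
Qed.

(** The primitive of the projection of g is a competitor for the best
    approximation of f, and the difference is the primitive of a function
    orthogonal to polynomials. *)
Lemma sqr_nrm_H1_defect M f g : H1pair f g ->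
  nrm (fun t => f t - lproj M.+2 f t) ^+ 2 <= defect a b M * nrm g ^+ 2.
Proof.
move=> fg; have [L2f L2g _] := fg; have hf := H1pair_crep hdot ab fg.
have L2r := L2_sub_lproj hdot M.+1 L2g; set r := (fun t => _) in L2r.
have L2lg := L2_lproj hdot a b M.+1 g.
have [c hc] : exists c, (fun t => crep f a + pcomb primleg M.+1 (coef dot a b ^~ g) t) =
    pcomb leg M.+2 c.
  by apply/(polyT_leg ab)/(polyT_prim ab); eexists; eexists.
have L2pr := L2_prim hdot ab L2r.
apply: (@le_trans _ _ (nrm (prim r) ^+ 2)).
  rewrite lerXn2r ?nnegrE ?nrm_ge0//.
  apply: le_trans (lproj_best hdot ab M.+2 c L2f) _.
  have L2pc := L2_pcomb hdot a b leg M.+2 c.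
  rewrite (nrm_ae hdot (L2B hdot L2f L2pc) L2pr)//.
  apply: aeS hf => t hf Dt; rewrite hf// -hc /r (primB hdot ab)// opprD addrACA subrr add0r.
  congr (_ - _); rewrite /lproj prim_lcomb//; exact: subset_itv_oc_cc.
apply: le_trans (sqr_nrm_prim_defect L2r _) _.
  by move=> i iM; exact: (mom_sub_lproj hdot ab L2g iM).
have d0 : 0 <= defect a b M.
  by rewrite /defect mulr_ge0// ?divr_ge0 ?sqr_ge0// addr_ge0// invr_ge0.
apply: ler_wpM2l => //; rewrite lerXn2r ?nnegrE ?nrm_ge0//; exact: nrm_sub_lproj_le.
Qed.

(** Integrate by parts against primleg j.+1, a multiple of leg j.+2 - leg j
    that vanishes at both ends. *)
Lemma mom_H1 j f g : H1pair f g ->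
  mom j.+1 f = ((2 * j + 3)%:R * (2 / tau))^-1 *: (mom j g - mom j.+2 g).
Proof.
move=> fg; have [L2f L2g _] := fg.
have := H1_by_parts hdot ab (C1_horner (primleg j.+1)) fg.
rewrite -derivE deriv_primleg// primleg_a// primleg_b// !scale0r subr0 sub0r -/(mom j.+1 f) => ->.
set e := (_ * _)^-1.
rewrite (_ : (fun t => _) = fun t => e *: ((leg j.+2).[t] *: g t - (leg j).[t] *: g t)).
  rewrite (vintZ hdot ab); last by apply: (L2B hdot); exact: L2_poly.
  by rewrite (vintB hdot ab) -?scalerN ?opprB//; exact: L2_poly.
apply/funext => t; rewrite -scalerBl scalerA; congr (_ *: _).
by rewrite /primleg hornerM hornerC hornerD hornerN.
Qed.

Lemma sqr_mom_H1_le n j f g : H1pair f g -> (n <= j.+1)%N ->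
  wt j.+1 * `|mom j.+1 f| ^+ 2 * n%:R ^+ 2 <=
  tau ^+ 2 / 2 * (wt j.+2 * `|mom j.+2 g| ^+ 2 + wt j * `|mom j g| ^+ 2).
Proof.
move=> fg nj; rewrite (mom_H1 j fg) normrZ exprMn real_normK ?num_real//.
have hAB : `|mom j g - mom j.+2 g| ^+ 2 <= 2 * (`|mom j.+2 g| ^+ 2 + `|mom j g| ^+ 2).
  have := ler_normB (mom j g) (mom j.+2 g).
  have := normr_ge0 (mom j g - mom j.+2 g).
  have := normr_ge0 (mom j g); have := normr_ge0 (mom j.+2 g).
  move: `|mom j g| `|mom j.+2 g| `|mom j g - mom j.+2 g| => x y z x0 y0 z0 h.
  have := sqr_ge0 (x - y); nra.
move: hAB; move: (`|mom j g - mom j.+2 g| ^+ 2) => Z.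
have := sqr_ge0 `|mom j g|; have := sqr_ge0 `|mom j.+2 g|.
move: (`|mom j.+2 g| ^+ 2) (`|mom j g| ^+ 2) => A B A0 B0 hZ.
have q0 : 0 < (2 * j + 3)%:R :> R by rewrite ltr0n addn3.
have e1 : wt j.+1 = (2 * j + 3)%:R / tau by rewrite /wt; congr (_%:R / _); lia.
have e2 : wt j.+2 = ((2 * j + 3)%:R + 2) / tau.
  by rewrite /wt -natrD; congr (_%:R / _); lia.
have e3 : wt j = ((2 * j + 3)%:R - 2) / tau.
  by rewrite /wt -natrB ?addn3//; congr (_%:R / _); lia.
have hn : n%:R ^+ 2 <= (2 * j + 3)%:R * ((2 * j + 3)%:R - 2) :> R.
  rewrite -natrB ?addn3// -natrM -natrX ler_nat; nia.
rewrite e1 e2 e3; move: ((2 * j + 3)%:R : R) (n%:R ^+ 2 : R) (sqr_ge0 (n%:R : R)) q0 hn.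
move=> q N N0 q0 hn; clear e1 e2 e3.
have tn : tau != 0 by rewrite gt_eqF.
have qn : q != 0 by rewrite gt_eqF.
have -> : q / tau * ((q * (2 / tau))^-1 ^+ 2 * Z) * N = tau / 4 * (Z * N / q).
  by field; rewrite tn qn.
have -> : tau ^+ 2 / 2 * ((q + 2) / tau * A + (q - 2) / tau * B) =
    tau / 4 * (2 * ((q + 2) * A + (q - 2) * B)) by field.
rewrite ler_pM2l ?divr_gt0// ler_pdivrMr//.
have h1 : Z * N <= 2 * (A + B) * N by rewrite ler_wpM2r.
apply: le_trans h1 _.
have h2 : (A + B) * N <= (A + B) * (q * (q - 2)) by rewrite ler_wpM2l ?addr_ge0.
have h3 : 0 <= A * q by rewrite mulr_ge0// ltW.
nra.
Qed.

End Approximation.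

Section Jackson.
Context (R : realType) (X : completeNormedModType R) (dot : {dot X for idfun}).
Hypothesis hdot : forall x : X, dot x x = `|x| ^+ 2.
Context (a b : R).
Hypothesis ab : a < b.
Implicit Types (f g h u v w : R -> X) (phi : R -> R) (x : X) (c d : nat -> X).
Local Notation D := [set` `]a, b]].
Local Notation mu := (@lebesgue_measure R).
Local Notation L2 := (@L2 R X a b).
Local Notation nrm := (nrm dot a b).
Local Notation vint := (vint dot a b).
Local Notation prim := (prim dot a b).
Local Notation crep := (crep a b).
Local Notation H1pair := (H1pair dot a b).
Local Notation leg := (leg a b).
Local Notation primleg := (primleg a b).
Local Notation mom := (mom dot a b).
Local Notation lproj := (lproj dot a b).
Local Notation lorth := (lorth dot a b).
Local Notation "f =ae g" := {ae mu, forall t, D t -> f t = g t}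
  (at level 70, no associativity).

Let mD : @measurable _ (measurableTypeR R) D. Proof. exact: measurable_itv. Qed.
Let tau : R := b - a.
Let tau0 : 0 < tau. Proof. by rewrite subr_gt0. Qed.
Let wt i : R := (2 * i + 1)%:R / tau.
Let wt0 i : 0 < wt i.
Proof. by rewrite divr_gt0// ltr0n addn1. Qed.

Lemma sum_shift_le (F : nat -> R) n M : (forall i, 0 <= F i) ->
  \sum_(n <= i < M) F i <= \sum_(i < M) F i.
Proof.
move=> F0; have [nM|Mn] := leqP n M.
  rewrite -(big_mkord xpredT F) [leRHS](@big_cat_nat _ _ _ n)//= lerDr.
  by apply: sumr_ge0 => i _.
by rewrite big_geq ?(ltnW Mn)// sumr_ge0.
Qed.

Lemma defect_le M : defect a b M <= tau ^+ 2 / 4 / M.+1%:R.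
Proof.
rewrite /defect -/tau.
have h (q : nat) : (M.+1 <= q)%N -> (q%:R : R)^-1 <= M.+1%:R^-1.
  move=> Mq; have q0 : (0 < q)%N by exact: leq_trans Mq.
  by rewrite lef_pV2 ?ler_nat// posrE ltr0n.
have h1 : (2 * M + 1)%:R^-1 <= M.+1%:R^-1 :> R by apply: h; lia.
have h2 : (2 * M + 3)%:R^-1 <= M.+1%:R^-1 :> R by apply: h; lia.
move: h1 h2; move: (_^-1) (_^-1) (_^-1) => x y z h1 h2.
have t0 := sqr_ge0 tau.
have -> : tau ^+ 2 / 4 * y = tau ^+ 2 / 8 * (y + y) by field.
by apply: ler_wpM2l; [rewrite divr_ge0|lra].
Qed.

(** By Parseval's identity, up to a defect that vanishes in the limit, the
    squared error is a weighted sum of the squared moments of f of index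
    larger than n, and each of these moments is smaller by a factor of order
    tau / n than two neighbouring moments of f'. *)
Lemma nrm_sub_lproj_H1 n f g : H1pair f g ->
  nrm (fun t => f t - lproj n.+1 f t) <= tau / n.+1%:R * nrm g.
Proof.
move=> fg; have [L2f L2g _] := fg.
have n0 : 0 < n.+1%:R :> R by rewrite ltr0n.
rewrite -(@ler_pXn2r _ 2)// ?nnegrE ?mulr_ge0 ?nrm_ge0// ?divr_ge0 ?(ltW tau0)//.
set A := nrm _ ^+ 2; rewrite exprMn.
pose F i := wt i * `|mom i g| ^+ 2.
have F0 i : 0 <= F i by rewrite mulr_ge0 ?exprn_ge0// ltW.
(* The bound must not depend on M, which tends to infinity below. *)
have tail M : \sum_(n.+1 <= i < M) wt i * `|mom i f| ^+ 2 <= (tau / n.+1%:R) ^+ 2 * nrm g ^+ 2.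
  have s1 : \sum_(n <= i < M.-1) F i <= nrm g ^+ 2.
    by apply: le_trans (sum_shift_le _ _ F0) _; exact: bessel.
  have s2 : \sum_(n <= i < M.-1) F i.+2 <= nrm g ^+ 2.
    apply: le_trans (sum_shift_le (F := fun i => F i.+2) _ _ _) _ => //.
    apply: le_trans _ (bessel hdot ab M.-1.+2 L2g).
    by rewrite !big_ord_recl /= addrA lerDr addr_ge0// ?F0// -/(F 0%N) -/(F 1%N).
  have : \sum_(n.+1 <= i < M) wt i * `|mom i f| ^+ 2 * n.+1%:R ^+ 2 <=
      tau ^+ 2 / 2 * (\sum_(n <= i < M.-1) F i.+2 + \sum_(n <= i < M.-1) F i).
    rewrite big_add1 -big_split mulr_sumr /= !big_seq; apply: ler_sum => i.
    rewrite mem_index_iota => /andP[ni _]; exact: sqr_mom_H1_le.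
  rewrite -mulr_suml expr_div_n => h.
  have N0 : 0 < (n.+1%:R : R) ^+ 2 by rewrite exprn_gt0.
  rewrite mulrAC ler_pdivlMr//; apply: le_trans h _.
  have t2 : 0 <= tau ^+ 2 by exact: sqr_ge0.
  have -> : tau ^+ 2 * nrm g ^+ 2 = tau ^+ 2 / 2 * (nrm g ^+ 2 + nrm g ^+ 2) by field.
  by rewrite ler_wpM2l ?divr_ge0// lerD.
have key m : A <= (tau / n.+1%:R) ^+ 2 * nrm g ^+ 2 + defect a b (n + m) * nrm g ^+ 2.
  have nM : (n.+1 <= (n + m).+2)%N by lia.
  rewrite /A (sqr_nrm_tail hdot ab L2f nM); apply: lerD; first exact: tail.
  exact: sqr_nrm_H1_defect.
set B := _ * _; rewrite leNgt; apply/negP => BA.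
pose G := tau ^+ 2 / 4 * nrm g ^+ 2.
have G0 : 0 <= G by rewrite mulr_ge0 ?sqr_ge0// divr_ge0// sqr_ge0.
have AB : 0 < A - B by rewrite subr_gt0.
pose m := Num.truncn (G / (A - B)).
have hm : G / (A - B) < m.+1%:R by apply: truncnS_gt.
have := key m; rewrite -/B leNgt => /negP; apply.
rewrite -ltrBrDl; apply: le_lt_trans (_ : G / m.+1%:R < _); last first.
  by rewrite ltr_pdivrMr ?ltr0n// mulrC -ltr_pdivrMr.
have -> : G / m.+1%:R = tau ^+ 2 / 4 / m.+1%:R * nrm g ^+ 2 by rewrite /G; ring.
apply: ler_wpM2r; first exact: sqr_ge0.
apply: le_trans (defect_le _) _.
apply: ler_wpM2l; first by rewrite divr_ge0// sqr_ge0.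
by rewrite lef_pV2 ?posrE ?ltr0n// ler_nat ltnS leq_addl.
Qed.

Lemma vint_primleg_lorth n i f : L2 f -> lorth n f -> (i.+1 < n)%N ->
  vint (fun t => (primleg i).[t] *: f t) = 0.
Proof.
move=> L2f fo ni.
have [d hd] : exists d : nat -> R, primleg i = \sum_(j < n) (d j)%:P * leg j.
  apply: poly_span; first by move=> j; exact: size_leg.
  by have := size_primbasis i.+1 ab; rewrite /= => ->.
rewrite hd (_ : (fun t => _) = fun t => \sum_(j < n) d j *: ((leg j).[t] *: f t)).
  rewrite (vint_sum hdot ab); last by move=> j; apply: (L2Z hdot); exact: L2_poly.
  apply: big1 => j _; rewrite (vintZ hdot ab); last exact: L2_poly.
  by rewrite -/(mom j f) fo// scaler0.
apply/funext => t; rewrite horner_sum scaler_suml; apply: eq_bigr => j _.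
by rewrite hornerM hornerC scalerA.
Qed.

(** As f is orthogonal to the constants, its primitive vanishes at both ends,
    and integrating by parts shows that it is orthogonal to all polynomials of
    one degree less than f is. It thus equals its own projection error. The
    loss of one degree is the reason for the factor 2. *)
Lemma nrm_prim_lorth n f : L2 f -> lorth n.+1 f ->
  nrm (prim f) <= 2 * tau / n.+1%:R * nrm f.
Proof.
move=> L2f fo; have L2p := L2_prim hdot ab L2f.
have nf := nrm_ge0 dot a b f.
(* For n = 0 the length of the interval gives the bound. *)
case: n fo => [|n] fo.
  have h : nrm (prim f) <= tau * nrm f.
    rewrite -(@ler_pXn2r _ 2)// ?nnegrE ?mulr_ge0 ?nrm_ge0// ?(ltW tau0)//.
    rewrite (sqr_nrm hdot) (_ : (_ * _) ^+ 2 = (tau * nrm f ^+ 2) * (b - a)); last first.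
      by rewrite /tau; ring.
    rewrite -(Rintegral_itv_cst ab); apply: le_Rintegral => //.
    - exact: L2_dot.
    - exact: integrable_cst.
    move=> t Dt; rewrite hdot; have tab : a <= t /\ t <= b.
      by move: Dt; rewrite /= in_itv/= => /andP[/ltW-> ->].
    have h := prim_le hdot ab L2f tab.1 tab.2.
    have e : Num.sqrt (b - a) ^+ 2 = tau by rewrite sqr_sqrtr// ltW.
    by rewrite -e -exprMn lerXn2r ?nnegrE// mulr_ge0// sqrtr_ge0.
  by rewrite divr1; apply: le_trans h _; rewrite ler_wpM2r// ler_peMl ?(ltW tau0)// ler1n.
have fg : H1pair (prim f) f.
  have := H1pair_prim hdot ab 0 L2f.
  by under eq_fun do rewrite add0r.
have primfb : vint f = 0.
  have := fo 0%N isT; rewrite /mom leg0 => <-.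
  by congr (vint _); apply/funext => t; rewrite hornerC scale1r.
have po : lorth n.+1 (prim f).
  move=> i ni; have := H1_by_parts hdot ab (C1_horner (primleg i)) fg.
  rewrite -derivE deriv_primleg// primleg_a// scale0r subr0 -/(mom i (prim f)) => ->.
  rewrite (vint_primleg_lorth L2f fo)//.
  have cb : crep (prim f) b = 0.
    have bb : b \in `[a, b] by rewrite in_itv/= lexx ltW.
    rewrite (@crepE _ _ _ _ ab (prim f) (prim f) _ _ _ bb) ?prim_b//.
      exact: continuous_prim.
    exact: aeW.
  by rewrite cb scaler0 subrr.
have e : (fun t => prim f t - lproj n.+1 (prim f) t) = prim f.
  apply/funext => t; rewrite /lproj /pcomb big1 ?subr0// => i _.
  by rewrite /coef po ?scaler0.
have := nrm_sub_lproj_H1 n fg; rewrite e => /le_trans; apply.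
rewrite ler_wpM2r//; have n1 : 0 < n.+1%:R :> R by rewrite ltr0n.
have n2 : 0 < n.+2%:R :> R by rewrite ltr0n.
rewrite (mulrC 2) -mulrA ler_pM2l// ler_pdivlMr// mulrC ler_pdivrMr//.
by rewrite -natrM ler_nat; lia.
Qed.

(** The error of best approximation in L^2 by polynomials of degree less than
    n, by lproj_best. *)
Definition bestL2 n f : R := nrm (fun t => f t - lproj n f t).

Lemma bestL2_le n f : L2 f -> bestL2 n f <= nrm f.
Proof. exact: nrm_sub_lproj_le. Qed.

Lemma bestL2_ge0 n f : 0 <= bestL2 n f. Proof. exact: nrm_ge0. Qed.

(** Subtracting from f the primitive of the projection of g does not change
    its best approximation error, and turns g into its projection error. *)
Lemma bestL2_H1 n f g : H1pair f g -> bestL2 n.+1 f <= tau / n.+1%:R * bestL2 n g.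
Proof.
move=> fg; have [L2f L2g _] := fg.
pose Q := fun t => 0 + pcomb primleg n (coef dot a b ^~ g) t.
have hQ : H1pair Q (lproj n g) by exact: H1pair_primcomb.
have [c hc] : exists c, Q = pcomb leg n.+1 c.
  by apply/(polyT_leg ab)/(polyT_prim ab); exists 0, (coef dot a b ^~ g).
have := nrm_sub_lproj_H1 n (H1pairB hdot fg hQ).
apply: le_trans; rewrite /bestL2; have [L2Q _ _] := hQ.
have -> : (fun t => f t - Q t - lproj n.+1 (fun t => f t - Q t) t) =
    fun t => f t - lproj n.+1 f t.
  apply/funext => t; rewrite (lprojB hdot ab)// hc (lproj_lcomb hdot ab).
  by rewrite opprB addrA subrK.
by [].
Qed.

End Jackson.

(** * Sobolev spaces of integer order *)

Section Sobolev.
Context (R : realType) (X : completeNormedModType R) (dot : {dot X for idfun}).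
Hypothesis hdot : forall x : X, dot x x = `|x| ^+ 2.
Context (a b : R).
Hypothesis ab : a < b.
Implicit Types (f g h u v w : R -> X) (phi : R -> R) (x : X) (c d : nat -> X).
Local Notation D := [set` `]a, b]].
Local Notation mu := (@lebesgue_measure R).
Local Notation L2 := (@L2 R X a b).
Local Notation H1pair := (H1pair dot a b).
Local Notation leg := (leg a b).
Local Notation primleg := (primleg a b).
Local Notation sobolevn := (sobolevn dot a b).
Local Notation wder := (wder dot a b).
Local Notation wdern := (wdern dot a b).
Local Notation "f =ae g" := {ae mu, forall t, D t -> f t = g t}
  (at level 70, no associativity).

Lemma sobolevn_L2 m w : sobolevn m w -> L2 w.
Proof. by case: m => [//|m [] ]. Qed.

Lemma sobolevn_ae m w w' : L2 w' -> w =ae w' -> sobolevn m w -> sobolevn m w'.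
Proof.
case: m => [//|m] L2w' ww' [L2w [g [wg sg]]]; split=> //; exists g; split=> //.
have L2g := sobolevn_L2 sg.
by have [] := H1pair_ae hdot L2w' L2g ww' (aeD_refl a b g) (And3 L2w L2g wg).
Qed.

(** The definition provides some weak derivative that is in the next Sobolev
    space; the chosen one agrees with it almost everywhere. *)
Lemma sobolevnS m w : sobolevn m.+1 w -> H1pair w (wder w) /\ sobolevn m (wder w).
Proof.
move=> [L2w [g [wg sg]]]; have p : H1pair w g by split=> //; exact: sobolevn_L2 sg.
have h := wder_H1pair p; split=> //.
have [_ L2d _] := h.
by apply: sobolevn_ae sg => //; exact: aeD_sym (wderE hdot ab p).
Qed.

Lemma sobolevnW m w : sobolevn m.+1 w -> sobolevn m w.
Proof.
elim: m w => [|m ih] w; first by case.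
by move=> [L2w [g [wg sg]]]; split=> //; exists g; split=> //; exact: ih.
Qed.

Lemma sobolevn_le m n w : (m <= n)%N -> sobolevn n w -> sobolevn m w.
Proof.
move=> mn; rewrite -(subnK mn); elim: (n - m)%N => [//|k ih].
by rewrite addSn => /sobolevnW.
Qed.

Lemma sobolevnB m w v : sobolevn m w -> sobolevn m v ->
  sobolevn m (fun t => w t - v t).
Proof.
elim: m w v => [|m ih] w v; first exact: (L2B hdot).
move=> [L2w [g [wg sg]]] [L2v [h [vh sh]]]; split; first exact: (L2B hdot).
exists (fun t => g t - h t); split; last exact: ih.
by apply: (wderB hdot) => //; [exact: sobolevn_L2 sg|exact: sobolevn_L2 sh].
Qed.

Lemma wdernS k w : wdern k.+1 w = wdern k (wder w).
Proof. by rewrite /wdern iterSr. Qed.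

Lemma wdern_H1pair m k w : sobolevn m w -> (k < m)%N ->
  H1pair (wdern k w) (wdern k.+1 w).
Proof.
elim: k m w => [|k ih] [|m] w // sw km; have [p s1] := sobolevnS sw.
  exact: p.
by rewrite wdernS [wdern k.+2 w]wdernS; exact: ih s1 _.
Qed.

Lemma wdern_L2 m k w : sobolevn m w -> (k <= m)%N -> L2 (wdern k w).
Proof.
case: k => [|k] sw km; first exact: sobolevn_L2 sw.
by have [] := wdern_H1pair sw km.
Qed.

Lemma wdern_ae m k w w' : sobolevn m w -> L2 w' -> w =ae w' -> (k <= m)%N ->
  wdern k w =ae wdern k w'.
Proof.
elim: k m w w' => [//|k ih] [|m] w w' // sw L2w' ww' km.
have sw' := sobolevn_ae L2w' ww' sw.
have [p s1] := sobolevnS sw; have [p' s1'] := sobolevnS sw'.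
rewrite !wdernS; apply: (ih m) => //; first exact: sobolevn_L2 s1'.
have [L2w L2g _] := p.
have p2 := H1pair_ae hdot L2w' L2g ww' (aeD_refl a b _) p.
exact (H1pair_uniq hdot ab p2 p').
Qed.

Lemma wdernB m k w v : sobolevn m w -> sobolevn m v -> (k <= m)%N ->
  wdern k (fun t => w t - v t) =ae (fun t => wdern k w t - wdern k v t).
Proof.
elim: k m w v => [|k ih] [|m] w v // sw sv km; try exact: aeD_refl.
have [pw sw1] := sobolevnS sw; have [pv sv1] := sobolevnS sv.
have [pwv swv1] := sobolevnS (sobolevnB sw sv).
rewrite !wdernS; apply: aeD_trans (ih m _ _ sw1 sv1 km).
apply: (wdern_ae swv1) => //; first exact: sobolevn_L2 (sobolevnB sw1 sv1).
exact (wderE hdot ab (H1pairB hdot pw pv)).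
Qed.

Lemma derive1_primcomb x n c :
  derive1 (fun t => x + pcomb primleg n c t) = pcomb leg n c.
Proof.
pose c' i := if i is j.+1 then c j else x.
rewrite (_ : (fun t => x + pcomb primleg n c t) = pcomb (primbasis a b) n.+1 c').
  rewrite derive1_pcomb; apply/funext => t.
  rewrite /pcomb big_ord_recl /= derivC horner0 scale0r add0r.
  by apply: eq_bigr => i _; rewrite deriv_primleg.
by apply/funext => t; rewrite /pcomb big_ord_recl /= hornerC scale1r.
Qed.

Lemma H1pair_polyT q u : polyT X q u -> H1pair u (derive1 u) /\ polyT X q (derive1 u).
Proof.
move=> uq; have [x [c ->]] := (polyT_prim ab q u).1 uq.
rewrite derive1_primcomb; split; first exact: H1pair_primcomb.
apply/(polyT_leg ab); exists (fun i => if i == q then 0 else c i); apply/funext => t.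
rewrite /pcomb big_ord_recr /= eqxx scaler0 addr0; apply: eq_bigr => i _.
by rewrite ltn_eqF.
Qed.

Lemma sobolevn_polyT m q u : polyT X q u -> sobolevn m u.
Proof.
elim: m u => [|m ih] u uq; have [[L2u L2d ud] dq] := H1pair_polyT uq; first by [].
by split=> //; exists (derive1 u); split=> //; exact: ih.
Qed.

Lemma wder_polyT q u : polyT X q u -> wder u =ae derive1 u.
Proof. by move=> uq; have [p _] := H1pair_polyT uq; exact (wderE hdot ab p). Qed.

End Sobolev.

(** * The two projectors on one interval *)

Section Projectors.
Context (R : realType) (X : completeNormedModType R) (dot : {dot X for idfun}).
Hypothesis hdot : forall x : X, dot x x = `|x| ^+ 2.
Context (a b : R).
Hypothesis ab : a < b.
Implicit Types (f g h u v w : R -> X) (phi : R -> R) (x : X) (c d : nat -> X).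
Local Notation D := [set` `]a, b]].
Local Notation mu := (@lebesgue_measure R).
Local Notation L2 := (@L2 R X a b).
Local Notation ip := (L2dot dot a b).
Local Notation prim := (prim dot a b).
Local Notation H1pair := (H1pair dot a b).
Local Notation leg := (leg a b).
Local Notation primleg := (primleg a b).
Local Notation mom := (mom dot a b).
Local Notation coef := (coef dot a b).
Local Notation lorth := (lorth dot a b).
Local Notation sobolevn := (sobolevn dot a b).
Local Notation wder := (wder dot a b).
Local Notation crep := (crep a b).
Local Notation "f =ae g" := {ae mu, forall t, D t -> f t = g t}
  (at level 70, no associativity).

Let tau : R := b - a.
Let tau0 : 0 < tau. Proof. by rewrite subr_gt0. Qed.
Let tau1 : tau != 0. Proof. by rewrite gt_eqF. Qed.
Let bab : b \in `[a, b]. Proof. by rewrite in_itv/= lexx ltW. Qed.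
Let aab : a \in `[a, b]. Proof. by rewrite in_itv/= lexx ltW. Qed.

(** The moments of f themselves are taken as coefficients of the test
    polynomial. *)
Lemma lorth_test n f : L2 f -> (forall c, ip f (pcomb leg n c) = 0) -> lorth n f.
Proof.
move=> L2f h i ni; have := h (mom ^~ f); rewrite (L2dot_lcomb hdot ab)// => /eqP.
rewrite psumr_eq0; last by move=> j _; rewrite hdot exprn_ge0.
move=> /allP /(_ (Ordinal ni) (mem_index_enum _)) /=.
by rewrite hdot sqrf_eq0 normr_eq0 => /eqP.
Qed.

Lemma lorth_coef n g c i : L2 g -> lorth n (fun t => g t - pcomb leg n c t) ->
  (i < n)%N -> c i = coef i g.
Proof.
move=> L2g h ni; have := h i ni; rewrite (momB hdot ab)//; last exact: (L2_pcomb hdot).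
rewrite (mom_lcomb hdot ab) ni => /eqP; rewrite subr_eq0 => /eqP e.
by rewrite /coef e scalerA mulrA divfK// mulfV ?scale1r.
Qed.

Lemma pcomb_leg_b n c : pcomb leg n c b = \sum_(i < n) c i.
Proof. by apply: eq_bigr => i _; rewrite leg_b// scale1r. Qed.

Lemma pcomb_primleg_a n c : pcomb primleg n c a = 0.
Proof. by apply: big1 => i _; rewrite primleg_a// scale0r. Qed.

Lemma eq_pcomb P n c d : (forall i, (i < n)%N -> c i = d i) -> pcomb P n c = pcomb P n d :> (R -> X).
Proof. by move=> h; apply/funext => t; apply: eq_bigr => i _; rewrite h. Qed.

Lemma crep_primcomb_ae w x g : L2 g -> w =ae (fun t => x + prim g t) -> crep w a = x.
Proof. by move=> L2g h; rewrite (crep_prim hdot ab L2g h)// prim_a// addr0. Qed.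

Lemma continuous_pcomb P n c : continuous (pcomb P n c : R -> X).
Proof.
elim: n => [|n ih].
  rewrite (_ : pcomb P 0 c = cst 0); last by apply/funext => t; rewrite /pcomb big_ord0.
  exact: cst_continuous.
rewrite (_ : pcomb P n.+1 c = fun t => pcomb P n c t + (P n).[t] *: c n); last first.
  by apply/funext => t; rewrite /pcomb big_ord_recr.
by move=> t; apply: cvgD; [exact: ih|apply: cvgZr_tmp; exact: continuous_horner].
Qed.

(** The primitive, with value w(a) at a, of the L^2 projection of w'. The
    conditions that define the H^1 projector say exactly this. *)
Definition H1poly n w t : X := crep w a + pcomb primleg n (coef ^~ (wder w)) t.

Lemma H1pair_sub_primcomb w g x n c : H1pair w g ->
  H1pair (fun t => w t - (x + pcomb primleg n c t)) (fun t => g t - pcomb leg n c t) /\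
  (fun t => w t - (x + pcomb primleg n c t)) =ae
    (fun t => (crep w a - x) + prim (fun s => g s - pcomb leg n c s) t).
Proof.
move=> wg; have [_ L2g _] := wg; split.
  exact: (H1pairB hdot wg (H1pair_primcomb hdot ab x n c)).
apply: aeS (H1pair_crep hdot ab wg) => t h Dt; rewrite h//.
rewrite (primB hdot ab)//; last exact: (L2_pcomb hdot).
rewrite (prim_lcomb hdot ab); last exact: subset_itv_oc_cc.
by rewrite opprD addrACA.
Qed.

Lemma is_H1projP n w u : sobolevn 1 w -> is_H1proj dot a b n w u <-> u = H1poly n w.
Proof.
move=> sw; have [p _] := sobolevnS hdot ab sw; have [L2w L2w1 _] := p.
have key x c : [/\ L2 (wder (fun t => w t - (x + pcomb primleg n c t))),
    wder (fun t => w t - (x + pcomb primleg n c t)) =ae (fun t => wder w t - pcomb leg n c t)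
    & crep (fun t => w t - (x + pcomb primleg n c t)) a = crep w a - x].
  have [p2 h] := H1pair_sub_primcomb x n c p.
  have [_ L2d _] := wder_H1pair p2; split => //; first exact (wderE hdot ab p2).
  by have [_ L2g _] := p2; rewrite (crep_primcomb_ae L2g h).
split=> [[up o ca]|->].
  have [x [c uE]] := (polyT_prim ab n u).1 up; move: o ca; rewrite uE.
  have [L2d hd hc] := key x c.
  rewrite -[w \- _]/(fun t => w t - (x + pcomb primleg n c t)) => o; rewrite hc.
  move=> /eqP; rewrite subr_eq0 => /eqP xE; apply/funext => t; rewrite /H1poly xE.
  congr (_ + _); congr (_ t); apply: eq_pcomb => i ni.
  apply: (lorth_coef (n := n)) => //; apply: lorth_test.
    by apply: (L2B hdot) => //; exact: (L2_pcomb hdot).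
  move=> e; have L2pe := L2_pcomb hdot a b leg n e.
  rewrite -(L2dot_ae hdot L2d _ L2pe hd); last first.
    by apply: (L2B hdot) => //; exact: (L2_pcomb hdot).
  rewrite -(derive1_primcomb ab 0); apply: o; apply/(polyT_prim ab).
  by exists 0, e.
have [L2d hd hc] := key (crep w a) (coef ^~ (wder w)).
split.
- by apply/(polyT_prim ab); exists (crep w a), (coef ^~ (wder w)).
- move=> q /(polyT_prim ab)[x [c ->]]; rewrite (derive1_primcomb ab).
  rewrite (L2dot_ae hdot L2d _ (L2_pcomb hdot a b leg n c) hd); last exact: (L2_sub_lproj hdot).
  by apply: (lorth_dot hdot ab); [exact: (L2_sub_lproj hdot)|move=> i; exact: mom_sub_lproj].
- by rewrite -[crep _ a]/(crep (fun t => w t - (crep w a + pcomb primleg n (coef ^~ (wder w)) t)) a) hc subrr.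
Qed.

Lemma H1projE n w : sobolevn 1 w -> H1proj dot a b n w = H1poly n w.
Proof.
move=> sw; apply/(is_H1projP n _ sw).
by have := @xgetPex _ (fun=> 0) [set u | is_H1proj dot a b n w u]
  (ex_intro _ _ ((is_H1projP n _ sw).2 erefl)).
Qed.

(** The Legendre coefficients of the derivative of the Thomee polynomial:
    testing with polynomials of degree at most k gives those of w', and the
    last one makes the sum of all, which is the value at b, equal to that of
    w'. *)
Definition thcoef k g i : X :=
  if (i < k.+1)%N then coef i g else crep g b - \sum_(j < k.+1) coef j g.

Definition thpoly k w t : X := crep w a + pcomb primleg k.+2 (thcoef k (wder w)) t.

Lemma is_thomeeP k w u : sobolevn 2 w ->
  is_thomee dot a b k.+2 w u <-> u = thpoly k w.
Proof.
move=> sw; have [p _] := sobolevnS hdot ab sw; have [L2w L2w1 _] := p.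
have k2 : (k.+2 - 2)%N = k by rewrite subn2.
have L2c c := L2_pcomb hdot a b leg k.+2 c.
have cut g c : L2 g -> lorth k.+1 (fun t => g t - pcomb leg k.+2 c t) <->
    (forall i, (i < k.+1)%N -> c i = coef i g).
  move=> L2g; split=> h i ni.
    have := h i ni; rewrite (momB hdot ab)// (mom_lcomb hdot ab) (ltn_trans ni)// => /eqP.
    rewrite subr_eq0 => /eqP e.
    by rewrite /coef e scalerA mulrA divfK// mulfV ?scale1r.
  rewrite (momB hdot ab)// (mom_lcomb hdot ab) (ltn_trans ni)// h// /coef scalerA.
  by rewrite mulrA divfK// mulfV ?scale1r ?subrr.
rewrite /is_thomee k2; split=> [[up o db ua]|->].
  have [x [c uE]] := (polyT_prim ab k.+2 u).1 up; move: o db ua.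
  rewrite uE (derive1_primcomb ab) pcomb_leg_b pcomb_primleg_a addr0 => o db xE.
  have cE := (cut _ c L2w1).1 ((lorthP hdot ab k (L2B hdot L2w1 (L2c c))).2 o).
  apply/funext => t; rewrite /thpoly xE; congr (_ + _); congr (_ t).
  apply: eq_pcomb => i ni; rewrite /thcoef; case: ifPn => [|ki]; first exact: cE.
  have -> : i = k.+1 by apply/eqP; rewrite eqn_leq -ltnS ni leqNgt.
  have e : \sum_(j < k.+1) coef j (wder w) = \sum_(j < k.+1) c j.
    by apply: eq_bigr => j _; rewrite cE.
  by rewrite e -db big_ord_recr /= addrAC subrr add0r.
split.
- by apply/(polyT_prim ab); exists (crep w a), (thcoef k (wder w)).
- rewrite /thpoly (derive1_primcomb ab).
  apply/(lorthP hdot ab k (L2B hdot L2w1 (L2c _)))/cut => // i ni.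
  by rewrite /thcoef ni.
- rewrite /thpoly (derive1_primcomb ab) pcomb_leg_b big_ord_recr /=.
  rewrite /thcoef ltnn addrC (eq_bigr (fun i : 'I_k.+1 => coef i (wder w))) ?subrK//.
  by move=> j _; rewrite ltn_ord.
- by rewrite /thpoly pcomb_primleg_a addr0.
Qed.

Lemma thomeeE k w : sobolevn 2 w -> thomee dot a b k.+2 w = thpoly k w.
Proof.
move=> sw; apply/(is_thomeeP k _ sw).
by have := @xgetPex _ (fun=> 0) [set u | is_thomee dot a b k.+2 w u]
  (ex_intro _ _ ((is_thomeeP k _ sw).2 erefl)).
Qed.

Lemma thomee_polyT k q : polyT X k.+2 q -> thomee dot a b k.+2 q = q.
Proof.
move=> hq; have sq := sobolevn_polyT hdot ab 2 hq.
rewrite thomeeE//; apply/esym/(is_thomeeP k q sq).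
have [p1 q1] := H1pair_polyT hdot ab hq; have [p2 q2] := H1pair_polyT hdot ab q1.
have ae1 := wder_polyT hdot ab hq.
have cont u : polyT X k.+2 u -> {within `[a, b], continuous u}.
  by move=> /(polyT_leg ab)[c ->]; apply: continuous_subspaceT; exact: continuous_pcomb.
split=> //.
- move=> r hr; have [_ L2d _] := p1.
  have L2w : L2 (wder q) by have [_ ? _] := wder_H1pair p1.
  have L2r : L2 r by exact: (sobolevn_polyT hdot ab 0 hr).
  rewrite (L2dotBl hdot)// (L2dot_ae hdot L2w L2d L2r ae1) subrr//.
- by apply/esym; apply: (crepE ab (cont _ q1) ae1).
- by apply/esym; apply: (crepE ab (cont _ hq) (aeD_refl a b q)).
Qed.

End Projectors.

(** * Error estimates *)

Section ErrorEstimates.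
Context (R : realType) (X : completeNormedModType R) (dot : {dot X for idfun}).
Hypothesis hdot : forall x : X, dot x x = `|x| ^+ 2.
Context (a b : R).
Hypothesis ab : a < b.
Implicit Types (f g h u v w : R -> X) (phi : R -> R) (x : X) (c d : nat -> X).
Local Notation D := [set` `]a, b]].
Local Notation mu := (@lebesgue_measure R).
Local Notation L2 := (@L2 R X a b).
Local Notation nrm := (nrm dot a b).
Local Notation vint := (vint dot a b).
Local Notation prim := (prim dot a b).
Local Notation H1pair := (H1pair dot a b).
Local Notation leg := (leg a b).
Local Notation primleg := (primleg a b).
Local Notation pint := (pint a b).
Local Notation coef := (coef dot a b).
Local Notation lproj := (lproj dot a b).
Local Notation sobolevn := (sobolevn dot a b).
Local Notation wder := (wder dot a b).
Local Notation wdern := (wdern dot a b).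
Local Notation crep := (crep a b).
Local Notation "f =ae g" := {ae mu, forall t, D t -> f t = g t}
  (at level 70, no associativity).

Let tau : R := b - a.
Let tau0 : 0 < tau. Proof. by rewrite subr_gt0. Qed.
Let tau1 : tau != 0. Proof. by rewrite gt_eqF. Qed.
Let bab : b \in `[a, b]. Proof. by rewrite in_itv/= lexx ltW. Qed.
Let aab : a \in `[a, b]. Proof. by rewrite in_itv/= lexx ltW. Qed.

Local Notation H1poly := (H1poly dot a b).
Local Notation thpoly := (thpoly dot a b).

(** Twice this polynomial is the sum of two consecutive Legendre polynomials,
    which adds up at b and cancels at a. *)
Definition tracepoly n : {poly R} := (2^-1)%:P * (leg n.+1 + leg n).

Lemma deriv_tracepoly n :
  (tracepoly n)^`() = \sum_(j < n.+1) ((2 * j + 1)%:R / tau)%:P * leg j.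
Proof.
rewrite /tracepoly derivM derivC mul0r add0r derivD; elim: n => [|n ih].
  rewrite big_ord1 leg0 leg1 deriv_refvar// derivC addr0 -polyCM mulr1; congr _%:P.
  by rewrite -/tau /= muln0 add0n; field.
rewrite big_ord_recr -ih /= deriv_legSS// -/tau.
have -> : ((2 * n.+1 + 1)%:R / tau)%:P = (2^-1)%:P * ((2 * n + 3)%:R * (2 / tau)%:P) :> {poly R}.
  rewrite natr_poly -!polyCM; congr _%:P; have -> : (2 * n.+1 + 1 = 2 * n + 3)%N by lia.
  by move: ((2 * n + 3)%:R : R) => z; field.
by ring.
Qed.

(** The polynomial tracepoly n has the value 1 at b and vanishes at a, and its
    derivative reproduces the value at b of the projection. Integrating by
    parts thus expresses the trace of the projection error by the derivative
    h. *)
Lemma trace_sub_lproj n g h : H1pair g h ->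
  crep g b - lproj n.+1 g b = vint (fun t => (tracepoly n).[t] *: h t).
Proof.
move=> gh; have [L2g L2h _] := gh.
have := H1_by_parts hdot ab (C1_horner (tracepoly n)) gh.
have -> : (tracepoly n).[b] = 1.
  by rewrite /tracepoly hornerM hornerC hornerD !leg_b//; field.
have -> : (tracepoly n).[a] = 0.
  by rewrite /tracepoly hornerM hornerC hornerD !leg_a// exprS mulN1r addNr mulr0.
rewrite scale0r scale1r subr0 -derivE deriv_tracepoly => e.
have -> : lproj n.+1 g b = vint (fun t =>
    (\sum_(j < n.+1) ((2 * j + 1)%:R / tau)%:P * leg j).[t] *: g t).
  rewrite (_ : (fun t => _) = fun t =>
      \sum_(j < n.+1) ((2 * j + 1)%:R / tau) *: ((leg j).[t] *: g t)).
    rewrite (vint_sum hdot ab); last by move=> j; apply: (L2Z hdot); exact: (L2_poly hdot).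
    rewrite /lproj (pcomb_leg_b ab); apply: eq_bigr => j _.
    by rewrite (vintZ hdot ab)//; exact: (L2_poly hdot).
  apply/funext => t; rewrite horner_sum scaler_suml; apply: eq_bigr => j _.
  by rewrite hornerM hornerC scalerA.
by rewrite e opprB addrC subrK.
Qed.

Lemma pint_tracepoly_sqr n : pint (tracepoly n * tracepoly n) =
  4^-1 * (tau / (2 * n + 3)%:R + tau / (2 * n + 1)%:R).
Proof.
have -> : tracepoly n * tracepoly n = (4^-1)%:P * (leg n.+1 * leg n.+1 + leg n * leg n +
   2%:P * (leg n.+1 * leg n)).
  have -> : (4^-1)%:P = (2^-1)%:P * (2^-1)%:P :> {poly R} by rewrite -polyCM; congr _%:P; field.
  by rewrite /tracepoly polyC_natr; ring.
rewrite pintZ !pintD pintZ (@pint_leg_orth _ _ _ ab n.+1 n) ?gtn_eqF//.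
rewrite mulr0 addr0 !pint_leg_sqr//.
by have -> : (2 * n.+1 + 1 = 2 * n + 3)%N by lia.
Qed.

Lemma sqr_trace_le n g h : H1pair g h ->
  `|crep g b - lproj n.+1 g b| ^+ 2 <= pint (tracepoly n * tracepoly n) * nrm h ^+ 2.
Proof.
move=> gh; have [_ L2h _] := gh; rewrite (trace_sub_lproj n gh).
have [M M0 hM] := continuous_bounded a b (@continuous_horner R (tracepoly n)).
have mt : measurable_fun D (horner (tracepoly n)).
  by apply: measurable_funTS; apply: continuous_measurable_fun; exact: continuous_horner.
apply: le_trans (sqr_vint_le hdot ab mt hM L2h) _.
rewrite le_eqVlt; apply/orP; left; apply/eqP; congr (_ * _).
by apply: eq_Rintegral => t _; rewrite [RHS]hornerM expr2.
Qed.

Lemma sqr_nrm_poly_cst (p : {poly R}) x :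
  nrm (fun t => p.[t] *: x) ^+ 2 = pint (p * p) * `|x| ^+ 2.
Proof.
rewrite (sqr_nrm hdot) /L2dot /pint mulrC -RintegralZl//.
  by apply: eq_Rintegral => t _; rewrite dotZl dotZr hdot hornerM; ring.
exact: integrable_poly.
Qed.

(** The derivatives of the two polynomials differ in their last Legendre
    coefficient only, and the value of the difference at b is prescribed. *)
Lemma thpoly_H1poly k w t :
  thpoly k w t = H1poly k.+2 w t +
    (primleg k.+1).[t] *: (crep (wder w) b - lproj k.+2 (wder w) b).
Proof.
rewrite /thpoly /H1poly -addrA; congr (_ + _).
rewrite /pcomb big_ord_recr /= [in RHS]big_ord_recr /= -addrA; congr (_ + _).
  by apply: eq_bigr => i _; rewrite /thcoef ltn_ord.
rewrite -scalerDr; congr (_ *: _); rewrite /thcoef ltnn /lproj (pcomb_leg_b ab).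
by rewrite [X in _ = _ + (_ - X)]big_ord_recr /= opprD (addrA (crep _ _)) [RHS]addrC subrK.
Qed.

Lemma L2_pcomb_add w x n c : L2 w -> L2 (fun t => w t - (x + pcomb primleg n c t)).
Proof.
move=> L2w; apply: (L2B hdot) => //; apply: (L2D hdot); first exact: (L2_cst hdot).
exact: (L2_pcomb hdot).
Qed.

(** The squared norm of tracepoly is of order tau / p, so the trace costs a
    factor of order (tau / p)^(1/2) against h; the primitive of the Legendre
    polynomial of degree p-1 has an L^2 norm of order (tau / p)^(3/2). *)
Lemma nrm_correction k g h : H1pair g h ->
  nrm (fun t => (primleg k.+1).[t] *: (crep g b - lproj k.+2 g b)) <=
  (tau / k.+2%:R) ^+ 2 * nrm h.
Proof.
move=> gh; have R0 : 0 <= (tau / k.+2%:R) ^+ 2 * nrm h.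
  by apply: mulr_ge0; [exact: sqr_ge0|exact: nrm_ge0].
rewrite -(@ler_pXn2r _ 2)// ?nnegrE ?nrm_ge0//.
rewrite sqr_nrm_poly_cst exprMn.
have H := sqr_trace_le k.+1 gh; rewrite pint_tracepoly_sqr in H.
rewrite pint_primleg_sqr// -/tau.
have P0 : 0 <= (tau / 2) ^+ 2 / (2 * k + 3)%:R ^+ 2 *
    (tau / (2 * k + 5)%:R + tau / (2 * k + 1)%:R).
  have t0 := ltW tau0.
  by rewrite mulr_ge0 ?divr_ge0 ?sqr_ge0// addr_ge0// divr_ge0.
apply: le_trans (ler_wpM2l P0 H) _; rewrite mulrA.
apply: ler_wpM2r; first exact: sqr_ge0.
have e1 : (2 * k.+1 + 3 = 2 * k + 5)%N by lia.
have e2 : (2 * k.+1 + 1 = 2 * k + 3)%N by lia.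
rewrite e1 e2; set p : R := k.+2%:R.
have p2 : 2 <= p by rewrite /p ler_nat.
have -> : (2 * k + 5)%:R = 2 * p + 1 by rewrite /p; ring.
have -> : (2 * k + 3)%:R = 2 * p - 1 by rewrite /p; ring.
have -> : (2 * k + 1)%:R = 2 * p - 3 by rewrite /p; ring.
clearbody p.
have hp : 0 < p by lra.
have h1 : (2 * p + 1)^-1 <= p^-1 by rewrite lef_pV2 ?posrE; lra.
have h2 : (2 * p - 1)^-1 <= p^-1 by rewrite lef_pV2 ?posrE; lra.
have h3 : (2 * p - 3)^-1 <= 2 * p^-1.
  have -> : 2 * p^-1 = (p / 2)^-1 by field; lra.
  by rewrite lef_pV2 ?posrE; lra.
have h2' : 0 <= (2 * p - 1)^-1 by rewrite invr_ge0; lra.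
have h1' : 0 <= (2 * p + 1)^-1 by rewrite invr_ge0; lra.
have h3' : 0 <= (2 * p - 3)^-1 by rewrite invr_ge0; lra.
rewrite -exprVn.
have t0 := ltW tau0.
move: h1 h2 h3 h1' h2' h3'; move: p^-1 (2 * p + 1)^-1 (2 * p - 1)^-1 (2 * p - 3)^-1.
move=> q x y z h1 h2 h3 x0 y0 z0; have q0 : 0 <= q by exact: le_trans x0 h1.
have t4 : 0 <= tau ^+ 4 by rewrite exprn_ge0// ltW.
have -> : (tau / 2) ^+ 2 * y ^+ 2 * (tau * x + tau * z) *
    (4^-1 * (tau * x + tau * y)) = tau ^+ 4 * (16^-1 * (y ^+ 2 * (x + z) * (x + y))).
  by field.
have -> : ((tau * q) ^+ 2) ^+ 2 = tau ^+ 4 * (q ^+ 2 * q ^+ 2) by ring.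
apply: ler_wpM2l => //.
have a1 : y ^+ 2 <= q ^+ 2 by rewrite lerXn2r ?nnegrE.
have a2 : (x + z) * (x + y) <= (3 * q) * (2 * q).
  by apply: ler_pM; rewrite ?addr_ge0//; lra.
have a3 : y ^+ 2 * ((x + z) * (x + y)) <= q ^+ 2 * ((3 * q) * (2 * q)).
  by apply: ler_pM; rewrite ?sqr_ge0// ?mulr_ge0 ?addr_ge0.
have q4 : 0 <= q ^+ 2 * q ^+ 2 by rewrite mulr_ge0 ?sqr_ge0.
have e : q ^+ 2 * ((3 * q) * (2 * q)) = 6 * (q ^+ 2 * q ^+ 2) by ring.
by rewrite e in a3; lra.
Qed.

Lemma sub_H1poly_ae n w : sobolevn 1 w ->
  (fun t => w t - H1poly n w t) =ae prim (fun s => wder w s - lproj n (wder w) s).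
Proof.
move=> sw; have [p _] := sobolevnS hdot ab sw.
have [_ h] := H1pair_sub_primcomb hdot ab (crep w a) n (coef ^~ (wder w)) p.
by apply: aeS h => t h /h; rewrite subrr add0r.
Qed.

(** A duality argument: the error is the primitive of a function that is
    orthogonal to polynomials, which gains a factor of order tau / n by
    nrm_prim_lorth. *)
Lemma nrm_sub_H1poly_le n w c : sobolevn 1 w ->
  nrm (fun t => w t - H1poly n.+1 w t) <=
  2 * (tau / n.+1%:R) * nrm (fun t => wder w t - pcomb leg n.+1 c t).
Proof.
move=> sw; have [[L2w L2w1 _] _] := sobolevnS hdot ab sw.
have L2d := L2_sub_lproj hdot n.+1 L2w1.
rewrite (nrm_ae hdot (L2_pcomb_add _ _ _ L2w) (L2_prim hdot ab L2d) (sub_H1poly_ae n.+1 sw)).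
apply: le_trans (nrm_prim_lorth hdot ab (n := n) L2d _) _.
  by move=> i; exact: mom_sub_lproj.
have -> : 2 * (b - a) / n.+1%:R = 2 * (tau / n.+1%:R) by rewrite mulrA.
apply: ler_wpM2l.
  by rewrite mulr_ge0 ?divr_ge0// ltW.
exact: lproj_best.
Qed.

(** The correction depends on w' only through the trace of its projection
    error, which does not change when a polynomial of degree less than p is
    subtracted from w'. Taking g as the derivative of w - q gives the bound by
    (w - q)''. *)
Lemma nrm_sub_thpoly_le k w g h c : sobolevn 2 w ->
  g = (fun t => wder w t - pcomb leg k.+2 c t) -> H1pair g h ->
  nrm (fun t => w t - thpoly k w t) <=
  nrm (fun t => w t - H1poly k.+2 w t) + (tau / k.+2%:R) ^+ 2 * nrm h.
Proof.
move=> sw gE gh; have sw1 := sobolevnW sw.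
have [p1 s1] := sobolevnS hdot ab sw; have [p2 _] := sobolevnS hdot ab s1.
have [L2w L2w1 _] := p1.
have -> : (fun t => w t - thpoly k w t) = fun t => (w t - H1poly k.+2 w t) -
    (primleg k.+1).[t] *: (crep (wder w) b - lproj k.+2 (wder w) b).
  by apply/funext => t; rewrite thpoly_H1poly opprD addrA.
have -> : crep (wder w) b - lproj k.+2 (wder w) b = crep g b - lproj k.+2 g b.
  have -> : lproj k.+2 g b = lproj k.+2 (wder w) b - pcomb leg k.+2 c b.
    rewrite gE (lprojB hdot ab)//; last exact: (L2_pcomb hdot).
    by rewrite (lproj_lcomb hdot ab).
  have cw := H1pair_crep hdot ab p2; have [_ L2w2 _] := p2.
  have -> : crep g b = crep (wder w) b - pcomb leg k.+2 c b.
    rewrite (crep_prim hdot ab L2w2 cw bab).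
    apply: (crepE ab (u := fun t => (crep (wder w) a + prim (wder (wder w)) t) - pcomb leg k.+2 c t)) => //.
      have c1 := continuous_cst_prim hdot ab (c := crep (wder w) a) L2w2.
      have c2 : {within `[a, b], continuous (pcomb leg k.+2 c)}.
        by apply: continuous_subspaceT; exact: continuous_pcomb.
      by move=> t; apply: cvgB; [exact: c1|exact: c2].
    by apply: aeS cw => t e Dt; rewrite gE e.
  by rewrite opprB addrA subrK.
apply: le_trans (nrmB hdot (L2_pcomb_add _ _ _ L2w) _) _.
  by apply: (L2_poly hdot); exact: (L2_cst hdot).
by rewrite lerD2l; exact: nrm_correction.
Qed.

Lemma nrm_sub_thpoly_H1poly k w : sobolevn 2 w ->
  nrm (fun t => w t - thpoly k w t) <=
  nrm (fun t => w t - H1poly k.+2 w t) + (tau / k.+2%:R) ^+ 2 * nrm (wdern 2 w).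
Proof.
move=> sw; have [_ s1] := sobolevnS hdot ab sw; have [p2 _] := sobolevnS hdot ab s1.
apply: (nrm_sub_thpoly_le (c := fun=> 0) sw _ p2).
apply/funext => t; rewrite /pcomb big1 ?subr0// => i _.
by rewrite scaler0.
Qed.

End ErrorEstimates.

Section SimultaneousApproximation.
Context (R : realType) (X : completeNormedModType R) (dot : {dot X for idfun}).
Hypothesis hdot : forall x : X, dot x x = `|x| ^+ 2.
Context (a b : R).
Hypothesis ab : a < b.
Implicit Types (f g h u v w : R -> X) (phi : R -> R) (x : X) (c d : nat -> X).
Local Notation D := [set` `]a, b]].
Local Notation mu := (@lebesgue_measure R).
Local Notation L2 := (@L2 R X a b).
Local Notation nrm := (nrm dot a b).
Local Notation prim := (prim dot a b).
Local Notation H1pair := (H1pair dot a b).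
Local Notation leg := (leg a b).
Local Notation primleg := (primleg a b).
Local Notation coef := (coef dot a b).
Local Notation lproj := (lproj dot a b).
Local Notation bestL2 := (bestL2 dot a b).
Local Notation sobolevn := (sobolevn dot a b).
Local Notation wder := (wder dot a b).
Local Notation wdern := (wdern dot a b).
Local Notation crep := (crep a b).
Local Notation "f =ae g" := {ae mu, forall t, D t -> f t = g t}
  (at level 70, no associativity).

Let tau : R := b - a.
Let tau0 : 0 < tau. Proof. by rewrite subr_gt0. Qed.

Local Notation thpoly := (thpoly dot a b).

Lemma wder_sub_polyT q n w : polyT X n q -> sobolevn 2 w ->
  [/\ sobolevn 2 (fun t => w t - q t),
      wder (fun t => w t - q t) =ae (fun t => wder w t - derive1 q t) &
      H1pair (fun t => wder w t - derive1 q t) (wdern 2 (fun t => w t - q t))].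
Proof.
move=> hq sw; have sq := sobolevn_polyT hdot ab 2 hq.
have swq := sobolevnB hdot sw sq.
have [pq q1] := H1pair_polyT hdot ab hq; have [pq1 _] := H1pair_polyT hdot ab q1.
have [pw s1] := sobolevnS hdot ab sw; have [pw1 _] := sobolevnS hdot ab s1.
have e1 := wderE hdot ab (H1pairB hdot pw pq).
have [pwq s2] := sobolevnS hdot ab swq; have [pwq1 _] := sobolevnS hdot ab s2.
have [_ L2g _] := H1pairB hdot pw pq; have [_ L2h _] := pwq1.
split; [exact: swq|exact e1|].
exact (H1pair_ae hdot L2g L2h e1 (aeD_refl a b _) pwq1).
Qed.

Lemma nrm_sub_thpoly_polyT k w q : sobolevn 2 w -> polyT X k.+2 q ->
  nrm (fun t => w t - thpoly k w t) <=
  2 * (tau / k.+2%:R * nrm (wdern 1 (fun t => w t - q t)) +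
       (tau / k.+2%:R) ^+ 2 * nrm (wdern 2 (fun t => w t - q t))).
Proof.
move=> sw hq; have [swq e1 pg] := wder_sub_polyT hq sw.
have [x [c qE]] := (polyT_prim ab k.+2 q).1 hq.
have gE : (fun t => wder w t - derive1 q t) = fun t => wder w t - pcomb leg k.+2 c t.
  by rewrite qE (derive1_primcomb ab).
have n1 : nrm (wdern 1 (fun t => w t - q t)) = nrm (fun t => wder w t - pcomb leg k.+2 c t).
  rewrite -gE; have [L2g _ _] := pg; have [[_ L2v _] _] := sobolevnS hdot ab swq.
  exact (nrm_ae hdot L2v L2g e1).
have h1 := nrm_sub_thpoly_le hdot ab sw gE pg.
have h2 := nrm_sub_H1poly_le hdot ab k.+1 c (sobolevnW sw).
rewrite n1; apply: le_trans h1 _; rewrite mulrDr; apply: lerD.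
  by rewrite mulrA.
by apply: ler_peMl; [rewrite mulr_ge0 ?sqr_ge0 ?nrm_ge0|lra].
Qed.

(** Projecting w'' and integrating twice gives a polynomial that is close to w
    in both seminorms at once. *)
Lemma exists_polyT k w : sobolevn 2 w -> exists2 q, polyT X k.+2 q &
  nrm (wdern 1 (fun t => w t - q t)) <= 2 * tau / k.+1%:R * bestL2 k.+1 (wdern 2 w) /\
  nrm (wdern 2 (fun t => w t - q t)) <= bestL2 k.+1 (wdern 2 w).
Proof.
move=> sw; have [pw s1] := sobolevnS hdot ab sw; have [pw1 _] := sobolevnS hdot ab s1.
have [_ L2w2 _] := pw1; have L2b := L2_sub_lproj hdot k.+1 L2w2.
pose r t := crep (wder w) a + pcomb primleg k.+1 (coef ^~ (wdern 2 w)) t.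
have hr : polyT X k.+1 r.
  by apply/(polyT_prim ab); exists (crep (wder w) a), (coef ^~ (wdern 2 w)).
have [c hc] := (polyT_leg ab k.+1 r).1 hr.
have hq : polyT X k.+2 (fun t => 0 + pcomb primleg k.+2 c t).
  by apply/(polyT_prim ab); exists 0, c.
exists (fun t => 0 + pcomb primleg k.+2 c t) => //.
have [swq e1 pg] := wder_sub_polyT hq sw.
rewrite (derive1_primcomb ab) -hc in e1 pg.
have [pr hp] := H1pair_sub_primcomb hdot ab (crep (wder w) a) k.+1 (coef ^~ (wdern 2 w)) pw1.
have e2 := H1pair_uniq hdot ab pg pr.
have L2wq1 := wdern_L2 hdot ab swq (k := 1) isT.
have L2wq2 := wdern_L2 hdot ab swq (k := 2) isT.
split; last first.
  by rewrite (nrm_ae hdot L2wq2 L2b e2).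
have e3 : wdern 1 (fun t => w t - (0 + pcomb primleg k.+2 c t)) =ae
    prim (fun s => wdern 2 w s - lproj k.+1 (wdern 2 w) s).
  apply: aeD_trans e1 _; apply: aeS hp => t h /h.
  by rewrite subrr add0r.
rewrite (nrm_ae hdot L2wq1 (L2_prim hdot ab L2b) e3).
apply: (nrm_prim_lorth hdot ab) => // i; exact: mom_sub_lproj.
Qed.

(** Each derivative gains a factor tau / (k.+1 - i), where the degree has
    dropped to k.+1 - i. As i stays below j, this is tau / k.+2 up to a factor
    i.+2, and the product of these is the factorial. *)
Lemma bestL2_wdern k j w : sobolevn (2 + j) w -> (j <= k.+1)%N ->
  bestL2 k.+1 (wdern 2 w) <=
  (j.+1)`!%:R * (tau / k.+2%:R) ^+ j * bestL2 (k.+1 - j) (wdern (2 + j) w).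
Proof.
elim: j => [|j ih] sw jk.
  by rewrite expr0 !mul1r subn0 addn0.
have sw' : sobolevn (2 + j) w by apply: (sobolevn_le _ sw); rewrite leq_add2l.
apply: le_trans (ih sw' (ltnW jk)) _.
have p := wdern_H1pair hdot ab sw (k := 2 + j) (ltac:(by rewrite ltn_add2l)).
have kj : (k.+1 - j)%N = (k.+1 - j.+1).+1 by rewrite subnSK.
have h := bestL2_H1 hdot ab (k.+1 - j.+1) p; rewrite -kj in h.
have c0 : 0 <= (j.+1)`!%:R * (tau / k.+2%:R) ^+ j :> R.
  by rewrite mulr_ge0 ?exprn_ge0// divr_ge0// ltW.
apply: le_trans (ler_wpM2l c0 h) _; rewrite mulrA addnS.
apply: ler_wpM2r; first exact: bestL2_ge0.
rewrite -/tau.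
have -> : (j.+2)`!%:R * (tau / k.+2%:R) ^+ j.+1 =
  (j.+1)`!%:R * (tau / k.+2%:R) ^+ j * (j.+2%:R * (tau / k.+2%:R)) :> R.
  by rewrite factS natrM exprSr; ring.
apply: (ler_wpM2l c0).
have n0 : 0 < (k.+1 - j)%:R :> R by rewrite ltr0n subn_gt0.
rewrite mulrCA ler_pM2l// ler_pdivlMr ?ltr0n// mulrC ler_pdivrMr//.
by rewrite -natrM ler_nat; nia.
Qed.

Lemma bestL2_triangle n f g : L2 f -> L2 g ->
  bestL2 n f <= nrm (fun t => f t - g t) + bestL2 n g.
Proof.
move=> L2f L2g; have L2fg := L2B hdot L2f L2g.
have -> : bestL2 n f = nrm (fun t => ((f t - g t) - lproj n (fun t => f t - g t) t) + (g t - lproj n g t)).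
  congr (nrm _); apply/funext => t; rewrite (lprojB hdot ab)//.
  by rewrite opprB addrACA subrK [_ - _ - _]addrAC subrr add0r.
apply: le_trans (nrmD hdot _ _) _; try exact: (L2_sub_lproj hdot).
by rewrite lerD2r; exact: nrm_sub_lproj_le.
Qed.

End SimultaneousApproximation.

(** * Interpolation seminorms *)

Section Interpolation.
Local Open Scope ereal_scope.

(** The integral of a nonnegative function is the supremum of the integrals of
    the simple functions below it. This covers integrands built from
    K-functionals, whose measurability is not at hand. *)
Lemma ge0_le_integral_restrict d (T : measurableType d) (R : realType)
    (mu : {measure set T -> \bar R}) (D E : set T) (f g : T -> \bar R) :
  (forall x, D x -> 0 <= f x) -> (forall x, E x -> 0 <= g x) ->
  (forall x, D x -> E x /\ f x <= g x) ->
  \int[mu]_(x in D) f x <= \int[mu]_(x in E) g x.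
Proof.
move=> f0 g0 fg; rewrite ge0_integralE// [leRHS]ge0_integralE//.
apply: ge_ereal_sup => _ [u uf <-]; apply: ereal_sup_ubound; exists u => // x.
apply: le_trans (uf x) _; rewrite !patchE.
case: ifPn => [/set_mem /fg[Ex fgx]|_]; first by rewrite mem_set.
by case: ifPn => // /set_mem /g0.
Qed.

(** The integral that defines the interpolation seminorm is at least its part
    over ]h, 2 * h], where the K-functional is at least kappa. *)
Lemma interpolate_ge (R : realType) (X : completeNormedModType R)
    (dot : {dot X for idfun}) (a b : R) N m (theta h kappa : R) w :
  (0 <= theta <= 1)%R -> (0 < h)%R -> (0 <= kappa)%R ->
  (forall x : R, (h <= x)%R -> kappa%:E <= Kfun dot a b N m x w) ->
  kappa%:E <= (4 * h `^ theta)%:E * interpolate dot a b N m theta w.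
Proof.
move=> /andP[t0 t1] h0 k0 hK.
have q0 : (0 < h `^ theta)%R by exact: powR_gt0.
pose y : R := (kappa / (4 * h `^ theta))%R.
have y0 : (0 <= y)%R by rewrite divr_ge0// mulr_ge0// ltW.
suff H : y%:E <= interpolate dot a b N m theta w.
  rewrite (_ : kappa = 4 * h `^ theta * y)%R.
    by rewrite EFinM; apply: lee_wpmul2l => //; rewrite lee_fin mulr_ge0// ltW.
  by rewrite /y mulrC divfK// gt_eqF// mulr_gt0.
have -> : y = ((y ^+ 2) `^ (2^-1))%R.
  by rewrite powR12_sqrt ?sqr_ge0// sqrtr_sqr ger0_norm.
rewrite /interpolate -poweR_EFin.
set I := \int[_]_(_ in _) _.
have I0 : 0 <= I.
  by apply: integral_ge0 => x _; rewrite mule_ge0 ?lee_fin ?powR_ge0 ?sqre_ge0.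
suff HI : (y ^+ 2)%:E <= I.
  apply: gt0_ler_poweR => //; rewrite in_itv /= ?leey ?andbT//.
  by rewrite lee_fin sqr_ge0.
pose e : R := (2 * theta + 1)%R.
have e0 : (0 < e)%R by rewrite /e; lra.
pose c : R := (((2 * h) `^ e)^-1 * kappa ^+ 2)%R.
have h20 : (0 < ((2 * h) `^ e)%R)%R by apply: powR_gt0; rewrite mulr_gt0.
have c0 : (0 <= c)%R by rewrite mulr_ge0 ?invr_ge0 ?sqr_ge0// ltW.
(* On ]h, 2 * h] the integrand is at least the constant c. *)
apply: (@le_trans _ _ (\int[lebesgue_measure]_(x in `]h, (2 * h)%R]) c%:E)).
  rewrite integral_cst//= lebesgue_measure_itv/= lte_fin.
  have -> : (h < 2 * h)%R by rewrite ltr_pMl//; lra.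
  rewrite -EFinB -EFinM lee_fin /c.
  have -> : ((2 * h) `^ e = 2 `^ e * ((h `^ theta) ^+ 2 * h))%R.
    rewrite powRM ?(ltW h0)//; congr *%R.
    rewrite /e powRD ?(gt_eqF h0) ?implybT// (powRr1 (ltW h0)); congr *%R.
    by rewrite mulrC powRrM powR_mulrn ?powR_ge0.
  (* 16 is the square of the 4 of the statement. *)
  have h8 : (2 `^ e <= 16 :> R)%R.
    rewrite (_ : 16 = 2 `^ 4%:R)%R; last by rewrite powR_mulrn//; ring.
    by apply: ler_powR; rewrite /e; lra.
  have h9 : (0 < 2 `^ e :> R)%R by exact: powR_gt0.
  rewrite /y; move: (2 `^ e)%R (h `^ theta)%R q0 h8 h9 => z q q0 z16 z0.
  have -> : ((z * (q ^+ 2 * h))^-1 * kappa ^+ 2 * (2 * h - h) = z^-1 * (kappa / q) ^+ 2)%R.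
    by field; rewrite !gt_eqF.
  have -> : ((kappa / (4 * q)) ^+ 2 = 16^-1 * (kappa / q) ^+ 2)%R.
    by field; rewrite gt_eqF.
  by rewrite ler_wpM2r ?sqr_ge0// lef_pV2 ?posrE.
apply: ge0_le_integral_restrict => [x _|x _|x /=].
- by rewrite lee_fin.
- by rewrite mule_ge0 ?lee_fin ?powR_ge0 ?sqre_ge0.
rewrite !in_itv /= andbT => /andP[hx x2]; have x0 := lt_trans h0 hx.
split=> //; rewrite /c EFinM; apply: lee_pmul.
- by rewrite lee_fin invr_ge0 ltW.
- by rewrite lee_fin sqr_ge0.
- rewrite lee_fin -opprD powRN lef_pV2 ?posrE ?powR_gt0 ?(mulr_gt0 _ h0)//.
  apply: ge0_ler_powR => //; rewrite ?nnegrE ?mulr_ge0//; exact: ltW.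
by rewrite EFin_expe; apply: lee_pmul => //; rewrite ?lee_fin//; exact/hK/ltW.
Qed.

End Interpolation.

Section BestApproximation.
Context (R : realType) (X : completeNormedModType R) (dot : {dot X for idfun}).
Hypothesis hdot : forall x : X, dot x x = `|x| ^+ 2.
Context (a b : R).
Hypothesis ab : a < b.
Implicit Types (f g h u v w : R -> X) (phi : R -> R) (x : X) (c d : nat -> X).
Local Notation D := [set` `]a, b]].
Local Notation mu := (@lebesgue_measure R).
Local Notation L2 := (@L2 R X a b).
Local Notation bestL2 := (bestL2 dot a b).
Local Notation sobolevn := (sobolevn dot a b).
Local Notation wdern := (wdern dot a b).
Local Notation "f =ae g" := {ae mu, forall t, D t -> f t = g t}
  (at level 70, no associativity).

Let tau : R := b - a.
Let tau0 : 0 < tau. Proof. by rewrite subr_gt0. Qed.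

Local Notation H1poly := (H1poly dot a b).
Local Notation thpoly := (thpoly dot a b).

Local Notation seminormn := (seminormn dot a b).
Local Notation Kfun := (Kfun dot a b seminormn).
Local Notation interpolate := (interpolate dot a b seminormn).
Local Notation thomee := (thomee dot a b).
Local Notation L2norm := (L2norm a b).

Definition best (p : nat) w : \bar R := ereal_inf
  [set ((tau / p%:R)%:E * L2norm (wdern 1 (w \- q)%R) +
        ((tau / p%:R) ^+ 2)%:E * L2norm (wdern 2 (w \- q)%R))%E
    | q in polyT X p].

Lemma thomee_le_H1proj k w : sobolevn 2 w ->
  (L2norm (w \- thomee k.+2 w)%R <=
   L2norm (w \- H1proj dot a b k.+2 w)%R +
   (tau ^+ 2 / k.+2%:R ^+ 2)%:E * L2norm (wdern 2 w))%E.
Proof.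
move=> sw; have sw1 := sobolevnW sw; have L2w := sobolevn_L2 sw.
rewrite (thomeeE hdot ab)// (H1projE hdot ab)//.
have L2t : L2 (w \- thpoly k w)%R.
  by apply: (L2_pcomb_add hdot).
have L2h : L2 (w \- H1poly k.+2 w)%R by by apply: (L2_pcomb_add hdot).
have L2w2 := wdern_L2 hdot ab sw (k := 2) isT.
rewrite (L2normE hdot L2t) (L2normE hdot L2h) (L2normE hdot L2w2).
rewrite -EFinM -EFinD lee_fin -expr_div_n.
exact: nrm_sub_thpoly_H1poly.
Qed.

Lemma thomee_le_best k w : sobolevn 2 w ->
  (L2norm (w \- thomee k.+2 w)%R <= 2%:E * best k.+2 w)%E.
Proof.
move=> sw; have L2w := sobolevn_L2 sw.
rewrite -lee_pdivrMl//; apply: le_ereal_inf_tmp => _ [q hq <-].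
rewrite lee_pdivrMl//.
have [swq _ _] := wder_sub_polyT hdot ab hq sw.
have L2q1 := wdern_L2 hdot ab swq (k := 1) isT.
have L2q2 := wdern_L2 hdot ab swq (k := 2) isT.
have L2t : L2 (w \- thpoly k w)%R.
  by apply: (L2_pcomb_add hdot).
rewrite (thomeeE hdot ab)//.
rewrite (L2normE hdot L2t) (L2normE hdot L2q1) (L2normE hdot L2q2).
rewrite -!EFinM lee_fin.
exact: (nrm_sub_thpoly_polyT hdot ab).
Qed.

(** The bound 2 * tau / k.+1 <= 4 * (tau / k.+2) in the first seminorm and 1
    in the second give the constant 5 = 4 + 1. *)
Lemma best_le_bestL2 k w : sobolevn 2 w ->
  (best k.+2 w <= (5 * (tau / k.+2%:R) ^+ 2 * bestL2 k.+1 (wdern 2 w))%:E)%E.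
Proof.
move=> sw; have [q hq [h1 h2]] := exists_polyT hdot ab k sw.
have [swq _ _] := wder_sub_polyT hdot ab hq sw.
have L2q1 := wdern_L2 hdot ab swq (k := 1) isT.
have L2q2 := wdern_L2 hdot ab swq (k := 2) isT.
apply: ge_ereal_inf; eexists; first by exists q.
rewrite (L2normE hdot L2q1) (L2normE hdot L2q2) -!EFinM -EFinD lee_fin.
have B0 := bestL2_ge0 dot a b k.+1 (wdern 2 w).
set B := bestL2 _ _ in h1 h2 B0 *.
have H0 : 0 <= tau / k.+2%:R by rewrite divr_ge0// ltW.
have h3 : 2 * tau / k.+1%:R <= 4 * (tau / k.+2%:R).
  rewrite ler_pdivrMr ?ltr0n// (_ : 2 * tau = 2 * (tau / k.+2%:R) * k.+2%:R); last first.
    by rewrite -mulrA divfK// pnatr_eq0.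
  rewrite (_ : 4 * _ * _ = 2 * (tau / k.+2%:R) * (2 * k.+1)%:R); last first.
    by rewrite natrM; ring.
  by apply: ler_wpM2l; [rewrite mulr_ge0|rewrite ler_nat; lia].
have h4 := le_trans h1 (ler_wpM2r B0 h3).
apply: le_trans (lerD (ler_wpM2l H0 h4) (ler_wpM2l (sqr_ge0 _) h2)) _.
by rewrite le_eqVlt; apply/orP; left; apply/eqP; ring.
Qed.

Lemma best_le_integer k j w : sobolevn (2 + j) w -> (j <= k.+1)%N ->
  (best k.+2 w <= ((5 * (j.+1)`!%:R) * (tau / k.+2%:R) ^+ (2 + j))%:E *
     L2norm (wdern (2 + j) w))%E.
Proof.
move=> sw jk; have sw2 : sobolevn 2 w by apply: sobolevn_le sw; exact: leq_addr.
apply: le_trans (best_le_bestL2 k sw2) _.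
have L2wj := wdern_L2 hdot ab sw (k := 2 + j) (leqnn _).
rewrite (L2normE hdot L2wj) -EFinM lee_fin exprD.
have H0 : 0 <= tau / k.+2%:R by rewrite divr_ge0// ltW.
have h1 := bestL2_wdern hdot ab sw jk.
have h2 := bestL2_le hdot ab (k.+1 - j)%N L2wj.
have c0 : 0 <= (j.+1)`!%:R * (tau / k.+2%:R) ^+ j by rewrite mulr_ge0 ?exprn_ge0.
have c1 : 0 <= 5 * (tau / k.+2%:R) ^+ 2 by rewrite mulr_ge0 ?sqr_ge0.
apply: le_trans (ler_wpM2l c1 (le_trans h1 (ler_wpM2l c0 h2))) _.
by rewrite le_eqVlt; apply/orP; left; apply/eqP; rewrite -/tau; ring.
Qed.

(** Split w into w - v and v: the first part is bounded by its own norm, the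
    second by one more derivative of v. *)
Lemma bestL2_le_Kfun n m w (h c : R) : sobolevn m w -> 1 <= c ->
  tau / n.+1%:R <= c * h ->
  ((bestL2 n.+1 (wdern m w) / c)%:E <= Kfun m h w)%E.
Proof.
move=> sw c1 hc; apply: le_ereal_inf_tmp => _ [v sv <-].
have sv' := sobolevnW sv; have swv := sobolevnB hdot sw sv'.
have L2w := wdern_L2 hdot ab sw (k := m) (leqnn _).
have L2wv := wdern_L2 hdot ab swv (k := m) (leqnn _).
have L2v := wdern_L2 hdot ab sv (k := m) (leqnSn _).
have L2vS := wdern_L2 hdot ab sv (k := m.+1) (leqnn _).
rewrite [X in (_ <= X + _)%E](L2normE hdot L2wv).
rewrite [X in (_ <= _ + _ * X)%E](L2normE hdot L2vS) -EFinM -EFinD.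
rewrite lee_fin ler_pdivrMr ?(lt_le_trans ltr01)//.
have h2 := bestL2_triangle hdot ab n.+1 L2w L2v.
have h3 := bestL2_H1 hdot ab n (wdern_H1pair hdot ab sv (ltnSn _)).
have h4 := bestL2_le hdot ab n L2vS.
have e := wdernB hdot ab sw sv' (leqnn _).
have e1 := nrm_ae hdot L2wv (L2B hdot L2w L2v) e.
apply: le_trans h2 _; rewrite -e1 mulrDl; apply: lerD.
  by apply: ler_peMr; [exact: nrm_ge0|exact: c1].
have T0 : 0 <= (b - a) / n.+1%:R by rewrite divr_ge0// ltW.
apply: le_trans h3 _; apply: le_trans (ler_wpM2l T0 h4) _.
rewrite [leRHS]mulrAC [h * c]mulrC; apply: ler_wpM2r => //; exact: nrm_ge0.
Qed.

(** The last, fractional derivative is gained through the K-functional. It is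
    monotone in its argument, so that its value at tau / k.+2 is controlled by
    the interpolation seminorm. The constant 20 = 5 * 4 comes from
    best_le_bestL2 and interpolate_ge. *)
Lemma best_le_fractional k j theta w : sobolevn (2 + j) w -> (j <= k)%N ->
  0 <= theta <= 1 ->
  (best k.+2 w <=
     ((20 * (j.+2)`!%:R) * ((tau / k.+2%:R) ^+ (2 + j) * (tau / k.+2%:R) `^ theta))%:E *
     interpolate (2 + j) theta w)%E.
Proof.
move=> sw jk t01; have sw2 : sobolevn 2 w by apply: sobolevn_le sw; exact: leq_addr.
have H0 : 0 < tau / k.+2%:R by rewrite divr_gt0// ltr0n.
set H := tau / k.+2%:R in H0 *.
have L2wj := wdern_L2 hdot ab sw (k := 2 + j) (leqnn _).
have h1 := bestL2_wdern hdot ab sw (leqW jk).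
have B0 := bestL2_ge0 dot a b (k.+1 - j)%N (wdern (2 + j) w).
set B := bestL2 (k.+1 - j)%N _ in h1 B0.
have hK (x : R) : H <= x -> ((B / j.+2%:R)%:E <= Kfun (2 + j) x w)%E.
  move=> Hx; rewrite /B (subSn jk); apply: bestL2_le_Kfun sw _ _.
    by rewrite ler1n.
  apply: le_trans (ler_wpM2l (ler0n _ _) Hx).
  rewrite ler_pdivrMr ?ltr0n// /H.
  have -> : j.+2%:R * (tau / k.+2%:R) * (k - j).+1%:R =
      tau * ((j.+2 * (k - j).+1)%:R / k.+2%:R) by rewrite natrM; ring.
  apply: ler_peMr; first exact: ltW.
  by rewrite ler_pdivlMr ?ltr0n// mul1r ler_nat; move: jk; clear; nia.
have J := interpolate_ge t01 H0 (divr_ge0 B0 (ler0n _ _)) hK.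
apply: le_trans (best_le_bestL2 k sw2) _.
have Hn n : 0 <= H ^+ n by rewrite exprn_ge0 ?(ltW H0).
have c0 : 0 <= 5 * H ^+ 2 * ((j.+1)`!%:R * H ^+ j) * j.+2%:R.
  by apply: mulr_ge0 => //; apply: mulr_ge0; apply: mulr_ge0 => //; exact: Hn.
apply: (@le_trans _ _ ((5 * H ^+ 2 * ((j.+1)`!%:R * H ^+ j) * j.+2%:R)%:E * (B / j.+2%:R)%:E)%E).
  have e (x y z t : R) : t != 0 -> x * y * t * (z / t) = x * (y * z).
    by move=> ?; field.
  rewrite -EFinM lee_fin (e _ _ _ _ _) ?pnatr_eq0//.
  by apply: (ler_wpM2l _ h1); apply: mulr_ge0 => //; exact: Hn.
apply: le_trans (lee_wpmul2l _ J) _; first by rewrite lee_fin.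
rewrite muleA -EFinM; apply: lee_wpmul2r; first exact: poweR_ge0.
rewrite lee_fin [(j.+2)`!]factS natrM exprD le_eqVlt; apply/orP; left; apply/eqP; ring.
Qed.

End BestApproximation.

Section SeminormEstimate.
Context (R : realType) (X : completeNormedModType R) (dot : {dot X for idfun}).
Hypothesis hdot : forall x : X, dot x x = `|x| ^+ 2.
Context (a b : R).
Hypothesis ab : a < b.
Implicit Types (f g h u v w : R -> X) (phi : R -> R) (x : X) (c d : nat -> X).
Local Notation D := [set` `]a, b]].
Local Notation mu := (@lebesgue_measure R).
Local Notation "f =ae g" := {ae mu, forall t, D t -> f t = g t}
  (at level 70, no associativity).

Let tau : R := b - a.
Let tau0 : 0 < tau. Proof. by rewrite subr_gt0. Qed.

Local Notation best := (best dot a b).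

(** With s fixed, at most s + 1 derivatives are gained, so the factorials of
    the integer and fractional estimates are bounded by one that depends on s
    alone. *)
Lemma best_le_seminorm k (s : R) w (r := Num.min s k.+2%:R + 1) :
  1 <= s -> sobolev dot a b (s + 1) w ->
  (best k.+2 w <= (20 * ((Num.truncn (s + 1)).+1)`!%:R)%:E *
     (((tau / k.+2%:R) `^ r)%:E * seminorm dot a b r w))%E.
Proof.
move=> s1 [sw _]; set M := Num.truncn (s + 1) in sw *.
have /andP[Ms sM] : M%:R <= s + 1 < M.+1%:R by apply: truncn_itv; lra.
have H0 : 0 <= tau / k.+2%:R by rewrite divr_ge0// ltW.
have integer m : (2 <= m <= k.+3)%N -> (m <= M)%N -> r = m%:R ->
    (best k.+2 w <= (20 * (M.+1)`!%:R)%:E *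
      (((tau / k.+2%:R) `^ r)%:E * seminorm dot a b r w))%E.
  move=> /andP[m2 mk] mM rm; have swm := sobolevn_le mM sw.
  rewrite rm powR_mulrn// /seminorm /frac_part natrK subrr eqxx.
  move: swm mk mM; rewrite -(subnKC m2) => swm mk mM.
  have jk : (m - 2 <= k.+1)%N by rewrite -(leq_add2l 2).
  apply: le_trans (best_le_integer hdot ab swm jk) _.
  rewrite [X in (X * _ <= _)%E]EFinM -muleA; apply: lee_wpmul2r.
    by rewrite mule_ge0 ?poweR_ge0// lee_fin exprn_ge0.
  rewrite lee_fin; apply: ler_pM => //; first by lra.
  by rewrite ler_nat leq_fact//; move: mM; clear; lia.
(* For s >= p the order saturates at the integer p + 1. *)
have [ks|sk] := leP k.+2%:R s.
  apply: (integer k.+3); rewrite ?leqnn//; last first.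
    by rewrite /r min_r// natr1.
  by rewrite truncn_ge_nat; [rewrite -natr1 lerD2r|lra].
have rE : r = s + 1 by rewrite /r min_l// ltW.
have M2 : (2 <= M)%N by rewrite truncn_ge_nat; lra.
have Mk : (M <= k.+2)%N.
  by rewrite -ltnS -(@ltr_nat R); apply: le_lt_trans Ms _; rewrite -natr1 ltrD2r.
have [s0|sN0] := eqVneq (frac_part (s + 1)) 0.
  apply: (integer M); rewrite ?M2//; first exact: leqW.
  by rewrite rE; apply/eqP; rewrite -subr_eq0; apply/eqP.
rewrite rE /seminorm (negbTE sN0) -/M; set th := frac_part _.
have t01 : 0 <= th <= 1.
  by rewrite /th /frac_part -/M; rewrite -natr1 in sM; apply/andP; split; lra.
have rM : s + 1 = M%:R + th by rewrite /th /frac_part -/M; ring.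
have q0 : 0 < tau / k.+2%:R by rewrite divr_gt0// ltr0n.
rewrite rM powRD ?(gt_eqF q0) ?implybT// powR_mulrn//.
move: sw Mk; rewrite -(subnKC M2) => sw Mk.
have jk : (M - 2 <= k)%N by rewrite -(leq_add2l 2).
apply: le_trans (best_le_fractional hdot ab sw jk t01) _.
rewrite [X in (X * _ <= _)%E]EFinM -muleA; apply: lee_wpmul2r.
  by rewrite mule_ge0 ?poweR_ge0// lee_fin mulr_ge0 ?exprn_ge0 ?powR_ge0.
rewrite lee_fin; apply: ler_wpM2l => //.
by rewrite ler_nat leq_fact// add2n leqnSn.
Qed.

Lemma best_ge0 p w : (0 <= best p w)%E.
Proof.
apply: le_ereal_inf_tmp => _ [q _ <-]; have t0 := ltW tau0.
by rewrite adde_ge0// mule_ge0 ?poweR_ge0// lee_fin ?sqr_ge0// divr_ge0.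
Qed.

End SeminormEstimate.

Theorem proposition2p5 (R : realType) (X : completeNormedModType R)
    (dot : {dot X for idfun}) (hdot : forall x : X, dot x x = `|x| ^+ 2)
    (s : R) (hs : 1 <= s) :
  exists C : R, 0 < C /\
  forall (T : R) (N : nat) (t : nat -> R) (p : nat -> nat),
    time_grid T N t ->
    (forall n, (1 <= n <= N)%N -> (2 <= p n)%N) ->
  forall n, (1 <= n <= N)%N ->
    let a := t n.-1 in let b := t n in
    let P := thomee dot a b (p n) in
    let h := (b - a) / (p n)%:R in
    let best (w : R -> X) := ereal_inf
      [set (h%:E * L2norm a b (wdern dot a b 1 (w \- q)%R) +
            (h ^+ 2)%:E * L2norm a b (wdern dot a b 2 (w \- q)%R))%E
          | q in polyT X (p n)] in
    (forall q, polyT X (p n) q -> forall r, r \in `]a, b] -> P q r = q r) /\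
    forall w : R -> X, sobolev dot a b (s + 1) w ->
      [/\ (L2norm a b (w \- P w)%R <=
             C%:E * (L2norm a b (w \- H1proj dot a b (p n) w)%R +
               ((b - a) ^+ 2 / (p n)%:R ^+ 2)%:E *
                 L2norm a b (wdern dot a b 2 w)))%E,
          (L2norm a b (w \- P w)%R <= C%:E * best w)%E &
          (best w <= C%:E * ((h `^ (Num.min s (p n)%:R + 1))%:E *
             seminorm dot a b (Num.min s (p n)%:R + 1) w))%E].
Proof.
pose C : R := 20 * ((Num.truncn (s + 1)).+1)`!%:R.
have C20 : 20 <= C by rewrite ler_peMr// ler1n fact_gt0.
exists C; split; first by apply: lt_le_trans C20.
move=> T N t p [_ _ tS] hp n hn a b P h best.
have ab : a < b.
  by move: hn => /andP[n0 nN]; rewrite /a /b -{2}(prednK n0); apply: tS; rewrite prednK.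
move: (hp n hn) @P @h @best; move: (p n) => [|[|k]] // _ P h best.
split=> [q hq r _|w hw]; first by rewrite /P (thomee_polyT hdot ab).
have sw2 : sobolevn dot a b 2 w.
  have [sw _] := hw; apply: sobolevn_le sw.
  by rewrite truncn_ge_nat; lra.
split.
- apply: le_trans (thomee_le_H1proj hdot ab k sw2) _; apply: lee_pemull.
    by rewrite adde_ge0 ?mule_ge0 ?poweR_ge0// lee_fin divr_ge0 ?sqr_ge0.
  by rewrite lee_fin; apply: le_trans C20; lra.
- apply: le_trans (thomee_le_best hdot ab k sw2) _; apply: lee_wpmul2r.
    exact: (best_ge0 dot ab).
  by rewrite lee_fin; apply: le_trans C20; lra.
exact: (best_le_seminorm hdot ab k hs hw).
Qed.
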